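(* Let $R,R_1>0$, let $\Omega_1\subset B_{R_1}\subset\mathbb{R}^2$ be a convex body containing the origin, with support function $h_1$, and set $$M=\frac1{2\pi}\int_0^{2\pi}\bigl(h_1(\theta)-R\bigr)\,d\theta=\frac{\operatorname{Per}(\Omega_1)-\operatorname{Per}(B_R)}{2\pi},\qquad c_R=R\,u_2'(R)^2e^{-R^2/2}.$$ Then there exist $t_1,C>0$ depending only on $R$ and $R_1$ such that $$T_\gamma\bigl((1-t)B_R+t\Omega_1\bigr)\ge T_\gamma(B_R)+c_RMt-Ct^2\qquad\text{for }0<t\le t_1 .$$ In particular, if $\operatorname{Per}(\Omega_1)>2\pi R$, then $T_\gamma((1-t)B_R+t\Omega_1)>T_\gamma(B_R)$ for all sufficiently small $t>0$.
   Context: $\gamma$ is the standard Gaussian measure on $\mathbb{R}^2$, $d\gamma=(2\pi)^{-1}e^{-|x|^2/2}\,dx$. For a bounded open set $\Omega\subset\mathbb{R}^2$, the torsion function $u_\Omega$ is the solution of $\Delta u-x\cdot\nabla u=-1$ in $\Omega$, $u=0$ on $\partial\Omega$, and $T_\gamma(\Omega)=\int_\Omega u_\Omega\,d\gamma$. A convex body $K$ is a compact convex set with nonempty interior, and $T_\gamma(K):=T_\gamma(\operatorname{int}K)$. $B_R$ is the (closed) ball of radius $R$ centered at the origin. $\operatorname{Per}$ is the perimeter. The support function of $K$ is $h_K(\theta)=\max_{z\in K}z\cdot(\cos\theta,\sin\theta)$, and $h_1=h_{\Omega_1}$. Sums and multiples of sets are in the Minkowski sense. The function $u_2$ is the solution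 of $u_2''+\frac1r u_2'-ru_2'=-1$, $u_2(0)=u_2'(0)=0$, so that $u_2'(r)=-\dfrac{e^{r^2/2}-1}{r}$. *)

(* Defs.v *)
From HB Require Import structures.
From mathcomp Require Import all_boot all_order all_algebra.
From mathcomp Require Import all_classical all_reals all_analysis.

Set Implicit Arguments.
Unset Strict Implicit.
Unset Printing Implicit Defensive.

Import Order.TTheory GRing.Theory Num.Theory.
Import numFieldNormedType.Exports.

Local Open Scope classical_set_scope.
Local Open Scope ring_scope.

Section plane.
Variable R : realType.

(* The library norm on [R * R] is the sup norm: it serves only for the topology
   and the differential calculus; metric notions use [enorm]. *)
Definition dotp (x y : R * R) : R := x.1 * y.1 + x.2 * y.2.
Definition enorm (x : R * R) : R := Num.sqrt (dotp x x).

Definition disk (r : R) : set (R * R) := [set x | enorm x <= r].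

Definition scale_set (a : R) (A : set (R * R)) : set (R * R) :=
  [set a *: x | x in A].
Definition sum_set (A B : set (R * R)) : set (R * R) :=
  [set x + y | x in A & y in B].

Definition convex_body (K : set (R * R)) : Prop :=
  [/\ compact K, convex_set K & K° !=set0].

Definition support_fun (K : set (R * R)) (theta : R) : R :=
  sup [set dotp z (cos theta, sin theta) | z in K].

Definition leb2 := (@lebesgue_measure R \x @lebesgue_measure R)%E.

Definition gauss (x : R * R) : R := (2 * pi)^-1 * expR (- enorm x ^+ 2 / 2).

Definition d1 (f : R * R -> R) (x : R * R) : R := 'D_(1, 0) f x.
Definition d2 (f : R * R -> R) (x : R * R) : R := 'D_(0, 1) f x.

(* C^1 functions on the plane with compact support contained in [Omega]. *)
Definition C1c (Omega : set (R * R)) (f : R * R -> R) : Prop :=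
  [/\ forall x, differentiable f x, continuous (d1 f), continuous (d2 f),
      compact (closure [set x | f x != 0]) &
      closure [set x | f x != 0] `<=` Omega].

(* Convergence in L^2(Omega, gamma). The cast selects the sigma-algebra on which
   [leb2] is defined. *)
Definition cvgL2 (Omega : set (R * R)) (f : nat -> R * R -> R)
    (g : R * R -> R) : Prop :=
  measurable_fun (Omega : set (measurableTypeR R * measurableTypeR R)) g /\
  (\int[leb2]_(x in Omega) ((f n x - g x) ^+ 2 * gauss x)%:E)%E
    @[n --> \oo] --> 0%E.

(* [u] belongs to H^1_0(Omega, gamma), the closure of C^1_c(Omega) in
   H^1(Omega, gamma), with weak gradient [(g1, g2)]. *)
Definition H10 (Omega : set (R * R)) (u g1 g2 : R * R -> R) : Prop :=
  exists f : nat -> R * R -> R,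
    [/\ forall n, C1c Omega (f n), cvgL2 Omega f u,
        cvgL2 Omega (fun n => d1 (f n)) g1 &
        cvgL2 Omega (fun n => d2 (f n)) g2].

(* [u] is the weak solution of Delta u - x . grad u = -1 in Omega, u = 0 on the
   boundary; since (Delta u - x . grad u) gauss = div (gauss grad u), the weak
   form against test functions is the one below. On an arbitrary bounded open
   set the boundary condition can only be required in the H^1_0 sense. *)
Definition is_torsion_fun (Omega : set (R * R)) (u : R * R -> R) : Prop :=
  exists g1 g2 : R * R -> R, H10 Omega u g1 g2 /\
    forall phi, C1c Omega phi ->
      \int[leb2]_(x in Omega) ((g1 x * d1 phi x + g2 x * d2 phi x) * gauss x) =
      \int[leb2]_(x in Omega) (phi x * gauss x).

Definition torsion_fun (Omega : set (R * R)) : R * R -> R :=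
  xget (cst 0) [set u | is_torsion_fun Omega u].

Definition Tgamma (Omega : set (R * R)) : R :=
  \int[leb2]_(x in Omega) (torsion_fun Omega x * gauss x).

Definition Tgamma_body (K : set (R * R)) : R := Tgamma K°.

(* De Giorgi perimeter. *)
Definition perimeter (K : set (R * R)) : \bar R :=
  ereal_sup [set e | exists X1 X2 : R * R -> R,
    [/\ C1c setT X1, C1c setT X2,
        forall x, enorm (X1 x, X2 x) <= 1 &
        e = (\int[leb2]_(x in K) (d1 X1 x + d2 X2 x))%:E]].

(* The initial conditions are one-sided, as [u] only matters on [0, +oo[. *)
Definition is_u2 (u : R -> R) : Prop :=
  [/\ forall r : R, 0 < r -> derivable u r 1 /\ derivable (derive1 u) r 1,
      forall r : R, 0 < r ->
        derive1 (derive1 u) r + r^-1 * derive1 u r - r * derive1 u r = -1,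
      u 0 = 0 &
      (u h - u 0) / h @[h --> 0^'+] --> 0].

End plane.

(* Main.v *)
(** The torsional rigidity is [max (2 \int phi dgamma - \int |grad phi|^2 dgamma)]
    over C^1_c, so a test function bounds it from below, and any field [V] with
    [div (gauss V) = - gauss] bounds it from above by [\int |V|^2 dgamma].

    With [K = t Omega1], the body [(1 - t) B_r + t Omega1] is the parallel body
    of [K] at distance [rho = (1 - t) r]. The test function is radial in the
    distance [d] to [K], with profile close to [u_2 d - u_2 rho]. Writing
    [x = resid + proj], one has [|x|^2 = d^2 + 2 resid . proj + O(t^2)]; the
    first-order term [f(d) resid . proj] is integrated by the divergence
    theorem, because [f(d) resid] is a gradient, and the Steiner formula turns
    everything into integrals over [[0, rho]] against [mwidth K + 2 pi s], which
    are explicit. For the disk, the field [grad u_2] gives the matching upper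
    bound.

    The Steiner formula follows from [4 |v| = \int |v . (cos th, sin th)| dth]:
    along a line, a decreasing function of the distance to [K] has total
    variation twice its maximum. It also identifies the De Giorgi perimeter of a
    convex body with the integral of its support function. *)

From HB Require Import structures.
Require Import Defs.
From mathcomp Require Import all_boot all_order all_algebra.
From mathcomp Require Import all_classical all_reals all_analysis.
From mathcomp Require Import measurable_realfun.
From mathcomp Require Import ring lra.
Set Implicit Arguments.
Unset Strict Implicit.
Unset Printing Implicit Defensive.
Import Order.TTheory GRing.Theory Num.Theory.
Import numFieldNormedType.Exports.
Local Open Scope classical_set_scope.
Local Open Scope ring_scope.

(** * Integration over the plane *)

Section plane_integral.
Context {R : realType}.
Notation mu := (@lebesgue_measure R).
Notation T2 := (measurableTypeR R * measurableTypeR R)%type.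
Implicit Types f g : R * R -> R.

(** Convexity gives little smoothness: the distance to [K] has a kink on the boundary, and its
    square is C^1 but in general not C^2. Everything is therefore written through [sqd K], whose
    gradient is [2 *: resid K], and [resid K] itself is never differentiated. [torsion_fun] is a
    choice among weak solutions. Both variational bounds hold for whichever one is chosen, once a
    solution is known to exist. The constant c_R is [kp r]. The width of [K] enters with weight
    [kp rho / (2 * pi)], and passing from [r] to [rho = (1 - t) * r] in the integral of [kp] costs
    at most [t * r * kp r]; together these make [kp r] times M, up to t^2. The remaining errors are
    uniform in Omega1, since they are controlled by [t * R1], which bounds the size of [K]. They are
    the Taylor remainder of the gaussian weight, of order (t R1)^2; the effect of a cut-off layer of
    width of order t^2, present because a test function has to vanish near the boundary; and the
    variation of [kp] between [rho] and [r]. *)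

Lemma open_rational_box (A : set (R * R)) : open A ->
  A = \bigcup_(q in [set q : (rat * rat) * (rat * rat) |
     `]ratr q.1.1, ratr q.1.2[ `*` `]ratr q.2.1, ratr q.2.2[ `<=` A])
     (`]ratr q.1.1, ratr q.1.2[%classic `*` `]ratr q.2.1, ratr q.2.2[%classic).
Proof.
move=> oA; apply/seteqP; split=> [[x y] Axy|[x y] [q /= qA xyq]]; last exact: qA.
have [e /= e0 He] : nbhs_ball ((x, y) : R * R) A.
  by apply/nbhs_ballP; exact: open_nbhs_nbhs.
have ex (z : R) : exists q : rat * rat, [/\ ratr q.1 < z, z < ratr q.2,
    z - e < ratr q.1 & ratr q.2 < z + e].
  have [q1] := @rat_in_itvoo _ (z - e) z ltac:(lra).
  have [q2] := @rat_in_itvoo _ z (z + e) ltac:(lra).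
  rewrite !in_itv/= => /andP[h1 h2] /andP[h3 h4].
  by exists (q1, q2).
have [[p1 p2] [a1 a2 a3 a4]] := ex x.
have [[q1 q2] [b1 b2 b3 b4]] := ex y.
exists ((p1, p2), (q1, q2)); last by rewrite /= !in_itv/= a1 a2 b1 b2.
move=> [u v] /=; rewrite !in_itv/= => -[/andP[u1 u2] /andP[v1 v2]].
apply: He; split; rewrite /ball/= ltr_norml; simpl in *; lra.
Qed.

(** The sigma-algebra is the one generated by measurable rectangles; an open set enters it as a
    countable union of rational boxes. *)
Lemma open_measurable2 (A : set (R * R)) : open A -> measurable (A : set T2).
Proof.
move=> /open_rational_box ->; rewrite bigcup_mkcond.
apply: countable_bigcupT_measurable => // q; case: ifPn => // _.
by apply: measurableX; exact: measurable_itv.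
Qed.

Lemma closed_measurable2 (A : set (R * R)) : closed A -> measurable (A : set T2).
Proof. by move/closed_openC/open_measurable2/measurableC; rewrite setCK. Qed.

Lemma continuous_measurable2 f : continuous f -> measurable_fun (setT : set T2) f.
Proof.
move=> /continuousP cf; apply: (measurability _ (RGenOpens.measurableE R)).
move=> _ [_ [a [b ->] <-]]; rewrite setTI; apply: open_measurable2.
exact/cf/interval_open.
Qed.

(** Bounded, measurable and zero off a box. The class is stable under sums and under products with
    continuous functions, and its members are integrable, so the rules for [I2] need no separate
    integrability argument. *)
Definition bmc f := measurable_fun (setT : set T2) f /\
  exists L M : R, [/\ 0 < L, forall x, `|f x| <= M &
    forall x, f x != 0 -> `|x.1| <= L /\ `|x.2| <= L].

Definition box (L : R) : set (R * R) := `[-L, L] `*` `[-L, L].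

Lemma measurable_box L : measurable (box L : set T2).
Proof. by apply: measurableX; exact: measurable_itv. Qed.

Lemma in_box L x : box L x <-> `|x.1| <= L /\ `|x.2| <= L.
Proof. by rewrite /box /= !in_itv/= !ler_norml. Qed.

Lemma leb2_box (L : R) : 0 < L -> @leb2 R (box L) = ((2 * L) ^+ 2)%:E.
Proof.
move=> L0; rewrite /leb2 product_measure1E//=.
have -> : mu `[-L, L] = (2 * L)%:E.
  rewrite lebesgue_measure_itv/= lte_fin; case: ifPn => [_|].
      by rewrite -EFinD; congr EFin; ring.
  by move=> /negP[]; lra.
by rewrite -EFinM.
Qed.

Lemma bmc_int f : bmc f -> (@leb2 R).-integrable setT (EFin \o f).
Proof.
move=> [mf [L [M [L0 fM fL]]]].
rewrite (_ : EFin \o f = (EFin \o f) \_ (box L)); last first.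
  apply/funext => x; rewrite patchE; case: ifPn => //.
  move=> /negP xL; rewrite /=; case: (eqVneq (f x) 0) => [->//|/fL xL'].
  by exfalso; apply: xL; apply/mem_set/in_box.
apply/(integrable_mkcond _ (measurable_box L)).
apply: measurable_bounded_integrable.
- exact: measurable_box.
- by rewrite [X in (X < _)%E](leb2_box L0) ltry.
- by apply: measurable_funS mf.
- exists M; split; first by rewrite num_real.
  by move=> N MN x _; exact: le_trans (fM _) (ltW MN).
Qed.

Definition I2 f := \int[@leb2 R]_x f x.

Lemma bmcD f g : bmc f -> bmc g -> bmc (fun x => f x + g x).
Proof.
move=> [mf [L [M [L0 fM fL]]]] [mg [L' [M' [L'0 gM gL]]]]; split.
  exact: measurable_funD.
exists (Num.max L L'), (M + M'); split => [|x|x].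
- by rewrite lt_max L0.
- by rewrite (le_trans (ler_normD _ _))// lerD.
- case: (eqVneq (f x) 0) => [->|/fL[h1 h2] _]; last by rewrite !le_max h1 h2.
  by rewrite add0r => /gL[h1 h2]; rewrite !le_max h1 h2 !orbT.
Qed.

Lemma bmcM f g : bmc f -> measurable_fun (setT : set T2) g ->
  (forall L : R, exists M : R, forall x, box L x -> `|g x| <= M) ->
  bmc (fun x => f x * g x).
Proof.
move=> [mf [L [M [L0 fM fL]]]] mg gb; split; first exact: measurable_funM.
have [M' gM] := gb L.
exists L, (M * M'); split => // x; last first.
  by move=> h; apply: fL; apply: contra_neq h => ->; rewrite mul0r.
case: (eqVneq (f x) 0) => [->|fx0].
  rewrite mul0r normr0 mulr_ge0//; first exact: le_trans (fM x).
  apply: le_trans (gM (0,0) _) => //.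
  by apply/in_box; rewrite /= normr0 !ltW.
by rewrite normrM ler_pM// gM//; exact/in_box/fL.
Qed.

Lemma bmc_cont f g : bmc f -> continuous g -> bmc (fun x => f x * g x).
Proof.
move=> bf cg; apply: bmcM => //; first exact: continuous_measurable2.
move=> L; have cK : compact (box L).
  by apply: compact_setX; exact: segment_compact.
have : compact (g @` box L).
  apply: continuous_compact => //; exact: continuous_subspaceT.
move=> /compact_bounded[M [_ Mb]].
by exists (M + 1) => x Lx; apply: (Mb (M + 1) ltac:(lra)); exists x.
Qed.

Lemma bmc_bounded f g M : bmc f -> measurable_fun (setT : set T2) g ->
  (forall x, `|g x| <= M) -> bmc (fun x => f x * g x).
Proof. by move=> bf mg gM; apply: bmcM => // L; exists M. Qed.

Lemma bmcZ a f : bmc f -> bmc (fun x => a * f x).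
Proof.
move=> bf; rewrite (_ : (fun _ => _) = (fun x => f x * cst a x)).
  by apply: (bmc_bounded (M := `|a|)).
by apply/funext => x; rewrite mulrC.
Qed.

Lemma bmcN f : bmc f -> bmc (fun x => - f x).
Proof.
by move=> /(bmcZ (-1)); rewrite (_ : (fun _ => _) = (fun x => - f x))//;
   apply/funext => x; rewrite mulN1r.
Qed.

Lemma bmcB f g : bmc f -> bmc g -> bmc (fun x => f x - g x).
Proof. by move=> bf /bmcN; exact: bmcD. Qed.

Lemma bmc_indic A f : measurable (A : set T2) -> bmc f ->
  bmc (fun x => f x * \1_A x).
Proof.
move=> mA bf; apply: (bmc_bounded (M := 1)) => //.
by move=> x; rewrite indicE; case: (_ \in _); rewrite ?normr1 ?normr0.
Qed.

Lemma bmc_box L : bmc \1_(box L).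
Proof.
split; first by apply: measurable_indic; exact: measurable_box.
exists (Num.max L 1), 1; split=> [|x|x]; first by rewrite lt_max ltr01 orbT.
  by rewrite indicE; case: (_ \in _); rewrite ?normr1 ?normr0.
rewrite indicE; case: (boolP (x \in box L)) => [|_]; last by rewrite eqxx.
by move=> /set_mem/in_box[h1 h2] _; rewrite !le_max h1 h2.
Qed.

Lemma bmc_le f g : measurable_fun (setT : set T2) f -> bmc g ->
  (forall x, `|f x| <= `|g x|) -> bmc f.
Proof.
move=> mf [mg [L [M [L0 gM gL]]]] fg; split => //; exists L, M; split => // x.
  exact: le_trans (fg x) (gM x).
move=> f0; apply: gL; apply: contra_neq f0 => g0.
by apply/eqP; rewrite -normr_le0 (le_trans (fg x))// g0 normr0.
Qed.

Lemma bmc_norm f : bmc f -> bmc (fun x => `|f x|).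
Proof.
move=> bf; apply: (bmc_le _ bf) => [|x]; last by rewrite normr_id.
by apply: measurableT_comp => //; exact: bf.1.
Qed.

Lemma I2D f g : bmc f -> bmc g -> I2 (fun x => f x + g x) = I2 f + I2 g.
Proof. by move=> /bmc_int bf /bmc_int bg; rewrite /I2 RintegralD. Qed.

Lemma I2B f g : bmc f -> bmc g -> I2 (fun x => f x - g x) = I2 f - I2 g.
Proof. by move=> /bmc_int bf /bmc_int bg; rewrite /I2 RintegralB. Qed.

Lemma I2Z a f : bmc f -> I2 (fun x => a * f x) = a * I2 f.
Proof. by move=> /bmc_int bf; rewrite /I2 RintegralZl. Qed.

Lemma I2N f : bmc f -> I2 (fun x => - f x) = - I2 f.
Proof.
move=> bf; rewrite -mulN1r -I2Z//; congr I2.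
by apply/funext => x; rewrite mulN1r.
Qed.

Lemma I2_le f g : bmc f -> bmc g -> (forall x, f x <= g x) -> I2 f <= I2 g.
Proof. by move=> /bmc_int bf /bmc_int bg fg; apply: le_Rintegral. Qed.

Lemma I2_ge0 f : (forall x, 0 <= f x) -> 0 <= I2 f.
Proof. by move=> f0; apply: Rintegral_ge0. Qed.

Lemma I2_box (L : R) : 0 < L -> I2 \1_(box L) = (2 * L) ^+ 2.
Proof.
move=> L0; rewrite /I2 /Rintegral integral_indic ?setIT//; last exact: measurable_box.
by rewrite [X in fine X](leb2_box L0).
Qed.

Lemma I2_fin f : bmc f -> (\int[@leb2 R]_x (f x)%:E)%E = (I2 f)%:E.
Proof. by move=> /bmc_int bf; rewrite /I2 /Rintegral fineK//; exact: integrable_fin_num. Qed.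

Lemma I2_mkcond (A : set (R * R)) f :
  \int[@leb2 R]_(x in A) f x = I2 (fun x => f x * \1_A x).
Proof.
rewrite Rintegral_mkcond; congr Rintegral; apply/funext => x.
by rewrite patchE indicE; case: (_ \in _); rewrite ?mulr1 ?mulr0.
Qed.

Lemma I2_fubini f : bmc f -> I2 f = \int[mu]_x \int[mu]_y f (x, y).
Proof.
move=> /bmc_int bf; rewrite /I2 {1 2}/Rintegral; congr fine.
rewrite /leb2 -integral12_prod_meas1//.
(* The real inner integral is [fine] of the extended one; the two agree wherever the slice is
   integrable, which is almost everywhere. *)
apply: ae_eq_integral => //.
- by have := measurable_fubini_F bf.
- apply/measurable_EFinP; apply: measurableT_comp => //.
  by have := measurable_fubini_F bf.
- have := ae_integrable1 bf; apply: filterS => x ix _.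
  by rewrite /Rintegral fineK//; exact: integrable_fin_num.
Qed.

Lemma I2_fubini' f : bmc f -> I2 f = \int[mu]_y \int[mu]_x f (x, y).
Proof.
move=> /bmc_int bf; rewrite /I2 {1 2}/Rintegral; congr fine.
rewrite /leb2 -integral21_prod_meas1//.
apply: ae_eq_integral => //.
- by have := measurable_fubini_G bf.
- apply/measurable_EFinP; apply: measurableT_comp => //.
  by have := measurable_fubini_G bf.
- have := ae_integrable2 bf; apply: filterS => x ix _.
  by rewrite /Rintegral fineK//; exact: integrable_fin_num.
Qed.

End plane_integral.

(** * Differential calculus in the plane *)

Section plane_calculus.
Context {R : realType}.
Notation mu := (@lebesgue_measure R).
Notation T2 := (measurableTypeR R * measurableTypeR R)%type.
Implicit Types f g : R * R -> R.

Lemma continuous_pair (T U V : topologicalType) (f : T -> U) (g : T -> V) :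
  continuous f -> continuous g -> continuous (fun x => (f x, g x)).
Proof. by move=> cf cg x; exact: (cvg_pair (cf x) (cg x)). Qed.

Lemma cts_add (T : topologicalType) (f g : T -> R) :
  continuous f -> continuous g -> continuous (fun x => f x + g x).
Proof. by move=> cf cg x; exact: (cvgD (cf x) (cg x)). Qed.

Lemma cts_mul (T : topologicalType) (f g : T -> R) :
  continuous f -> continuous g -> continuous (fun x => f x * g x).
Proof. by move=> cf cg x; exact: (cvgM (cf x) (cg x)). Qed.

Lemma cts_opp (T : topologicalType) (f : T -> R) :
  continuous f -> continuous (fun x => - f x).
Proof. by move=> cf x; exact: (cvgN (cf x)). Qed.

Lemma cts_cst (T : topologicalType) (a : R) : continuous (fun _ : T => a).
Proof. by move=> x; exact: cvg_cst. Qed.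

Lemma Rintegral_segment (f : R -> R) (a b : R) :
  (forall x, f x != 0 -> a <= x <= b) -> \int[mu]_x f x = \int[mu]_(x in `[a, b]) f x.
Proof.
move=> fab; rewrite [RHS]Rintegral_mkcond; congr Rintegral.
apply/funext => x; rewrite patchE; case: ifPn => // /negP xab.
case: (eqVneq (f x) 0) => // /fab h; exfalso; apply: xab.
by apply/mem_set; rewrite /= in_itv.
Qed.

Lemma Rintegral_null (f : R -> R) z : (forall x, x != z -> f x = 0) ->
  \int[mu]_x f x = 0.
Proof.
move=> fz; rewrite -[RHS](Rintegral_set1 f z) [RHS]Rintegral_mkcond.
congr Rintegral; apply/funext => x; rewrite patchE.
by case: ifPn => //; rewrite notin_setE /= => /eqP/fz.
Qed.

Lemma is_derive_continuous (F : R -> R) (x d : R) : is_derive x 1 F d -> {for x, continuous F}.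
Proof. by move=> h; apply: differentiable_continuous; apply/derivable1_diffP; exact: ex_derive. Qed.

Lemma FTC_segment (f F : R -> R) (a b : R) : a <= b ->
  (forall x : R, is_derive x 1 F (f x)) -> continuous f ->
  \int[mu]_(x in `[a, b]) f x = F b - F a.
Proof.
rewrite le_eqVlt => /predU1P[->|ab] dF cf.
  by rewrite set_itv1 Rintegral_set1 subrr.
rewrite /Rintegral (@continuous_FTC2 _ f F a b ab) //.
- exact: continuous_subspaceT.
- split.
  + by move=> x _; apply: ex_derive.
  + by apply: cvg_at_right_filter; apply: is_derive_continuous (dF a).
  + by apply: cvg_at_left_filter; apply: is_derive_continuous (dF b).
- by move=> x _; rewrite derive1E; apply: derive_val.
Qed.

Lemma integral_derive_0 (F f : R -> R) (L : R) : 0 <= L ->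
  (forall x : R, is_derive x 1 F (f x)) -> continuous f ->
  (forall x, L < `|x| -> F x = 0) -> \int[mu]_x f x = 0.
Proof.
move=> L0 dF cf FL.
(* The margin 1 puts a whole neighbourhood of [x] where [F] vanishes, so that the derivative
   vanishes at [x] as well. *)
have fL x : f x != 0 -> - (L + 1) <= x <= L + 1.
  move=> fx; rewrite -ler_norml leNgt; apply/negP => Lx.
  move: fx => /eqP; apply.
  have <- : 'D_1 F x = f x by apply: derive_val.
  rewrite -(derive_cst (0 : R) x (1 : R)); apply: near_eq_derive.
  have : \forall y \near x, `|x - y| < 1 by exact: (@cvgr_dist_lt _ _ _ _ _ id x (@cvg_id _ (nbhs x)) 1 ltr01).
  apply: filterS => y xy; apply: FL.
  have := ler_normD (x - y) y; rewrite subrK; lra.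
rewrite (Rintegral_segment fL) (@FTC_segment f F)//; last lra.
by rewrite !FL ?subrr// ?normrN; have := ler_norm (L + 1); lra.
Qed.

Lemma I2_derive1_0 (F g : R * R -> R) z (L : R) : 0 <= L -> bmc g ->
  (forall x y : R, y != z -> is_derive x 1 (fun s => F (s, y)) (g (x, y))) ->
  (forall y, y != z -> continuous (fun x => g (x, y))) ->
  (forall x y, L < `|x| -> F (x, y) = 0) -> I2 g = 0.
Proof.
move=> L0 bg dF cg FL; rewrite (I2_fubini' bg) (Rintegral_null (z := z))// => y yz.
by apply: (@integral_derive_0 (fun s => F (s, y)) _ L) => //; [move=> x; exact: dF|exact: cg|
  move=> x; exact: FL].
Qed.

Lemma I2_derive2_0 (F g : R * R -> R) z (L : R) : 0 <= L -> bmc g ->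
  (forall x y : R, x != z -> is_derive y 1 (fun s => F (x, s)) (g (x, y))) ->
  (forall x, x != z -> continuous (fun y => g (x, y))) ->
  (forall x y, L < `|y| -> F (x, y) = 0) -> I2 g = 0.
Proof.
move=> L0 bg dF cg FL; rewrite (I2_fubini bg) (Rintegral_null (z := z))// => y yz.
by apply: (@integral_derive_0 (fun s => F (y, s)) _ L) => //; [move=> x; exact: dF|exact: cg|
  move=> x; exact: FL].
Qed.

(** Differentials are recorded by their gradient for [dotp]; the sup norm underneath only fixes the
    topology. *)
Definition grad f (x p : R * R) := is_diff x f (fun v => dotp p v).

Lemma grad_differentiable f x p : grad f x p -> differentiable f x.
Proof. by move=> df; exact: (@ex_diff _ _ _ _ _ _ _ df). Qed.

Lemma grad_continuous f x p : grad f x p -> {for x, continuous f}.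
Proof. by move/grad_differentiable/differentiable_continuous. Qed.

Lemma grad_derive f x p v : grad f x p -> 'D_v f x = dotp p v.
Proof.
move=> df; rewrite deriveE; first by rewrite (@diff_val _ _ _ _ _ _ _ df).
exact: grad_differentiable df.
Qed.

Lemma grad_d1 f x p : grad f x p -> d1 f x = p.1.
Proof. by move=> /grad_derive; rewrite /d1 => ->; rewrite /dotp/=; ring. Qed.

Lemma grad_d2 f x p : grad f x p -> d2 f x = p.2.
Proof. by move=> /grad_derive; rewrite /d2 => ->; rewrite /dotp/=; ring. Qed.

Lemma grad_eq f x p p' : grad f x p -> p = p' -> grad f x p'.
Proof. by move=> + <-. Qed.

Lemma differentiable_grad f x : differentiable f x -> grad f x (d1 f x, d2 f x).
Proof.
move=> df; apply: DiffDef => //; apply/funext => -[v1 v2].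
rewrite /dotp/= /d1 /d2 !deriveE//.
rewrite -[in RHS](mulrC v1) -[in RHS](mulrC v2) -[v1 * _]/(v1 *: _) -[v2 * _]/(v2 *: _).
rewrite -!linearZ -linearD; congr ('d f x _).
by apply/pair_equal_spec; split; rewrite /= /GRing.scale/= !(mulr1, mulr0, addr0, add0r).
Qed.

Lemma grad_cst a x : grad (cst a) x (0, 0).
Proof.
apply: (is_diff_eq (is_diff_cst a x)).
by apply/funext => -[u v]; rewrite /dotp/= !mul0r addr0.
Qed.

Lemma gradD f g x p q : grad f x p -> grad g x q -> grad (fun y => f y + g y) x (p + q).
Proof.
move=> df dg; apply: (is_diff_eq (is_diffD df dg)).
by apply/funext => -[u v]; rewrite /dotp !fctE/=; ring.
Qed.

Lemma gradN f x p : grad f x p -> grad (fun y => - f y) x (- p).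
Proof.
move=> df; apply: (is_diff_eq (is_diffN df)).
by apply/funext => -[u v]; rewrite /dotp !fctE/=; ring.
Qed.

Lemma gradB f g x p q : grad f x p -> grad g x q -> grad (fun y => f y - g y) x (p - q).
Proof. by move=> df /gradN; exact: gradD. Qed.

Lemma gradM f g x p q : grad f x p -> grad g x q ->
  grad (fun y => f y * g y) x (f x *: q + g x *: p).
Proof.
move=> df dg; apply: (is_diff_eq (is_diffM df dg)).
by apply/funext => -[u v]; rewrite /dotp !fctE/= /GRing.scale/=; ring.
Qed.

Lemma gradZ a f x p : grad f x p -> grad (fun y => a * f y) x (a *: p).
Proof.
move=> df; apply: (is_diff_eq (is_diffZ a df)).
by apply/funext => -[u v]; rewrite /dotp !fctE/= /GRing.scale/=; ring.
Qed.

Lemma is_derive_is_diff (h : R -> R) (x d : R) : is_derive x 1 h d ->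
  is_diff x h ( *%R d).
Proof.
move=> dh; have ex : derivable h x 1 by apply: ex_derive.
apply: DiffDef; first exact/derivable1_diffP.
rewrite deriv1E// derive1E derive_val; apply/funext => y.
by rewrite /GRing.scale/= mulrC.
Qed.

Lemma is_diff_is_derive (h : R -> R) (x d : R) : is_diff x h ( *%R d) ->
  is_derive x 1 h d.
Proof.
move=> dh; have df := @ex_diff _ _ _ _ _ _ _ dh.
apply: DeriveDef; first exact: diff_derivable.
by rewrite deriveE// diff_val mulr1.
Qed.

Lemma grad_comp (h : R -> R) f x p (d : R) : grad f x p -> is_derive (f x) 1 h d ->
  grad (fun y => h (f y)) x (d *: p).
Proof.
move=> df /is_derive_is_diff dh; apply: (is_diff_eq (is_diff_comp df dh)).
by apply/funext => -[u v]; rewrite /dotp /= /GRing.scale/=; ring.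
Qed.

Lemma grad_line f (q v p : R * R) s : grad f (q + s *: v) p ->
  is_derive s 1 (fun s : R => f (q + s *: v)) (dotp p v).
Proof.
move=> df; apply: is_diff_is_derive.
have dc : is_diff s (cst q + *:%R^~ v) (0 + *:%R^~ v).
  by apply: is_diffD.
refine (is_diff_eq (@is_diff_comp _ _ _ _ _ _ _ _ _ dc df) _).
by apply/funext => u; rewrite /dotp /= add0r /GRing.scale/=; ring.
Qed.

(** Entry point for derivatives known through an estimate of the remainder, such as that of [sqd].
    [dotp p] is packed as a continuous linear map so that uniqueness of the differential applies. *)
Lemma grad_littleo f x p :
  (forall e : R, 0 < e -> \forall h \near (0 : R * R), `|f (x + h) - f x - dotp p h| <= e * `|h|) ->
  grad f x p.
Proof.
move=> H.
pose L (v : R * R) := dotp p v.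
have Ll : linear L by move=> a u v; rewrite /L /dotp/= /GRing.scale/=; ring.
pose LL : {linear (R * R)%type -> R} := HB.pack L (GRing.isLinear.Build R (R * R)%type R *:%R L Ll).
have cL : continuous LL.
  move=> z; apply: cvgD; apply: cvgM; try exact: cvg_cst; [exact: cvg_fst|exact: cvg_snd].
have e : 'd f x = LL :> (_ -> _) /\ differentiable f x.
  have E : f \o shift x = cst (f x) + LL +o_ (0 : R * R) id.
    apply/eqaddoP => _/posnumP[e]; near=> h.
    rewrite /= !fctE/=.
    rewrite (_ : _ - _ = f (x + h) - f x - dotp p h).
        by near: h; apply: H.
    by rewrite [x + h]addrC opprD addrA.
  have dE := diff_unique cL E; split => //.
  apply/diff_locallyP; rewrite dE; split => //.
by apply: DiffDef; [exact: e.2|exact: e.1].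
Unshelve. all: by end_near. Qed.

Lemma grad_fst x : grad fst x (1, 0).
Proof.
apply: grad_littleo => e e0; near=> h => /=.
by rewrite /dotp/= (_ : _ - _ = 0) ?normr0 ?mulr_ge0//; [exact: ltW|ring].
Unshelve. all: by end_near. Qed.

Lemma grad_snd x : grad snd x (0, 1).
Proof.
apply: grad_littleo => e e0; near=> h => /=.
by rewrite /dotp/= (_ : _ - _ = 0) ?normr0 ?mulr_ge0//; [exact: ltW|ring].
Unshelve. all: by end_near. Qed.

Definition C1 f := [/\ forall x, differentiable f x, continuous (d1 f) & continuous (d2 f)].

Lemma C1_intro f (g : R * R -> R * R) : (forall x, grad f x (g x)) -> continuous g ->
  C1 f /\ forall x, (d1 f x, d2 f x) = g x.
Proof.
move=> df cg; have e1 x := grad_d1 (df x); have e2 x := grad_d2 (df x).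
split; [split|] => [x|x|x|x].
- exact: grad_differentiable (df x).
- rewrite /continuous_at (_ : d1 f = fst \o g); last exact/funext.
  by apply: continuous_comp; [exact: cg|exact: (grad_continuous (grad_fst _))].
- rewrite /continuous_at (_ : d2 f = snd \o g); last exact/funext.
  by apply: continuous_comp; [exact: cg|exact: (grad_continuous (grad_snd _))].
- by rewrite e1 e2; case: (g x).
Qed.

Lemma C1_continuous f : C1 f -> continuous f.
Proof. by case=> df _ _ x; exact: differentiable_continuous. Qed.

Lemma C1_grad f x : C1 f -> grad f x (d1 f x, d2 f x).
Proof. by case=> df _ _; exact: differentiable_grad. Qed.

Lemma bounded_closed_compact2 (S : set (R * R)) (L : R) : closed S ->
  S `<=` box L -> compact S.
Proof.
move=> cS SL; apply: (@subclosed_compact _ _ (box L)) => //.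
by apply: compact_setX; exact: segment_compact.
Qed.

Lemma C1c_intro f (S Omega : set (R * R)) L : C1 f -> closed S -> S `<=` box L ->
  S `<=` Omega -> (forall x, f x != 0 -> S x) -> C1c Omega f.
Proof.
move=> [df c1 c2] cS SL SO fS.
have cl : closure [set x | f x != 0] `<=` S.
  by rewrite [X in _ `<=` X]((closure_id S).1 cS); apply: closure_subset => x /fS.
split => //; last exact: subset_trans SO.
apply: (bounded_closed_compact2 _ (subset_trans cl SL)); exact: closed_closure.
Qed.

Lemma C1c_C1 Omega f : C1c Omega f -> C1 f. Proof. by case. Qed.

Lemma C1c_bound Omega f : C1c Omega f -> exists2 L : R, 0 < L &
  closure [set x | f x != 0] `<=` box L.
Proof.
move=> [_ _ _ /compact_bounded[M [_ Mb]] _].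
exists (`|M| + 1); first by rewrite ltr_wpDl.
move=> x /(Mb (`|M| + 1)) H; apply/in_box.
have : `|x| <= `|M| + 1 by apply: H; rewrite (le_lt_trans (ler_norm _))// ltrDl.
by rewrite prod_normE ge_max => /andP.
Qed.

Lemma C1c_outside Omega f x : C1c Omega f -> ~ closure [set x | f x != 0] x ->
  [/\ f x = 0, d1 f x = 0 & d2 f x = 0].
Proof.
move=> [df c1 c2 cK sub] nx.
have f0 : \forall y \near x, f y = 0.
  have oS : open (~` closure [set x | f x != 0]) by apply: closed_openC; exact: closed_closure.
  have : nbhs x (~` closure [set x | f x != 0]) by exact: open_nbhs_nbhs.
  apply: filterS => y ny; apply/eqP/negPn/negP => fy; apply: ny.
  exact: subset_closure.
have D v : 'D_v f x = 0.
  by rewrite -(derive_cst (0 : R) x v); apply: near_eq_derive.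
by split; [exact: nbhs_singleton f0|exact: D|exact: D].
Qed.

Lemma bmc_continuous f L : continuous f -> (forall x, f x != 0 -> box L x) -> bmc f.
Proof.
move=> cf fL.
have bL : box L `<=` box (Num.max L 1).
  by move=> x /in_box[h1 h2]; apply/in_box; rewrite !le_max h1 h2.
rewrite (_ : f = fun x => \1_(box (Num.max L 1)) x * f x).
  exact: bmc_cont (bmc_box _) cf.
apply/funext => x; rewrite indicE; case: (boolP (x \in _)) => [_|/negP nx].
  by rewrite mul1r.
rewrite mul0r; case: (eqVneq (f x) 0) => // /fL /bL h.
by exfalso; apply: nx; apply/mem_set.
Qed.

Lemma C1c_bmc Omega f : C1c Omega f -> [/\ bmc f, bmc (d1 f) & bmc (d2 f)].
Proof.
move=> Hf; have [L L0 SL] := C1c_bound Hf; have [df c1 c2 cK sub] := Hf.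
have out x : ~ box L x -> [/\ f x = 0, d1 f x = 0 & d2 f x = 0].
  by move=> nx; apply: C1c_outside Hf _ => /SL.
split; apply: (bmc_continuous (L := L)) => //.
- by move=> x; exact: differentiable_continuous.
- by move=> x /eqP fx; apply: contrapT => /out[].
- by move=> x /eqP fx; apply: contrapT => /out[].
- by move=> x /eqP fx; apply: contrapT => /out[].
Qed.

Lemma C1_M f g : C1 f -> C1 g -> C1 (fun x => f x * g x) /\
  forall x, d1 (fun x => f x * g x) x = f x * d1 g x + d1 f x * g x /\
            d2 (fun x => f x * g x) x = f x * d2 g x + d2 f x * g x.
Proof.
move=> Cf Cg; have cf := C1_continuous Cf; have cg := C1_continuous Cg.
have [_ f1 f2] := Cf; have [_ g1 g2] := Cg.
have [||C E] := @C1_intro (fun x => f x * g x)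
  (fun x => (f x * d1 g x + d1 f x * g x, f x * d2 g x + d2 f x * g x)).
- move=> x; apply: (grad_eq (gradM (C1_grad x Cf) (C1_grad x Cg))).
  by apply/pair_equal_spec; split; rewrite /= /GRing.scale/=; ring.
- exact: (continuous_pair (cts_add (cts_mul cf g1) (cts_mul f1 cg)) (cts_add (cts_mul cf g2) (cts_mul f2 cg))).
- by split => // x; have [] := E x.
Qed.

Lemma C1_D f g : C1 f -> C1 g -> C1 (fun x => f x + g x) /\
  forall x, d1 (fun x => f x + g x) x = d1 f x + d1 g x /\
            d2 (fun x => f x + g x) x = d2 f x + d2 g x.
Proof.
move=> Cf Cg; have [_ f1 f2] := Cf; have [_ g1 g2] := Cg.
have [||C E] := @C1_intro (fun x => f x + g x)
  (fun x => (d1 f x + d1 g x, d2 f x + d2 g x)).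
- by move=> x; apply: (grad_eq (gradD (C1_grad x Cf) (C1_grad x Cg))).
- exact: (continuous_pair (cts_add f1 g1) (cts_add f2 g2)).
- by split => // x; have [] := E x.
Qed.

Lemma C1_Z a f : C1 f -> C1 (fun x => a * f x) /\
  forall x, d1 (fun x => a * f x) x = a * d1 f x /\ d2 (fun x => a * f x) x = a * d2 f x.
Proof.
move=> Cf; have [_ f1 f2] := Cf.
have [||C E] := @C1_intro (fun x => a * f x) (fun x => (a * d1 f x, a * d2 f x)).
- by move=> x; apply: (grad_eq (gradZ a (C1_grad x Cf))).
- have h1 : continuous (fun x : R * R => a * d1 f x : R).
    by apply: (@cts_mul (R * R)%type (fun _ => a) (d1 f) _ f1); exact: cts_cst.
  have h2 : continuous (fun x : R * R => a * d2 f x : R).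
    by apply: (@cts_mul (R * R)%type (fun _ => a) (d2 f) _ f2); exact: cts_cst.
  exact: (continuous_pair h1 h2).
- by split => // x; have [] := E x.
Qed.

Lemma C1c_M Omega f g : C1c Omega f -> C1 g -> C1c Omega (fun x => f x * g x).
Proof.
move=> Hf Cg; have [L L0 SL] := C1c_bound Hf; have [_ _ _ _ sub] := Hf.
apply: (@C1c_intro _ (closure [set x | f x != 0]) Omega L).
- exact: (C1_M (C1c_C1 Hf) Cg).1.
- exact: closed_closure.
- exact: SL.
- exact: sub.
- by move=> x fg; apply: subset_closure; apply: contra_neq fg => /= ->; rewrite mul0r.
Qed.

Lemma C1c_D Omega f g : C1c Omega f -> C1c Omega g -> C1c Omega (fun x => f x + g x).
Proof.
move=> Hf Hg; have [L L0 SL] := C1c_bound Hf; have [_ _ _ _ sub] := Hf.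
have [L' L'0 SL'] := C1c_bound Hg; have [_ _ _ _ sub'] := Hg.
apply: (@C1c_intro _ (closure [set x | f x != 0] `|` closure [set x | g x != 0]) _ (Num.max L L')).
- exact: (C1_D (C1c_C1 Hf) (C1c_C1 Hg)).1.
- by apply: closedU; exact: closed_closure.
- by move=> x [/SL|/SL'] /in_box[h1 h2]; apply/in_box; rewrite !le_max h1 h2 ?orbT.
- by move=> x [/sub|/sub'].
- move=> x; case: (eqVneq (f x) 0) => [->|fx _]; last by left; exact: subset_closure.
  by rewrite add0r; right; exact: subset_closure.
Qed.

Lemma C1c_Z Omega a f : C1c Omega f -> C1c Omega (fun x => a * f x).
Proof.
move=> Hf; have [L L0 SL] := C1c_bound Hf; have [_ _ _ _ sub] := Hf.
apply: (@C1c_intro _ (closure [set x | f x != 0]) Omega L).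
- exact: (C1_Z a (C1c_C1 Hf)).1.
- exact: closed_closure.
- exact: SL.
- exact: sub.
- by move=> x fg; apply: subset_closure; apply: contra_neq fg => /= ->; rewrite mulr0.
Qed.

Lemma is_derive_fst f x y : differentiable f (x, y) ->
  is_derive x 1 (fun s : R => f (s, y)) (d1 f (x, y)).
Proof.
move=> /differentiable_grad df.
have -> : (fun s : R => f (s, y)) = (fun s => f ((0, y) + s *: (1, 0))).
  apply/funext => s; congr f; apply/pair_equal_spec.
  by rewrite /= /GRing.scale/= mulr1 mulr0 add0r addr0.
have -> : d1 f (x, y) = dotp (d1 f (x, y), d2 f (x, y)) (1, 0) by rewrite /dotp/=; ring.
apply: grad_line; rewrite (_ : _ + _ = (x, y))//.
by apply/pair_equal_spec; rewrite /= /GRing.scale/= mulr1 mulr0 add0r addr0.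
Qed.

Lemma is_derive_snd f x y : differentiable f (x, y) ->
  is_derive y 1 (fun s : R => f (x, s)) (d2 f (x, y)).
Proof.
move=> /differentiable_grad df.
have -> : (fun s : R => f (x, s)) = (fun s => f ((x, 0) + s *: (0, 1))).
  apply/funext => s; congr f; apply/pair_equal_spec.
  by rewrite /= /GRing.scale/= mulr1 mulr0 add0r addr0.
have -> : d2 f (x, y) = dotp (d1 f (x, y), d2 f (x, y)) (0, 1) by rewrite /dotp/=; ring.
apply: grad_line; rewrite (_ : _ + _ = (x, y))//.
by apply/pair_equal_spec; rewrite /= /GRing.scale/= mulr1 mulr0 add0r addr0.
Qed.

Lemma continuous_slice1 f y : continuous f -> continuous (fun x => f (x, y)).
Proof.
move=> cf x; apply: (@continuous_comp _ _ _ (fun x : R => (x, y)) f); last exact: cf.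
by apply: (@continuous_pair R R R id (cst y)) => z; [exact: cvg_id|exact: cvg_cst].
Qed.

Lemma continuous_slice2 f x : continuous f -> continuous (fun y => f (x, y)).
Proof.
move=> cf y; apply: (@continuous_comp _ _ _ (fun y : R => (x, y)) f); last exact: cf.
by apply: (@continuous_pair R R R (cst x) id) => z; [exact: cvg_cst|exact: cvg_id].
Qed.

Lemma I2_d1 Omega f : C1c Omega f -> I2 (d1 f) = 0 /\ I2 (d2 f) = 0.
Proof.
move=> Hf; have [bf b1 b2] := C1c_bmc Hf; have [L L0 SL] := C1c_bound Hf.
have [df c1 c2 _ _] := Hf.
have out x : ~ box L x -> f x = 0.
  by move=> nx; have [|//] := @C1c_outside _ _ x Hf; move=> /SL.
have out' (x : R * R) : L < `|x.1| \/ L < `|x.2| -> f x = 0.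
  by move=> h; apply: out => /in_box[]; case: h; rewrite ltNge => /negbTE ->.
split.
- apply: (@I2_derive1_0 f _ 0 L) => //; first exact: ltW.
  + by move=> x y _; exact: is_derive_fst.
  + by move=> y _; exact: continuous_slice1.
  + by move=> x y xL; apply: out'; left.
- apply: (@I2_derive2_0 f _ 0 L) => //; first exact: ltW.
  + by move=> x y _; exact: is_derive_snd.
  + by move=> x _; exact: continuous_slice2.
  + by move=> x y xL; apply: out'; right.
Qed.

(** One factor carries the compact support, so the product is in C^1_c and its derivatives integrate
    to 0. *)
Lemma I2_by_parts Omega f g : C1c Omega f -> C1 g ->
  I2 (fun x => f x * d1 g x) = - I2 (fun x => d1 f x * g x) /\
  I2 (fun x => f x * d2 g x) = - I2 (fun x => d2 f x * g x).
Proof.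
move=> Hf Cg; have [bf b1 b2] := C1c_bmc Hf.
have cg := C1_continuous Cg; have [_ g1 g2] := Cg.
have [I1 I2'] := I2_d1 (C1c_M Hf Cg).
have [_ E] := C1_M (C1c_C1 Hf) Cg.
split; apply/eqP; rewrite -addr_eq0 -I2D; try exact: bmc_cont; apply/eqP.
- by rewrite -[RHS]I1; congr I2; apply/funext => x; rewrite (E x).1.
- by rewrite -[RHS]I2'; congr I2; apply/funext => x; rewrite (E x).2.
Qed.

End plane_calculus.

(** * Projection onto a convex set *)

Section convex_geometry.
Context {R : realType}.
Implicit Types (K : set (R * R)) (x y z u v : R * R).

Definition convex2 K := forall x y (s : R), K x -> K y -> 0 <= s <= 1 ->
  K ((1 - s) *: x + s *: y).

(** The interior may be empty: the single point [disk 0] will serve as a body too. *)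
Definition ccn K := [/\ compact K, convex2 K & K !=set0].

Lemma dotpC x y : dotp x y = dotp y x.
Proof. by rewrite /dotp mulrC [x.2 * _]mulrC. Qed.

Lemma dotpDl x y z : dotp (x + y) z = dotp x z + dotp y z.
Proof. by rewrite /dotp /=; ring. Qed.

Lemma dotpBl x y z : dotp (x - y) z = dotp x z - dotp y z.
Proof. by rewrite /dotp /=; ring. Qed.

Lemma dotpZl (a : R) x y : dotp (a *: x) y = a * dotp x y.
Proof. by rewrite /dotp /= /GRing.scale/=; ring. Qed.

Lemma dotpNl x y : dotp (- x) y = - dotp x y.
Proof. by rewrite /dotp /=; ring. Qed.

Lemma dotpDr x y z : dotp z (x + y) = dotp z x + dotp z y.
Proof. by rewrite !(dotpC z) dotpDl. Qed.

Lemma dotpBr x y z : dotp z (x - y) = dotp z x - dotp z y.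
Proof. by rewrite !(dotpC z) dotpBl. Qed.

Lemma dotpZr (a : R) x y : dotp y (a *: x) = a * dotp y x.
Proof. by rewrite !(dotpC y) dotpZl. Qed.

Lemma dotpNr x y : dotp y (- x) = - dotp y x.
Proof. by rewrite !(dotpC y) dotpNl. Qed.

Definition dotpE := (dotpDl, dotpBl, dotpZl, dotpNl, dotpDr, dotpBr, dotpZr, dotpNr).

Lemma dotp_ge0 x : 0 <= dotp x x.
Proof. by rewrite /dotp addr_ge0// -expr2 sqr_ge0. Qed.

Lemma dotp_eq0 x : dotp x x = 0 -> x = 0.
Proof.
case: x => a b; rewrite /dotp/= => h.
by apply/pair_equal_spec; split; apply/eqP; rewrite -sqrf_eq0 expr2; apply/eqP; nra.
Qed.

Lemma dotp_young x y : 2 * dotp x y <= dotp x x + dotp y y.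
Proof. by have := dotp_ge0 (x - y); rewrite !dotpE [dotp y x]dotpC; lra. Qed.

(** Lagrange's identity: the two sides differ by the square of the determinant of [x] and [y]. *)
Lemma dotp_cs x y : dotp x y ^+ 2 <= dotp x x * dotp y y.
Proof. by rewrite /dotp; have := sqr_ge0 (x.1 * y.2 - x.2 * y.1); rewrite !expr2; nra. Qed.

Lemma enormE x : enorm x ^+ 2 = dotp x x.
Proof. by rewrite /enorm sqr_sqrtr// dotp_ge0. Qed.

Lemma enorm_ge0 x : 0 <= enorm x. Proof. exact: sqrtr_ge0. Qed.

Lemma dotp_le x y : dotp x y <= enorm x * enorm y.
Proof.
have [h|h] := lerP (dotp x y) 0.
  by apply: (le_trans h); rewrite mulr_ge0// enorm_ge0.
rewrite -(@ler_pXn2r _ 2)// ?nnegrE ?(ltW h)//; last by rewrite mulr_ge0// enorm_ge0.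
by rewrite exprMn !enormE dotp_cs.
Qed.

Lemma dotp_sup x : dotp x x <= 2 * `|x| ^+ 2.
Proof.
rewrite prod_normE /dotp -!expr2 -(real_normK (num_real x.1)) -(real_normK (num_real x.2)).
set m := Num.max _ _.
have h1 : `|x.1| <= m by rewrite le_max lexx.
have h2 : `|x.2| <= m by rewrite le_max lexx orbT.
have := normr_ge0 x.1; have := normr_ge0 x.2; rewrite !expr2; nra.
Qed.

Lemma dotp_normle x : `|x.1| ^+ 2 <= dotp x x /\ `|x.2| ^+ 2 <= dotp x x.
Proof.
by rewrite !real_normK ?num_real// /dotp -!expr2; split; have := sqr_ge0 x.1; have := sqr_ge0 x.2; lra.
Qed.

Lemma dotp_cont (f g : R * R -> R * R) : continuous f -> continuous g ->
  continuous (fun x => dotp (f x) (g x)).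
Proof.
move=> cf cg x.
have c1 := @continuous_comp _ _ _ f fst x (cf x) (grad_continuous (grad_fst _)).
have c2 := @continuous_comp _ _ _ f snd x (cf x) (grad_continuous (grad_snd _)).
have d1 := @continuous_comp _ _ _ g fst x (cg x) (grad_continuous (grad_fst _)).
have d2 := @continuous_comp _ _ _ g snd x (cg x) (grad_continuous (grad_snd _)).
exact: (cvgD (cvgM c1 d1) (cvgM c2 d2)).
Qed.

Lemma cts_id2 : continuous (id : R * R -> R * R).
Proof. by move=> x; exact: cvg_id. Qed.

Lemma cts_cst2 (p : R * R) : continuous (fun _ : R * R => p).
Proof. by move=> x; exact: cvg_cst. Qed.

Lemma cts_sub2 (f g : R * R -> R * R) : continuous f -> continuous g ->
  continuous (fun x => f x - g x).
Proof. by move=> cf cg x; exact: (cvgB (cf x) (cg x)). Qed.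

(** The variational inequality for the nearest point: seen from [p], no point of [K] makes an acute
    angle with [x]. *)
Definition is_proj K x p := K p /\ forall z, K z -> dotp (x - p) (z - p) <= 0.

Lemma is_proj_ex K x : ccn K -> exists p, is_proj K x p.
Proof.
move=> [cK convK K0].
have cf : continuous (fun z => dotp (x - z) (x - z)).
  by apply: dotp_cont; apply: cts_sub2; by [exact: cts_cst2|exact: cts_id2].
have [p /set_mem Kp Hp] := compact_EVT_min K0 cK (continuous_subspaceT cf).
exists p; split=> // z Kz; rewrite leNgt; apply/negP => D0.
set D := dotp (x - p) (z - p) in D0.
set N := dotp (z - p) (z - p).
have N0 : 0 <= N by exact: dotp_ge0.
have key (s : R) : 0 <= s <= 1 -> 2 * s * D <= s ^+ 2 * N.
  move=> s01; have := Hp _ (mem_set (convK p z s Kp Kz s01)).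
  rewrite [leRHS](_ : _ = dotp (x - p) (x - p) - 2 * s * D + s ^+ 2 * N); first lra.
  by rewrite /D /N; rewrite /dotp /= /GRing.scale/=; ring.
have := key 1 ltac:(lra); rewrite expr1n => k1.
(* For this [s] one has s^2 N = s D - s^2 D < 2 s D, against [key]; adding [D] to the denominator
   keeps [s] in [0, 1]. *)
pose s := D / (N + D).
have ND : 0 < N + D by lra.
have s01 : 0 <= s <= 1 by rewrite /s divr_ge0 ?ler_pdivrMr ?mul1r//; lra.
have s0 : 0 < s by rewrite /s divr_gt0//.
have sE : s * (N + D) = D by rewrite /s divfK// gt_eqF.
have E : s ^+ 2 * N = s * (s * (N + D)) - s ^+ 2 * D by ring.
by have := key s s01; rewrite E sE; nra.
Qed.

Definition cproj K x := xget (0, 0) (is_proj K x).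

Lemma projP K x : ccn K -> is_proj K x (cproj K x).
Proof. by move=> /(is_proj_ex x)[p hp]; rewrite /cproj; case: xgetP => // /(_ p). Qed.

(** Sum of the two variational inequalities, each tested at the foot of the other point. *)
Lemma proj_lip2 K x y p q : is_proj K x p -> is_proj K y q ->
  dotp (p - q) (p - q) <= dotp (x - y) (p - q).
Proof.
move=> [Kp Hp] [Kq Hq]; have := Hp _ Kq; have := Hq _ Kp.
by rewrite !dotpE (dotpC q p) (dotpC y) (dotpC y); lra.
Qed.

Lemma proj_eq K x p : ccn K -> is_proj K x p -> cproj K x = p.
Proof.
move=> cK hp; apply/eqP; rewrite -subr_eq0; apply/eqP/dotp_eq0/eqP.
rewrite eq_le dotp_ge0 andbT; have := proj_lip2 (projP x cK) hp.
by rewrite subrr /dotp /= !mul0r addr0.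
Qed.

Lemma proj_lip K x y : ccn K ->
  dotp (cproj K x - cproj K y) (cproj K x - cproj K y) <= dotp (x - y) (x - y).
Proof.
move=> cK; have := proj_lip2 (projP x cK) (projP y cK).
have := dotp_young (x - y) (cproj K x - cproj K y); lra.
Qed.

(** [resid K] is half the gradient of the convex function [sqd K], hence monotone. The proof uses
    that the projection is nonexpansive. *)
Lemma proj_mono K x y : ccn K ->
  0 <= dotp ((x - cproj K x) - (y - cproj K y)) (x - y).
Proof.
move=> cK; have := proj_lip x y cK.
have := dotp_young (x - y) (cproj K x - cproj K y).
have -> : x - cproj K x - (y - cproj K y) = (x - y) - (cproj K x - cproj K y).
  by apply/pair_equal_spec; split; rewrite /=; ring.
by rewrite (dotpBl (x - y)) (dotpC (cproj K x - cproj K y)); lra.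
Qed.

(** Off [K] this is the distance times the outer unit normal at the foot; unlike that normal, it
    extends continuously by 0 to [K]. *)
Definition resid K x := x - cproj K x.
Definition sqd K x := dotp (resid K x) (resid K x).

Lemma sqd_ge0 K x : 0 <= sqd K x. Proof. exact: dotp_ge0. Qed.

Lemma proj_cont K : ccn K -> continuous (cproj K).
Proof.
move=> cK x; apply/cvgrPdist_le => /= e e0; near=> y.
have xy : `|x - y| <= e / 2.
  near: y; apply: (@cvgr_dist_le _ _ _ _ _ id x (@cvg_id _ (nbhs x)) (e / 2)).
  by rewrite divr_gt0.
have h := le_trans (proj_lip x y cK) (dotp_sup (x - y)).
have [h1 h2] := dotp_normle (cproj K x - cproj K y).
have nn := normr_ge0 (x - y).
have hh (a : R) : 0 <= a -> a ^+ 2 <= dotp (cproj K x - cproj K y) (cproj K x - cproj K y) -> a <= e.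
  move=> a0 ha; rewrite -(@ler_pXn2r _ 2) ?nnegrE ?(ltW e0)//.
  by apply: (le_trans ha); apply: (le_trans h); rewrite !expr2; nra.
by rewrite prod_normE ge_max !hh.
Unshelve. all: by end_near. Qed.

Lemma resid_cont K : ccn K -> continuous (resid K).
Proof. by move=> cK; apply: cts_sub2; [exact: cts_id2|exact: proj_cont]. Qed.

(** The remainder lies between 0 and |h|^2: the upper bound takes the foot of [x] as a competitor
    for [x + h], the lower one is the variational inequality at the foot of [x]. *)
Lemma sqd_grad K x : ccn K -> grad (sqd K) x (2 *: resid K x).
Proof.
move=> cK; apply: grad_littleo => e e0; near=> h.
have hs : `|h| <= e / 2.
  near: h.
  have e20 : 0 < e / 2 by rewrite divr_gt0.
  exact: (@pseudometric_normed_Zmodule.nbhs0_le _ (R * R)%type _ e20).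
have up : `|sqd K (x + h) - sqd K x - dotp (2 *: resid K x) h| <= dotp h h.
  have [Kp Hp] := projP x cK; have [Kq Hq] := projP (x + h) cK.
  rewrite ler_norml; move: (Hp _ Kq) (Hq _ Kp) (proj_lip2 (projP (x + h) cK) (projP x cK)) (proj_lip (x + h) x cK).
  rewrite /sqd /resid; move: (cproj K x) (cproj K (x + h)) => p q.
  rewrite [x + h - x]addrC addKr /dotp /= /GRing.scale/=.
  move=> a1 a2 a3 a4.
  have b1 := sqr_ge0 (h.1 - (q.1 - p.1)); have b2 := sqr_ge0 (h.2 - (q.2 - p.2)).
  have b3 := sqr_ge0 (q.1 - p.1); have b4 := sqr_ge0 (q.2 - p.2).
  have b5 := sqr_ge0 h.1; have b6 := sqr_ge0 h.2.
  by rewrite !expr2 in b1 b2 b3 b4 b5 b6; apply/andP; split; lra.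
apply: (le_trans up); apply: (le_trans (dotp_sup h)).
by have := normr_ge0 h; rewrite expr2; nra.
Unshelve. all: by end_near. Qed.

Lemma proj_in K x : ccn K -> K x -> cproj K x = x.
Proof.
move=> cK Kx; apply: proj_eq => //; split => // z _.
by rewrite subrr /dotp /= !mul0r addr0.
Qed.

Lemma sqd_in K x : ccn K -> K x -> sqd K x = 0.
Proof. by move=> cK Kx; rewrite /sqd /resid proj_in// subrr /dotp/= !mul0r addr0. Qed.

Lemma sqd0_in K x : ccn K -> sqd K x = 0 -> K x.
Proof.
move=> cK /dotp_eq0/eqP; rewrite subr_eq0 => /eqP ->.
by have [] := projP x cK.
Qed.

(** The support function on all vectors, since it will be evaluated at [resid K x]; [support_fun] is
    its restriction to the unit circle. *)
Definition hsup K u := sup [set dotp z u | z in K].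

Lemma dotp_cont_r u : continuous (fun z => dotp z u).
Proof. by apply: dotp_cont; [exact: cts_id2|exact: cts_cst2]. Qed.

Lemma hsup_att K u : ccn K -> exists2 z, K z & dotp z u = hsup K u.
Proof.
move=> [cK _ K0].
have [p /set_mem Kp Hp] := compact_EVT_max K0 cK (continuous_subspaceT (@dotp_cont_r u)).
exists p => //; apply/eqP; rewrite eq_le; apply/andP; split.
  apply: ub_le_sup; last by exists p.
  by exists (dotp p u) => _ [z Kz <-]; exact/Hp/mem_set.
apply: ge_sup; first by exists (dotp p u), p.
by move=> _ [z Kz <-]; exact/Hp/mem_set.
Qed.

Lemma hsup_ge K u z : ccn K -> K z -> dotp z u <= hsup K u.
Proof.
move=> [cK _ K0] Kz.
have [p /set_mem Kp Hp] := compact_EVT_max K0 cK (continuous_subspaceT (@dotp_cont_r u)).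
by apply: ub_le_sup; [exists (dotp p u) => _ [w Kw <-]; exact/Hp/mem_set|exists z].
Qed.

Lemma hsup_le K u a : ccn K -> (forall z, K z -> dotp z u <= a) -> hsup K u <= a.
Proof. by move=> cK H; have [z Kz <-] := hsup_att u cK; exact: H. Qed.

(** The variational inequality says that the foot of [x] maximizes the product with [resid K x]: the
    residual is an outer normal there. *)
Lemma resid_hsup K x : ccn K -> dotp (cproj K x) (resid K x) = hsup K (resid K x).
Proof.
move=> cK; have [Kp Hp] := projP x cK.
apply/eqP; rewrite eq_le hsup_ge//=; apply: hsup_le => // z /Hp.
by rewrite -/(resid K x) dotpBr dotpC [dotp (resid _ _) (cproj _ _)]dotpC; lra.
Qed.

Lemma hsup_bounded K L : compact K -> K `<=` box L -> forall z u, K z -> `|dotp z u| <= L * (`|u.1| + `|u.2|).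
Proof.
move=> _ KL z u /KL/in_box[h1 h2]; rewrite /dotp (le_trans (ler_normD _ _))// !normrM mulrDr.
by rewrite lerD// ler_wpM2r.
Qed.

Lemma hsup_lip K L u v : ccn K -> K `<=` box L ->
  `|hsup K u - hsup K v| <= L * (`|u.1 - v.1| + `|u.2 - v.2|).
Proof.
move=> cK KL.
have main a b : hsup K a - hsup K b <= L * (`|a.1 - b.1| + `|a.2 - b.2|).
  have [z Kz <-] := hsup_att a cK; have := hsup_ge b cK Kz.
  have cK' : compact K by case: cK.
  have := hsup_bounded cK' KL (a - b) Kz; rewrite dotpBr /=.
  by have := ler_norm (dotp z a - dotp z b); lra.
rewrite ler_norml; apply/andP; split; last exact: main.
by have := main v u; rewrite (distrC v.1) (distrC v.2); lra.
Qed.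

Lemma compact_box K : compact K -> exists2 L, 0 < L & K `<=` box L.
Proof.
move=> /compact_bounded[M [_ Mb]].
exists (`|M| + 1); first by rewrite ltr_wpDl.
move=> x /(Mb (`|M| + 1)) H; apply/in_box.
have : `|x| <= `|M| + 1 by apply: H; rewrite (le_lt_trans (ler_norm _))// ltrDl.
by rewrite prod_normE ge_max => /andP.
Qed.

Definition perp u : R * R := (- u.2, u.1).

Lemma dotp_perp u : dotp u (perp u) = 0. Proof. by rewrite /dotp/=; ring. Qed.

Lemma line_nearest_side K u (tau : R) : ccn K -> dotp u u = 1 -> hsup K u <= tau ->
  exists x0, [/\ dotp x0 u = tau, dotp (resid K x0) (perp u) = 0 &
    sqd K x0 = (tau - hsup K u) ^+ 2].
Proof.
move=> cK u1 ht; have [z Kz zu] := hsup_att u cK.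
pose x0 := z + (tau - hsup K u) *: u.
have E : x0 - z = (tau - hsup K u) *: u by rewrite /x0 addrC addKr.
have px0 : cproj K x0 = z.
  apply: proj_eq => //; split => // w Kw; rewrite E dotpZl dotpBr.
  have := hsup_ge u cK Kw; rewrite (dotpC u w) (dotpC u z) zu => h.
  by nra.
exists x0; rewrite /sqd /resid px0 E; split.
- by rewrite /x0 dotpDl dotpZl u1 zu; ring.
- by rewrite dotpZl dotp_perp mulr0.
- by rewrite !dotpE u1; ring.
Qed.

(** The second condition makes [x0] a critical point of [sqd K] on the line {x . u = tau}, hence a
    nearest point to [K] by convexity. The line passes [K] on the side of [u], on that of [- u], or
    meets it; the maximum covers the three cases. *)
Lemma line_nearest K u (tau : R) : ccn K -> dotp u u = 1 ->
  exists x0, [/\ dotp x0 u = tau, dotp (resid K x0) (perp u) = 0 &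
    sqd K x0 = Num.max 0 (Num.max (tau - hsup K u) (- tau - hsup K (- u))) ^+ 2].
Proof.
move=> cK u1; have [z1 K1 E1] := hsup_att u cK; have [z2 K2 E2] := hsup_att (- u) cK.
have hh : - hsup K (- u) <= hsup K u.
  by have := hsup_ge u cK K2; rewrite -E2 dotpNr; lra.
have [h1|h1] := lerP (hsup K u) tau.
  have [x0 [a b c]] := line_nearest_side cK u1 h1; exists x0; split => //; rewrite c.
  by congr (_ ^+ 2); rewrite [Num.max (tau - _) _]max_l ?[Num.max 0 _]max_r//; lra.
have [h2|h2] := lerP (hsup K (- u)) (- tau).
  have u1' : dotp (- u) (- u) = 1 by rewrite dotpNl dotpNr opprK.
  have [x0 [a b c]] := line_nearest_side cK u1' h2; exists x0; split => //.
  - by move: a; rewrite dotpNr => /oppr_inj.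
  - by move: b; rewrite /perp/= /dotp/=; lra.
  - rewrite c; congr (_ ^+ 2); rewrite [Num.max (tau - _) _]max_r ?[Num.max 0 _]max_r//; lra.
(* The line meets [K]: [s] weights the two opposite support points so that the combination lies on
   the line. *)
pose s := (tau + hsup K (- u)) / (hsup K u + hsup K (- u)).
have d0 : 0 < hsup K u + hsup K (- u) by lra.
have s01 : 0 <= s <= 1 by rewrite /s divr_ge0 ?ler_pdivrMr ?mul1r//; lra.
have cvK : convex2 K by case: cK.
have Kx := cvK _ _ _ K2 K1 s01; exists ((1 - s) *: z2 + s *: z1).
have e2 : dotp z2 u = - hsup K (- u) by rewrite -E2 dotpNr opprK.
rewrite sqd_in// /resid proj_in// subrr; split.
- by rewrite !dotpE E1 e2 /s; field; lra.
- by rewrite /dotp/= !mul0r addr0.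
- by rewrite [Num.max 0 _]max_l ?expr0n// ge_max; lra.
Qed.

Lemma support_funE K th : support_fun K th = hsup K (cos th, sin th).
Proof. by []. Qed.

End convex_geometry.

(** * Integrals over segments *)

Section line_integral.
Context {R : realType}.
Notation mu := (@lebesgue_measure R).
Implicit Types f g F : R -> R.

Lemma derD f g (x df dg : R) : is_derive x 1 f df -> is_derive x 1 g dg ->
  is_derive x 1 (fun y => f y + g y) (df + dg).
Proof. exact: is_deriveD. Qed.

Lemma derB f g (x df dg : R) : is_derive x 1 f df -> is_derive x 1 g dg ->
  is_derive x 1 (fun y => f y - g y) (df - dg).
Proof. exact: is_deriveB. Qed.

Lemma derN f (x df : R) : is_derive x 1 f df -> is_derive x 1 (fun y => - f y) (- df).
Proof. exact: is_deriveN. Qed.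

Lemma derZ a f (x df : R) : is_derive x 1 f df -> is_derive x 1 (fun y => a * f y) (a * df).
Proof. exact: is_deriveZ. Qed.

Lemma derM f g (x df dg : R) : is_derive x 1 f df -> is_derive x 1 g dg ->
  is_derive x 1 (fun y => f y * g y) (f x * dg + g x * df).
Proof. exact: is_deriveM. Qed.

Lemma derC (a x : R) : is_derive x 1 (fun _ : R => a) 0.
Proof. exact: is_derive_cst. Qed.

Lemma derI (x : R) : is_derive x 1 (fun y : R => y) 1.
Proof. exact: is_derive_id. Qed.

Lemma dercomp f g (x df dg : R) : is_derive (g x) 1 f df -> is_derive x 1 g dg ->
  is_derive x 1 (fun y => f (g y)) (df * dg).
Proof. exact: is_derive1_comp. Qed.

Lemma deq f (x d d' : R) : is_derive x 1 f d -> d = d' -> is_derive x 1 f d'.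
Proof. by move=> + <-. Qed.

Lemma integrable_cont f (a b : R) : continuous f -> mu.-integrable `[a, b] (EFin \o f).
Proof.
by move=> cf; apply: continuous_compact_integrable; [exact: segment_compact|exact: continuous_subspaceT].
Qed.

Lemma Rint_split f (a b x : R) : continuous f -> a <= b -> b <= x ->
  \int[mu]_(t in `[a, x]) f t = \int[mu]_(t in `[a, b]) f t + \int[mu]_(t in `[b, x]) f t.
Proof.
move=> cf ab bx.
have h := @Rintegral_itvB _ f (BLeft a) (BRight x) b (@integrable_cont f a x cf) ab bx.
rewrite -(@Rintegral_itv_obnd_cbnd _ b (BRight x)); first by rewrite -h addrC subrK.
by apply: integrableS (@integrable_cont f b x cf) => //; exact: subset_itv_oc_cc.
Qed.

(** A primitive on the whole line, glued from the integrals from [- N]. Normalized to vanish at 0,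
    these no longer depend on [N], which is chosen with [x]. *)
Lemma antideriv f : continuous f -> exists F, forall x : R, is_derive x 1 F (f x).
Proof.
move=> cf.
pose G (N x : R) := \int[mu]_(t in `[- N, x]) f t.
have GE (N M x : R) : - N < x -> - M < x -> 0 <= N -> 0 <= M -> G N x - G N 0 = G M x - G M 0.
  wlog NM : N M / N <= M => [hw|] h1 h2 h3 h4.
    case: (leP N M) => [NM|/ltW MN]; first exact: hw NM h1 h2 h3 h4.
    by apply/esym; exact: hw MN h2 h1 h4 h3.
  have hMN : - M <= - N by lra.
  have hN0 : - N <= 0 by lra.
  by rewrite /G (Rint_split cf hMN (ltW h1)) (Rint_split cf hMN hN0); ring.
pose F x := G (`|x| + 1) x - G (`|x| + 1) 0.
have nx (x : R) : - (`|x| + 1) < x /\ 0 <= `|x| + 1.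
  by have := ler_norm (- x); have := normr_ge0 x; rewrite normrN; lra.
exists F => x.
(* A single [N] serves the whole interval of radius 1 around [x]. *)
set N := `|x| + 2.
have N0 : 0 <= N by have := normr_ge0 x; rewrite /N; lra.
have Nx : - N < x by have [] := nx x; rewrite /N; lra.
have e : \near x, G N x - G N 0 = F x.
  have : \forall y \near x, `|x - y| < 1 by exact: (@cvgr_dist_lt _ _ _ _ _ id x (@cvg_id _ (nbhs x)) 1 ltr01).
  apply: filterS => y xy; have [h1 h2] := nx y; apply: GE => //.
  by move: xy; rewrite ltr_norml /N; have := ler_norm (- x); rewrite normrN; lra.
apply: (near_eq_is_derive e).
have [d1 d2] := @continuous_FTC1_closed _ f (- N) x (x + 1) ltac:(lra) (@integrable_cont f (- N) (x + 1) cf) Nx (cf x).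
have h : is_derive x 1 (G N) (f x) by apply: DeriveDef; [exact: d1|rewrite -derive1E; exact: d2].
by apply: (deq (derB h (derC (G N 0) x))); rewrite subr0.
Qed.

Lemma Rint_FTC f F (a b : R) : a <= b -> continuous f ->
  (forall x : R, is_derive x 1 F (f x)) -> \int[mu]_(x in `[a, b]) f x = F b - F a.
Proof. by move=> ab cf dF; exact: FTC_segment. Qed.

Lemma vanishing_primitive (b : R -> R) (a : R) : continuous b -> (forall s, a <= s -> b s = 0) ->
  exists2 B : R -> R, forall s : R, is_derive s 1 B (- b s) & forall s, a <= s -> B s = 0.
Proof.
move=> cb ba; have [F dF] := antideriv cb; exists (fun s => F a - F s).
  by move=> s; apply: (deq (derB (derC _ _) (dF s))); rewrite sub0r.
move=> s sa; apply/eqP; rewrite -oppr_eq0 opprB -(Rint_FTC sa cb dF); apply/eqP.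
have -> : \int[mu]_(x in `[a, s]) b x = \int[mu]_(x in `[a, s]) cst 0 x.
  by apply: eq_Rintegral => x /set_mem /=; rewrite in_itv/= => /andP[/ba].
by rewrite /Rintegral integral0.
Qed.

Lemma is_derive_comp_affine F f (a b : R) : (forall x : R, is_derive x 1 F (f x)) ->
  forall x : R, is_derive x 1 (fun y => F (a * y + b)) (a * f (a * x + b)).
Proof.
move=> dF x.
have h : is_derive x 1 (fun y : R => a * y + b) a.
  by apply: (deq (derD (derZ a (derI x)) (derC b x))); ring.
by apply: (deq (dercomp (dF _) h)); rewrite mulrC.
Qed.

Lemma cts_affine (a b : R) : continuous (fun x : R => a * x + b).
Proof.
by move=> x; apply: cvgD; [apply: cvgM; [exact: cvg_cst|exact: cvg_id]|exact: cvg_cst].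
Qed.

Lemma cts_comp (T U V : topologicalType) (g : U -> V) (f : T -> U) : continuous f -> continuous g ->
  continuous (fun x => g (f x)).
Proof. by move=> cf cg x; exact: (continuous_comp (cf x) (cg (f x))). Qed.

Lemma cts_shift (a : R) : continuous (fun x : R => x + a).
Proof. by move=> x; exact: (cvgD (@cvg_id _ (nbhs x)) (cvg_cst a)). Qed.

(** A primitive [F] of [f] is constant on each side of [- N', N'], and the affine map sends the ends
    of [- M, M] beyond that interval; the sign of [a] only decides which end goes to which side. *)
Lemma integral_affine f (a b N : R) : a != 0 -> continuous f ->
  (forall x, f x != 0 -> `|x| <= N) ->
  \int[mu]_y f (a * y + b) = `|a|^-1 * \int[mu]_x f x.
Proof.
move=> a0 cf fN0; have [F dF] := antideriv cf.
pose N' := `|N| + 1.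
have N'0 : 0 < N' by rewrite ltr_wpDl.
have fN x : f x != 0 -> `|x| < N'.
  by move=> /fN0; have := ler_norm N; rewrite /N'; lra.
pose M := `|a|^-1 * (N' + `|b|).
have na : 0 < `|a| by rewrite normr_gt0.
have M0 : 0 <= M by rewrite /M mulr_ge0 ?invr_ge0 ?addr_ge0// ltW.
rewrite [in RHS](Rintegral_segment (a := - N') (b := N')); last first.
  by move=> x /fN /ltW; rewrite ler_norml.
rewrite (Rintegral_segment (a := - M) (b := M)); last first.
  move=> y /fN h.
  rewrite -ler_norml /M ler_pdivlMl// -normrM.
  have := ler_normB (a * y + b) b; rewrite addrK; lra.
have daF : forall x : R, is_derive x 1 (fun y => a^-1 * F (a * y + b)) (f (a * x + b)).
  move=> x; have h := is_derive_comp_affine a b dF x.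
  by apply: (deq (derZ a^-1 h)); rewrite mulKf.
rewrite (@Rint_FTC f F (- N') N' _ cf dF); last lra.
rewrite (@Rint_FTC (fun y => f (a * y + b)) _ (- M) M _ _ daF); last 2 first.
- lra.
- exact: cts_comp (@cts_affine a b) cf.
have Fc (x y : R) : (forall t, x <= t <= y -> f t = 0) -> x <= y -> F x = F y.
  move=> h xy; apply/eqP; rewrite eq_sym -subr_eq0 -(Rint_FTC xy cf dF); apply/eqP.
  rewrite (@eq_Rintegral _ _ _ _ _ (cst 0)); first by rewrite /Rintegral integral0.
  by move=> t /set_mem /=; rewrite in_itv/= => /h.
have f0 t : N' <= `|t| -> f t = 0.
  by move=> Nt; apply/eqP/negPn/negP => /fN; rewrite ltNge Nt.
have Fr y : N' <= y -> F y = F N'.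
  move=> Ny; apply/esym/Fc => // t /andP[h1 h2]; apply: f0.
  by have := ler_norm t; lra.
have Fl y : y <= - N' -> F y = F (- N').
  move=> Ny; apply/Fc => // t /andP[h1 h2]; apply: f0.
  by have := ler_norm (- t); rewrite normrN; lra.
have aM : `|a| * M = N' + `|b| by rewrite /M mulVKf// gt_eqF.
have := ler_norm b; have := ler_norm (- b); rewrite normrN => b1 b2.
case: (ltrgtP a 0) a0 => // sa _.
- rewrite ltr0_norm// in aM *.
  by rewrite (Fl (a * M + b)) ?(Fr (a * - M + b)); [rewrite invrN; ring|lra|lra].
- rewrite gtr0_norm// in aM *.
  by rewrite (Fr (a * M + b)) ?(Fl (a * - M + b)); [ring|lra|lra].
Qed.

(** For a primitive [F], the difference [F (x + p) - F x] has zero derivative, so it takes the same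
    value at [a] and at 0. *)
Lemma periodic_shift f (a p : R) : 0 <= p -> continuous f -> (forall x, f (x + p) = f x) ->
  \int[mu]_(x in `[0, p]) f (x + a) = \int[mu]_(x in `[0, p]) f x.
Proof.
move=> p0 cf fp; have [F dF] := antideriv cf.
have cfa : continuous (fun x => f (x + a)).
  exact: cts_comp (@cts_shift a) cf.
have dFa b : forall x : R, is_derive x 1 (fun y => F (y + b)) (f (x + b)).
  by move=> x; apply: (deq (dercomp (dF _) (derD (derI x) (derC b x)))); ring.
rewrite (Rint_FTC p0 cfa (dFa a)) (Rint_FTC p0 cf dF) add0r.
have dG : forall x : R, is_derive x 1 (fun y => F (y + p) - F y) 0.
  by move=> x; apply: (deq (derB (dFa p x) (dF x))); rewrite fp subrr.
have := is_derive_0_is_cst a 0 dG; rewrite add0r => <-.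
by rewrite [p + a]addrC.
Qed.

Lemma integral_abs_cos : \int[mu]_(x in `[0, 2 * pi]) `|cos x| = 4.
Proof.
have c1 : continuous (fun x : R => `|cos x|).
  by move=> x; apply: cvg_norm; exact: continuous_cos.
have pi0 := pi_gt0 R.
have dsin : forall x : R, is_derive x 1 sin (cos x) by move=> x; exact: is_derive_sin.
have cc := @continuous_cos R.
rewrite -(periodic_shift (- (pi / 2)) (p := 2 * pi)) //; last 2 first.
- lra.
- by move=> x; rewrite mulr2n mulrDl mul1r -mulr2n cosD2pi.
rewrite (_ : (fun x => _) = (fun x : R => `|sin x|)); last first.
  by apply/funext => x; rewrite cosBpihalf.
have cs := @continuous_sin R.
have c2 : continuous (fun x : R => `|sin x|).
  by move=> x; apply: cvg_norm; exact: continuous_sin.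
have dcos : forall x : R, is_derive x 1 (fun x => - cos x) (sin x).
  by move=> x; apply: (deq (derN (is_derive_cos x))); rewrite opprK.
rewrite (Rint_split c2 (ltW pi0)); last lra.
have -> : \int[mu]_(t in `[0, pi]) `|sin t| = \int[mu]_(t in `[0, pi]) sin t.
  apply: eq_Rintegral => x /set_mem; rewrite /= in_itv/= => xp; rewrite ger0_norm//.
  by apply: sin_ge0_pi.
rewrite (Rint_FTC (ltW pi0) cs dcos).
have -> : \int[mu]_(t in `[pi, 2 * pi]) `|sin t| = \int[mu]_(t in `[pi, 2 * pi]) - sin t.
  apply: eq_Rintegral => x /set_mem; rewrite /= in_itv/= => xp; rewrite ler0_norm//.
  rewrite -[x](subrK pi) sinDpi oppr_le0; apply: sin_ge0_pi; lra.
have dcos' : forall x : R, is_derive x 1 cos (- sin x) by move=> x; exact: is_derive_cos.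
have csN : continuous (fun x : R => - sin x) by apply: cts_opp.
rewrite (Rint_FTC _ csN dcos'); last lra.
rewrite cos0 cospi (_ : 2 * pi = pi *+ 2) ?cos2pi; last by rewrite mulr_natl.
lra.
Qed.

Lemma unit_angle (a b : R) : a ^+ 2 + b ^+ 2 = 1 -> exists al : R, a = cos al /\ b = sin al.
Proof.
move=> h; have ha : -1 <= a <= 1.
  by have := sqr_ge0 b; move: h; rewrite !expr2 => h hb; apply/andP; split; nra.
have hs : sin (acos a) = `|b|.
  by rewrite sin_acos// -h addrC addKr sqrtr_sqr.
have [b0|b0] := lerP 0 b.
  by exists (acos a); rewrite acosK ?in_itv//= hs ger0_norm.
by exists (- acos a); rewrite cosN sinN acosK ?in_itv//= hs ltr0_norm// opprK.
Qed.

(** The product is |v| cos (th - al) for some phase [al], which periodicity removes. [perp] appears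
    because the lines {x . u = tau} run in the direction [perp u]. *)
Lemma integral_abs_dir (v : R * R) :
  \int[mu]_(th in `[0, 2 * pi]) `|dotp v (perp (cos th, sin th))| = 4 * enorm v.
Proof.
have [v0|v0] := eqVneq (enorm v) 0.
  have := enormE v; rewrite v0 expr0n/= => /esym/dotp_eq0 ->; rewrite mulr0.
  rewrite (@eq_Rintegral _ _ _ _ _ (cst 0)); first by rewrite /Rintegral integral0.
  by move=> x _; rewrite /dotp/= !mul0r addr0 normr0.
have [al [e1 e2]] : exists al : R, v.2 / enorm v = cos al /\ - v.1 / enorm v = sin al.
  apply: unit_angle; rewrite !exprMn sqrrN -mulrDl exprVn enormE /dotp -!expr2 addrC divff//.
  by move: (enormE v); rewrite /dotp -!expr2 => <-; rewrite expf_neq0.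
have n0 : 0 < enorm v by rewrite lt_def v0 enorm_ge0.
have E : (fun th => `|dotp v (perp (cos th, sin th))|) = (fun th => enorm v * `|cos (th + - al)|).
  apply/funext => th; rewrite cosB -e1 -e2 -[X in X * `|_|](gtr0_norm n0) -normrM.
  by congr `|_|; rewrite /dotp/=; field.
have c1 : continuous (fun x : R => `|cos x|).
  by move=> x; apply: cvg_norm; exact: continuous_cos.
have ca : continuous (fun x => `|cos (x - al)|).
  exact: cts_comp (@cts_shift (- al)) c1.
rewrite E RintegralZl//; last exact: integrable_cont.
have pi0 := pi_gt0 R.
rewrite (@periodic_shift (fun x => `|cos x|) (- al)) ?integral_abs_cos; [ring|lra|exact: c1|].
by move=> x; rewrite mulr2n mulrDl mul1r -mulr2n cosD2pi.
Qed.

End line_integral.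

(** * The Steiner formula *)

Section steiner.
Context {R : realType}.
Notation mu := (@lebesgue_measure R).
Notation T2 := (measurableTypeR R * measurableTypeR R)%type.
Implicit Types K : set (R * R).

Lemma cts_max (T : topologicalType) (f g : T -> R) : continuous f -> continuous g ->
  continuous (fun x => Num.max (f x) (g x)).
Proof.
move=> cf cg x.
rewrite /continuous_at (_ : (fun x => _) = fun x => (f x + g x + `|f x - g x|) / 2).
  rewrite maxr_absE; apply: cvgM; last exact: cvg_cst.
  exact: (cvgD (cvgD (cf x) (cg x)) (cvg_norm (cvgB (cf x) (cg x)))).
by apply/funext => y; rewrite maxr_absE.
Qed.

Lemma bmc_slice1 (f : R * R -> R) (L y : R) : (forall x, f x != 0 -> box L x) ->
  forall x, f (x, y) != 0 -> `|x| <= L.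
Proof. by move=> fL x /fL/in_box[]. Qed.

(** A shear takes the place of a rotation: for [a = - u.2 / u.1] it turns the vertical lines into
    the lines {x . u = y u.1} without changing areas. This is why directions with [u.1 = 0] are set
    apart below. *)
Lemma I2_shear (f : R * R -> R) (L a : R) : continuous f ->
  (forall x, f x != 0 -> box L x) ->
  bmc (fun p => f (p.1 + a * p.2, p.2)) /\
  I2 f = I2 (fun p => f (p.1 + a * p.2, p.2)).
Proof.
move=> cf fL.
have bg : bmc (fun p => f (p.1 + a * p.2, p.2)).
  have cfst : continuous (@fst R R) by move=> x; exact: (grad_continuous (grad_fst x)).
  have csnd : continuous (@snd R R) by move=> x; exact: (grad_continuous (grad_snd x)).
  have ca : continuous (fun p : R * R => p.1 + a * p.2).
    exact: (cts_add cfst (cts_mul (@cts_cst _ _ a) csnd)).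
  apply: (@bmc_continuous _ _ ((1 + `|a|) * L)).
    exact: (cts_comp (continuous_pair ca csnd) cf).
  move=> [x y] /fL/in_box/=[h1 h2]; apply/in_box => /=.
  have L0 : 0 <= L by exact: le_trans h2.
  split.
    have := ler_normB (x + a * y) (a * y); rewrite addrK normrM.
    have := ler_wpM2l (normr_ge0 a) h2; lra.
  by rewrite (le_trans h2)// ler_peMl// lerDl.
split => //.
rewrite (I2_fubini' (bmc_continuous cf fL)) (I2_fubini' bg).
congr Rintegral; apply/funext => y /=.
have := @integral_affine _ (fun x => f (x, y)) 1 (a * y) L (oner_neq0 _) (continuous_slice1 cf) (bmc_slice1 fL).
rewrite normr1 invr1 mul1r => <-.
by congr Rintegral; apply/funext => x; rewrite mul1r.
Qed.

Section profile.
Variables (b : R -> R) (M : R).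
Hypotheses (cb : continuous b) (b0 : forall s, 0 <= b s) (M0 : 0 < M)
  (bM : forall s, M ^+ 2 <= s -> b s = 0).

Lemma profile_primitive : exists B : R -> R,
  [/\ forall s : R, is_derive s 1 B (- b s), forall s, M ^+ 2 <= s -> B s = 0,
      continuous B & forall s, 0 <= B s].
Proof.
have [B dB BM] := vanishing_primitive cb bM.
exists B; split => // s; first exact: is_derive_continuous (dB s).
have [Ms|/ltW sM] := leP (M ^+ 2) s; first by rewrite BM.
have dN (x : R) : is_derive x 1 (fun y => - B y) (b x) by apply: deq (derN (dB x)) _; rewrite opprK.
have := Rint_FTC sM cb dN; rewrite BM// oppr0 sub0r opprK => <-.
by apply: Rintegral_ge0 => x _.
Qed.

Lemma sqd_far K L : ccn K -> K `<=` box L -> forall x, b (sqd K x) != 0 -> box (L + M) x.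
Proof.
move=> cK KL x bx; have sM : sqd K x < M ^+ 2.
  by rewrite ltNge; apply: contra bx => /bM/eqP.
have [/KL/in_box[p1 p2] _] := projP x cK.
have [r1 r2] := dotp_normle (resid K x).
have hh (a : R) : 0 <= a -> a ^+ 2 <= sqd K x -> a <= M.
  move=> a0 ha; rewrite -(@ler_pXn2r _ 2) ?nnegrE ?(ltW M0)//; lra.
have q1 := hh _ (normr_ge0 _) r1; have q2 := hh _ (normr_ge0 _) r2.
apply/in_box; split.
  have -> : x.1 = (cproj K x).1 + (resid K x).1 by rewrite /resid /=; ring.
  by rewrite (le_trans (ler_normD _ _))// lerD.
have -> : x.2 = (cproj K x).2 + (resid K x).2 by rewrite /resid /=; ring.
by rewrite (le_trans (ler_normD _ _))// lerD.
Qed.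

Section fixed_body.
Variable K : set (R * R).
Hypothesis cK : ccn K.

Let cres := resid_cont cK.

Lemma sqd_cont : continuous (sqd K).
Proof. exact: dotp_cont cres cres. Qed.

(** Minus the derivative of [B (sqd K)] in the direction [perp u], when [b] is minus the derivative
    of [B]. *)
Definition dirder (u x : R * R) := 2 * b (sqd K x) * dotp (resid K x) (perp u).

Lemma dirder_cont u : continuous (dirder u).
Proof.
apply: cts_mul; last exact: (cts_comp cres (@dotp_cont_r _ (perp u))).
exact: (cts_mul (@cts_cst _ _ 2) (cts_comp sqd_cont cb)).
Qed.

Lemma dirder_supp L u : K `<=` box L -> forall x, dirder u x != 0 -> box (L + M) x.
Proof.
move=> KL x h; apply: (sqd_far cK KL); apply: contra_neq h => h.
by rewrite /dirder h mulr0 mul0r.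
Qed.

Variable B : R -> R.
Hypotheses (dB : forall s : R, is_derive s 1 B (- b s))
  (BM : forall s, M ^+ 2 <= s -> B s = 0) (cB : continuous B).

(** For a unit vector [u], the distance from [K] to the line {x . u = tau}, by [line_nearest]. *)
Definition linedist (u : R * R) (tau : R) :=
  Num.max 0 (Num.max (tau - hsup K u) (- tau - hsup K (- u))).

(* On a line, [B (sqd K)] increases and then decreases, so its total variation is
   twice its maximum. *)
Lemma line_variation (u : R * R) (y : R) : dotp u u = 1 -> u.1 != 0 ->
  \int[mu]_t `|dirder u (y + (- u.2 / u.1) * t, t)| = 2 * `|u.1| * B (linedist u (y * u.1) ^+ 2).
Proof.
move=> u1 c0; have [L L0 KL] := compact_box (let: And3 h _ _ := cK in h).
pose w : R * R := (- u.2 / u.1, 1).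
pose q : R * R := (y, 0).
have pE t : (y + (- u.2 / u.1) * t, t) = q + t *: w.
  by apply/pair_equal_spec; split; rewrite /= /GRing.scale/=; ring.
have wE : perp u = u.1 *: w.
  by apply/pair_equal_spec; split; rewrite /= /GRing.scale/=; [field|ring].
have [x0 [x0u x0r x0d]] := line_nearest (y * u.1) cK u1.
pose t0 := x0.2.
have x0E : x0 = q + t0 *: w.
  rewrite -pE [LHS]surjective_pairing; congr pair.
  apply: (mulIf c0); rewrite mulrDl -x0u /dotp /t0; field.
  exact: c0.
(* Half the slope of [sqd K] along the line. It is nondecreasing and vanishes at [t0], so its sign
   is known on both sides. *)
pose D t := dotp (resid K (q + t *: w)) w.
have D0 : D t0 = 0.
  by rewrite /D -x0E; apply: (mulfI c0); rewrite mulr0 -dotpZr -wE.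
have Dmono s t : s <= t -> D s <= D t.
  move=> st; have := proj_mono (q + t *: w) (q + s *: w) cK.
  have -> : q + t *: w - (q + s *: w) = (t - s) *: w.
    by apply/pair_equal_spec; split; rewrite /= /GRing.scale/=; ring.
  move: st; rewrite le_eqVlt => /predU1P[->//|st].
  by rewrite dotpZr pmulr_rge0 ?subr_gt0// dotpBl subr_ge0.
pose k t := B (sqd K (q + t *: w)).
pose beta t := b (sqd K (q + t *: w)).
have dk : forall t : R, is_derive t 1 k (- (2 * beta t * D t)).
  move=> t; have := grad_line (sqd_grad (q + t *: w) cK) => h.
  apply: (deq (dercomp (dB _) h)).
  by rewrite dotpZl /beta /D; ring.
have cline : continuous (fun t : R => q + t *: w).
  move=> t; apply: cvgD; first exact: cvg_cst.
  exact: (cvgZr_tmp (@cvg_id _ (nbhs t))).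
have cD : continuous D := cts_comp (cts_comp cline cres) (@dotp_cont_r _ w).
have cbeta : continuous beta := cts_comp (cts_comp cline sqd_cont) cb.
have cbD : continuous (fun t => 2 * beta t * D t).
  exact: cts_mul (cts_mul (@cts_cst _ _ 2) cbeta) cD.
have gE t : `|dirder u (y + (- u.2 / u.1) * t, t)| = `|u.1| * `|2 * beta t * D t|.
  by rewrite pE -normrM /dirder wE dotpZr; congr `|_|; rewrite /beta /D; ring.
pose T := Num.max (L + M) `|t0| + 1.
have T1 : L + M < T by rewrite /T ltr_pwDr// le_max lexx.
have T2' : `|t0| < T by rewrite /T ltr_pwDr// le_max lexx orbT.
have [Tt0 t0T] : - T <= t0 /\ t0 <= T by have := T2'; rewrite ltr_norml; lra.
have betaT t : beta t != 0 -> `|t| <= L + M.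
  move=> /(sqd_far cK KL)/in_box[_] /=.
  by rewrite /GRing.scale/= add0r mulr1.
rewrite (_ : (fun t => _) = (fun t => `|u.1| * `|2 * beta t * D t|)); last exact/funext.
have cabs : continuous (fun t => `|2 * beta t * D t|).
  by move=> t; apply: cvg_norm; exact: cbD.
rewrite (Rintegral_segment (a := - T) (b := T)); last first.
  move=> t h; rewrite -ler_norml; apply: ltW; apply: le_lt_trans T1; apply: betaT.
  by apply: contra_neq h => ->; rewrite mulr0 mul0r normr0 mulr0.
rewrite RintegralZl//; last exact: integrable_cont.
rewrite (Rint_split cabs Tt0 t0T).
have kT t : L + M < `|t| -> k t = 0.
  move=> h; apply: BM; rewrite leNgt; apply/negP => h'.
  have [p1 _] := projP (q + t *: w) cK.
  have [_ pb] := (in_box _ _).1 (KL _ p1).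
  have [_] := dotp_normle (resid K (q + t *: w)).
  have -> : (resid K (q + t *: w)).2 = t - (cproj K (q + t *: w)).2.
    by rewrite /resid/= /GRing.scale/=; ring.
  move=> h2; have h3 : `|t - (cproj K (q + t *: w)).2| ^+ 2 < M ^+ 2.
    by apply: le_lt_trans h'.
  move: h3; rewrite ltr_pXn2r// ?nnegrE ?ltW// => h3.
  have := ler_normD (t - (cproj K (q + t *: w)).2) (cproj K (q + t *: w)).2.
  by rewrite subrK; lra.
have e1 : \int[mu]_(t in `[- T, t0]) `|2 * beta t * D t| = k t0.
  have -> : \int[mu]_(t in `[- T, t0]) `|2 * beta t * D t| =
            \int[mu]_(t in `[- T, t0]) - (2 * beta t * D t).
    apply: eq_Rintegral => t /set_mem; rewrite /= in_itv/= => /andP[_ tt0].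
    have bt : 0 <= 2 * beta t by rewrite mulr_ge0 ?b0.
    have Dt : D t <= 0 by rewrite -D0; exact: Dmono.
    by rewrite ler0_norm// mulr_ge0_le0.
  rewrite (Rint_FTC Tt0 (cts_opp cbD) dk) [k (- T)]kT ?subr0//.
  by rewrite normrN; have := ler_norm T; lra.
have e2 : \int[mu]_(t in `[t0, T]) `|2 * beta t * D t| = k t0.
  have -> : \int[mu]_(t in `[t0, T]) `|2 * beta t * D t| =
            \int[mu]_(t in `[t0, T]) (2 * beta t * D t).
    apply: eq_Rintegral => t /set_mem; rewrite /= in_itv/= => /andP[tt0 _].
    have bt : 0 <= 2 * beta t by rewrite mulr_ge0 ?b0.
    have Dt : 0 <= D t by rewrite -D0; exact: Dmono.
    by rewrite ger0_norm// mulr_ge0.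
  have dk' : forall t : R, is_derive t 1 (fun t => - k t) (2 * beta t * D t).
    by move=> t; apply: (deq (derN (dk t))); rewrite opprK.
  rewrite (Rint_FTC t0T cbD dk') [k T]kT ?oppr0 ?opprK ?add0r//.
  by have := ler_norm T; lra.
rewrite e1 e2 /k -x0E x0d /linedist; ring.
Qed.

Lemma linedist_cont u : continuous (linedist u).
Proof.
have c1 : continuous (fun t : R => t - hsup K u) by exact: cts_shift.
have c2 : continuous (fun t : R => - t - hsup K (- u)).
  by move=> t; exact: (cvgB (cvgN (@cvg_id _ (nbhs t))) (cvg_cst _)).
exact: cts_max (@cts_cst _ _ 0) (cts_max c1 c2).
Qed.

Lemma cts_sqr (T : topologicalType) (f : T -> R) : continuous f -> continuous (fun x => f x ^+ 2).
Proof. by move=> cf; exact: (cts_mul cf cf). Qed.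

(** [linedist u] is 0 while the line meets [K], on an interval as long as the width of [K] in the
    direction [u], and grows with slope one on both sides. *)
Lemma integral_linedist u : dotp u u = 1 ->
  \int[mu]_tau B (linedist u tau ^+ 2) =
  B 0 * (hsup K u + hsup K (- u)) + 2 * \int[mu]_(s in `[0, M]) B (s ^+ 2).
Proof.
move=> u1; set h := hsup K u; set h' := hsup K (- u).
have hh : - h' <= h.
  have [z2 K2 E2] := hsup_att (- u) cK.
  by have := hsup_ge u cK K2; rewrite /h /h' -E2 dotpNr; lra.
have cs2 : continuous (fun s : R => s ^+ 2) by apply: cts_sqr => x; exact: cvg_id.
have cBs : continuous (fun s : R => B (s ^+ 2)) := cts_comp cs2 cB.
have cBd : continuous (fun t => B (linedist u t ^+ 2)).
  exact: cts_comp (cts_sqr (@linedist_cont u)) cB.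
have [E dE] := antideriv cBs.
rewrite (Rintegral_segment (a := - h' - M) (b := h + M)); last first.
  move=> t Bt; have hl : linedist u t < M.
    have l0 : 0 <= linedist u t by rewrite /linedist le_max lexx.
    by rewrite ltNge; apply: contra Bt => Ml; apply/eqP/BM; rewrite ler_pXn2r// nnegrE ltW.
  by move: hl; rewrite /linedist !gt_max -/h -/h'; lra.
have i1 : - h' - M <= - h' by rewrite lerBlDr lerDl ltW.
have i2 : h <= h + M by rewrite lerDl ltW.
rewrite (Rint_split cBd i1 (le_trans hh i2)) (Rint_split cBd hh i2).
have -> : \int[mu]_(t in `[- h' - M, - h']) B (linedist u t ^+ 2) =
          \int[mu]_(t in `[- h' - M, - h']) B ((- 1 * t + - h') ^+ 2).
  apply: eq_Rintegral => t /set_mem; rewrite /= in_itv/= => ht; congr (B (_ ^+ 2)).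
  rewrite /linedist -/h -/h'.
  have -> : Num.max (t - h) (- t - h') = - t - h' by rewrite max_r//; lra.
  by rewrite max_r; lra.
have -> : \int[mu]_(t in `[- h', h]) B (linedist u t ^+ 2) =
          \int[mu]_(t in `[- h', h]) cst (B 0) t.
  apply: eq_Rintegral => t /set_mem; rewrite /= in_itv/= => ht.
  by rewrite /linedist -/h -/h' max_l ?expr0n// ge_max; lra.
have -> : \int[mu]_(t in `[h, h + M]) B (linedist u t ^+ 2) =
          \int[mu]_(t in `[h, h + M]) B ((1 * t + - h) ^+ 2).
  apply: eq_Rintegral => t /set_mem; rewrite /= in_itv/= => ht; congr (B (_ ^+ 2)).
  rewrite /linedist -/h -/h'.
  have -> : Num.max (t - h) (- t - h') = t - h by rewrite max_l//; lra.
  by rewrite max_r; lra.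
have c1 := cts_comp (@cts_affine _ (- 1) (- h')) cBs.
have c2 := cts_comp (@cts_affine _ 1 (- h)) cBs.
have dE1 : forall t : R, is_derive t 1 (fun t => - E (- 1 * t + - h')) (B ((- 1 * t + - h') ^+ 2)).
  by move=> t; apply: (deq (derN (is_derive_comp_affine (- 1) (- h') dE t))); ring.
have dE2 : forall t : R, is_derive t 1 (fun t => E (1 * t + - h)) (B ((1 * t + - h) ^+ 2)).
  by move=> t; apply: (deq (is_derive_comp_affine 1 (- h) dE t)); ring.
have dE3 : forall t : R, is_derive t 1 (fun t => B 0 * t) (cst (B 0) t).
  by move=> t; apply: (deq (derZ (B 0) (derI t))); rewrite mulr1.
rewrite (Rint_FTC i1 c1 dE1) (Rint_FTC i2 c2 dE2).
rewrite (Rint_FTC hh (@cts_cst _ _ (B 0)) dE3).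
rewrite (Rint_FTC (ltW M0) cBs dE).
have -> : - 1 * - h' + - h' = 0 by ring.
have -> : - 1 * (- h' - M) + - h' = M by ring.
have -> : 1 * (h + M) + - h = M by ring.
have -> : 1 * h + - h = 0 by ring.
ring.
Qed.

(** Integration of [line_variation] over the parallel lines. The substitution tau = y u.1 brings the
    factor 1 / |u.1|, which cancels |u.1|. *)
Lemma plane_variation u : dotp u u = 1 -> u.1 != 0 ->
  I2 (fun x => `|dirder u x|) =
  2 * (B 0 * (hsup K u + hsup K (- u)) + 2 * \int[mu]_(s in `[0, M]) B (s ^+ 2)).
Proof.
move=> u1 c0; have [L L0 KL] := compact_box (let: And3 h _ _ := cK in h).
have cabs : continuous (fun x => `|dirder u x|).
  by move=> t; apply: cvg_norm; exact: dirder_cont.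
have supp x : `|dirder u x| != 0 -> box (L + M) x.
  by rewrite normr_eq0; exact: dirder_supp.
have [bs ->] := I2_shear (- u.2 / u.1) cabs supp.
rewrite (I2_fubini bs) /=.
under eq_Rintegral do rewrite (line_variation _ u1 c0).
have cBd : continuous (fun t => B (linedist u t ^+ 2)).
  exact: cts_comp (cts_sqr (@linedist_cont u)) cB.
pose N := `|hsup K u| + `|hsup K (- u)| + M.
have suppB t : B (linedist u t ^+ 2) != 0 -> `|t| <= N.
  move=> Bt; have hl : linedist u t < M.
    have l0 : 0 <= linedist u t by rewrite /linedist le_max lexx.
    by rewrite ltNge; apply: contra Bt => Ml; apply/eqP/BM; rewrite ler_pXn2r// nnegrE ltW.
  move: hl; rewrite /linedist !gt_max ler_norml /N.
  have := ler_norm (hsup K u); have := ler_norm (hsup K (- u)).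
  by have := normr_ge0 (hsup K u); have := normr_ge0 (hsup K (- u)); lra.
have cf : continuous (fun t => 2 * `|u.1| * B (linedist u t ^+ 2)).
  exact: cts_mul (@cts_cst _ _ (2 * `|u.1|)) cBd.
have suppf t : 2 * `|u.1| * B (linedist u t ^+ 2) != 0 -> `|t| <= N.
  by move=> h; apply: suppB; apply: contra_neq h => ->; rewrite mulr0.
have := integral_affine 0 c0 cf suppf.
rewrite (_ : (fun y => _) = (fun x => 2 * `|u.1| * B (linedist u (x * u.1) ^+ 2))); last first.
  by apply/funext => y; rewrite addr0 [u.1 * y]mulrC.
move=> ->; rewrite -(integral_linedist u1).
rewrite (Rintegral_segment (a := - N) (b := N)) => [|t /suppf]; last by rewrite ler_norml.
rewrite RintegralZl//; last exact: integrable_cont.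
rewrite [in RHS](Rintegral_segment (a := - N) (b := N)) => [|t /suppB]; last by rewrite ler_norml.
rewrite mulrA; congr (_ * _); rewrite mulrCA mulVf ?mulr1// normr_eq0//.
Qed.

End fixed_body.
End profile.
End steiner.

(* The library equips products of sigma-finite measures with a sigma-finite
   structure, but that instance is shadowed by the one for subprobabilities. *)
Section plane_measure.
Context {R : realType}.
Notation T2 := (measurableTypeR R * measurableTypeR R)%type.

Definition plane_measure : set T2 -> \bar R := @leb2 R.

HB.instance Definition _ := Measure.copy plane_measure
  (@lebesgue_measure R \x @lebesgue_measure R)%E.

Lemma plane_measure_sigma_finite : sigma_finite setT plane_measure.
Proof.
exists (fun n => box n%:R) => [|n].
  apply/esym/seteqP; split => // -[x y] _.
  have [n hn] : exists n : nat, Num.max `|x| `|y| <= n%:R.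
    exists (Num.truncn (Num.max `|x| `|y|)).+1; apply: ltW.
    have h0 : 0 <= Num.max `|x| `|y| by rewrite le_max normr_ge0.
    by have /andP[] := truncn_itv h0.
  exists n => //; apply/in_box => /=.
  by move: hn; rewrite ge_max => /andP.
split; first exact: measurable_box.
case: n => [|n]; last by rewrite /plane_measure leb2_box ?ltry.
rewrite (_ : box 0 = [set (0 : R)] `*` [set (0 : R)]).
  by rewrite /plane_measure /leb2 product_measure1E//= lebesgue_measure_set1 mule0 ltry.
by rewrite /box oppr0 set_itv1.
Qed.

HB.instance Definition _ := Measure_isSigmaFinite.Build _ _ _ plane_measure
  plane_measure_sigma_finite.

End plane_measure.

(** * Averaging over directions *)

Section steiner_formula.
Context {R : realType}.
Notation mu := (@lebesgue_measure R).
Notation T2 := (measurableTypeR R * measurableTypeR R)%type.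
Implicit Types K : set (R * R).

Definition udir (th : R) : R * R := (cos th, sin th).

Lemma udir_unit th : dotp (udir th) (udir th) = 1.
Proof. by rewrite /dotp/= -!expr2 cos2Dsin2. Qed.

Lemma udir_cont : continuous udir.
Proof. exact: (continuous_pair (@continuous_cos R) (@continuous_sin R)). Qed.

Lemma udirDpi th : udir (th + pi) = - udir th.
Proof. by rewrite /udir cosDpi sinDpi. Qed.

(** Pi times the mean width; for a convex body this is the perimeter, by [perimeterE]. *)
Definition mwidth K := \int[mu]_(th in `[0, 2 * pi]) support_fun K th.

Lemma support_cont K : ccn K -> continuous (support_fun K).
Proof.
move=> cK th; have [L L0 KL] := compact_box (let: And3 h _ _ := cK in h).
apply/cvgrPdist_le => /= e e0.
have eL : 0 < e / (2 * L) by rewrite divr_gt0// mulr_gt0.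
near=> y.
rewrite !support_funE; apply: le_trans (hsup_lip _ _ cK KL) _ => /=.
have e1 : `|cos th - cos y| <= e / (2 * L).
  by near: y; have /cvgrPdist_le/(_ _ eL) := (@continuous_cos R th).
have e2 : `|sin th - sin y| <= e / (2 * L).
  by near: y; have /cvgrPdist_le/(_ _ eL) := (@continuous_sin R th).
have -> : e = L * (e / (2 * L) + e / (2 * L)) by field; lra.
by rewrite ler_pM2l// lerD.
Unshelve. all: by end_near. Qed.

Lemma support_2pi K th : support_fun K (th + 2 * pi) = support_fun K th.
Proof. by rewrite /support_fun mulr_natl cosD2pi sinD2pi. Qed.

Lemma pi2_ge0 : 0 <= 2 * pi :> R. Proof. by have := pi_gt0 R; lra. Qed.

Lemma mwidth_opp K : ccn K ->
  \int[mu]_(th in `[0, 2 * pi]) hsup K (- udir th) = mwidth K.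
Proof.
move=> cK; rewrite /mwidth -(periodic_shift pi pi2_ge0 (support_cont cK) (@support_2pi K)).
by apply: eq_Rintegral => th _; rewrite support_funE -udirDpi.
Qed.

Lemma cos_eq0_2pi (th : R) : 0 <= th <= 2 * pi -> cos th = 0 -> th = pi / 2 \/ th = 2 * pi - pi / 2.
Proof.
move=> /andP[h1 h2] c0; have pi0 := pi_gt0 R.
have key (x : R) : 0 <= x <= pi -> cos x = 0 -> x = pi / 2.
  move=> hx cx; apply: cos_inj; rewrite ?in_itv/= ?cx ?cos_pihalf//; lra.
have [h|h] := lerP th pi; first by left; apply: key => //; lra.
right; rewrite -(key (2 * pi - th)); [ring|lra|].
by rewrite cosB mulr_natl cos2pi sin2pi c0; ring.
Qed.

Lemma measurable_pair_fun (f : R * R -> R) (g : R -> R) :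
  measurable_fun (setT : set T2) f -> measurable_fun setT g ->
  measurable_fun (setT : set (T2 * measurableTypeR R)) (fun z => f z.1 * g z.2).
Proof.
move=> mf mg; apply: measurable_funM.
  exact: (measurableT_comp mf measurable_fst).
exact: (measurableT_comp mg measurable_snd).
Qed.

(** Made for the two directions with zero cosine. [g] is written as [f] plus two spikes supported at
    points, which also supplies its integrability. *)
Lemma Rintegral_except2 (f g : R -> R) (a b p q : R) : p != q -> continuous f ->
  (forall x, a <= x <= b -> x != p -> x != q -> g x = f x) ->
  \int[mu]_(x in `[a, b]) g x = \int[mu]_(x in `[a, b]) f x.
Proof.
move=> pq cf gf.
pose D : set R := `[a, b]%classic.
pose k (z : R) : R -> R := cst ((g \_ D) z - (f \_ D) z) \_ [set z].
have ik z : mu.-integrable setT (EFin \o k z).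
  have mz : measurable ([set z] : set (measurableTypeR R)) by exact: measurable_set1.
  rewrite /k -restrict_EFin; apply: (proj1 (integrable_mkcond _ mz)).
  apply: measurable_bounded_integrable => //.
    by rewrite /= lebesgue_measure_set1 ltry.
  exists `|(g \_ D) z - (f \_ D) z|; split; first by rewrite num_real.
  by move=> N hN x _ /=; exact: ltW.
have iF : mu.-integrable setT (EFin \o (f \_ D)).
  have mD : measurable (D : set (measurableTypeR R)) by exact: measurable_itv.
  rewrite -restrict_EFin; apply: (proj1 (integrable_mkcond _ mD)).
  exact: integrable_cont.
have kE z x : x != z -> k z x = 0.
  by move=> xz; rewrite /k patchE memNset//= => /eqP; rewrite (negbTE xz).
have k0 z : \int[mu]_x k z x = 0 by apply: (@Rintegral_null _ _ z) => x; exact: kE.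
have kz z : k z z = (g \_ D) z - (f \_ D) z by rewrite /k patchE mem_set.
rewrite Rintegral_mkcond [RHS]Rintegral_mkcond.
rewrite (_ : g \_ D = fun x => (f \_ D) x + (k p x + k q x)).
  rewrite RintegralD//; last exact: integrableD (ik p) (ik q).
  by rewrite RintegralD// !k0 !addr0.
apply/funext => x.
have [->|xp] := eqVneq x p; first by rewrite kz kE// addr0 addrC subrK.
have [->|xq] := eqVneq x q; first by rewrite kz kE 1?eq_sym// add0r addrC subrK.
rewrite !kE// !addr0 !patchE; case: ifPn => // /set_mem; rewrite /D /= in_itv/= => xab.
exact: gf.
Qed.

Lemma tonelli_angle (b : R -> R) (M : R) K : continuous b -> 0 < M ->
  (forall s, M ^+ 2 <= s -> b s = 0) -> ccn K ->
  I2 (fun x => \int[mu]_(th in `[0, 2 * pi]) `|dirder b K (udir th) x|) =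
  \int[mu]_(th in `[0, 2 * pi]) I2 (fun x => `|dirder b K (udir th) x|).
Proof.
move=> cb M0 bM cK; have [L L0 KL] := compact_box (let: And3 h _ _ := cK in h).
pose G (z : T2 * measurableTypeR R) : R :=
  `|dirder b K (udir z.2) z.1| * \1_(`[0, 2 * pi]%classic : set R) z.2.
have mG : measurable_fun (setT : set (T2 * measurableTypeR R)) G.
  apply: measurable_funM; last first.
    apply: (measurableT_comp _ measurable_snd); apply: measurable_indic.
    exact: measurable_itv.
  apply: measurableT_comp => //.
  (* Expanded in sine and cosine, the integrand is a sum of products of a continuous function of the
     point and one of the angle; this gives joint measurability. *)
  rewrite (_ : (fun x => _) = (fun z : T2 * measurableTypeR R =>
    (2 * b (sqd K z.1) * (resid K z.1).1) * - sin z.2 +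
    (2 * b (sqd K z.1) * (resid K z.1).2) * cos z.2)); last first.
    by apply/funext => z; rewrite /dirder /dotp/=; ring.
  have c0 : continuous (fun x => 2 * b (sqd K x)).
    exact: cts_mul (@cts_cst _ _ 2) (cts_comp (sqd_cont cK) cb).
  have c1 : continuous (fun x => 2 * b (sqd K x) * (resid K x).1).
    apply: cts_mul c0 _; apply: (cts_comp (resid_cont cK)) => x.
    exact: (grad_continuous (grad_fst x)).
  have c2 : continuous (fun x => 2 * b (sqd K x) * (resid K x).2).
    apply: cts_mul c0 _; apply: (cts_comp (resid_cont cK)) => x.
    exact: (grad_continuous (grad_snd x)).
  have m1 := measurable_pair_fun (continuous_measurable2 c1)
    (continuous_measurable_fun (cts_opp (@continuous_sin R))).
  have m2 := measurable_pair_fun (continuous_measurable2 c2)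
    (continuous_measurable_fun (@continuous_cos R)).
  exact: measurable_funD m1 m2.
have mGE : measurable_fun (setT : set (T2 * measurableTypeR R)) (EFin \o G) by exact/measurable_EFinP.
have G0 z : (0 <= (EFin \o G) z)%E.
  by rewrite lee_fin mulr_ge0// indicE.
have ft := fubini_tonelli (m1 := @plane_measure R) (m2 := mu) (EFin \o G) mGE G0.
have inner1 x : (\int[mu]_th (EFin \o G) (x, th) =
   (\int[mu]_(th in `[0, 2 * pi]) `|dirder b K (udir th) x|)%:E)%E.
  have cx : continuous (fun th => `|dirder b K (udir th) x|).
    move=> th; apply: cvg_norm; apply: cvgM; first exact: cvg_cst.
    have cp : continuous (fun th => perp (udir th)).
      apply: (cts_comp udir_cont); apply: continuous_pair.
        by apply: cts_opp => y; exact: (grad_continuous (grad_snd y)).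
      by move=> y; exact: (grad_continuous (grad_fst y)).
    rewrite (_ : (fun y => _) = (fun th => dotp (perp (udir th)) (resid K x))).
      rewrite dotpC; exact: (cts_comp cp (@dotp_cont_r _ (resid K x))).
    by apply/funext => y; rewrite dotpC.
  rewrite /Rintegral fineK; last by apply: integrable_fin_num => //; exact: integrable_cont.
  rewrite [RHS]integral_mkcond; apply: eq_integral => th _.
  by rewrite patchE /G/= indicE; case: (_ \in _); rewrite ?mulr1 ?mulr0.
have inner2 th : (\int[@leb2 R]_x (EFin \o G) (x, th) =
   (\1_(`[0, 2 * pi]%classic : set R) th * I2 (fun x => `|dirder b K (udir th) x|))%:E)%E.
  have cd : continuous (fun x => `|dirder b K (udir th) x|).
    by move=> x; apply: cvg_norm; exact: dirder_cont.
  have bd : bmc (fun x => `|dirder b K (udir th) x|).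
    apply: (@bmc_continuous _ _ (L + M) cd) => x; rewrite normr_eq0.
    exact: (dirder_supp M0 bM cK KL).
  rewrite -I2Z// -I2_fin; last exact: bmcZ.
  by apply: eq_integral => x _; rewrite /= /G mulrC.
rewrite /I2 {1}/Rintegral.
under eq_integral do rewrite -inner1.
rewrite ft [RHS]Rintegral_mkcond /Rintegral; congr fine.
apply: eq_integral => th _; rewrite inner2 patchE indicE.
by case: (_ \in _); rewrite ?mul1r ?mul0r.
Qed.

(* Averages [plane_variation] over all directions with [integral_abs_dir]. *)
Lemma steiner (b : R -> R) (M : R) K : continuous b -> (forall s, 0 <= b s) -> 0 < M ->
  (forall s, M ^+ 2 <= s -> b s = 0) -> ccn K ->
  I2 (fun x => 2 * b (sqd K x) * enorm (resid K x)) =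
  \int[mu]_(s in `[0, M]) (2 * s * b (s ^+ 2) * (mwidth K + 2 * pi * s)).
Proof.
move=> cb b0 M0 bM cK; have [B [dB BM cB B0]] := profile_primitive cb b0 bM.
set S := \int[mu]_(s in `[0, M]) B (s ^+ 2).
have cs2 : continuous (fun s : R => s ^+ 2) by apply: cts_sqr => x; exact: cvg_id.
have cBs : continuous (fun s : R => B (s ^+ 2)) := cts_comp cs2 cB.
have cbs : continuous (fun s : R => b (s ^+ 2)) := cts_comp cs2 cb.
have ch := support_cont cK.
have cho : continuous (fun th => hsup K (- udir th)).
  rewrite (_ : (fun th => _) = (fun th => support_fun K (th + pi))).
    exact: cts_comp (@cts_shift _ pi) ch.
  by apply/funext => th; rewrite support_funE -udirDpi.
have E1 : I2 (fun x => 4 * (2 * b (sqd K x) * enorm (resid K x))) = 4 * (B 0 * mwidth K + 2 * pi * S).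
  rewrite (_ : (fun x => _) = (fun x => \int[mu]_(th in `[0, 2 * pi]) `|dirder b K (udir th) x|)); last first.
    apply/funext => x.
    have e th : `|dirder b K (udir th) x| = 2 * b (sqd K x) * `|dotp (resid K x) (perp (cos th, sin th))|.
      by rewrite /dirder normrM ger0_norm// mulr_ge0.
    under eq_Rintegral do rewrite e.
    rewrite RintegralZl//; first by rewrite integral_abs_dir; ring.
    apply: integrable_cont => th; apply: cvg_norm.
    have cp : continuous (fun th => perp (udir th)).
      apply: (cts_comp udir_cont); apply: continuous_pair.
        by apply: cts_opp => y; exact: (grad_continuous (grad_snd y)).
      by move=> y; exact: (grad_continuous (grad_fst y)).
    rewrite (_ : (fun y => _) = (fun th => dotp (perp (udir th)) (resid K x))).
      rewrite dotpC; exact: (cts_comp cp (@dotp_cont_r _ (resid K x))).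
    by apply/funext => y; rewrite dotpC.
  rewrite (tonelli_angle cb M0 bM cK).
  pose f th := 2 * (B 0 * (support_fun K th + hsup K (- udir th)) + 2 * S).
  have cf : continuous f.
    apply: (cts_mul (@cts_cst _ _ 2)); apply: cts_add (@cts_cst _ _ (2 * S)).
    exact: (cts_mul (@cts_cst _ _ (B 0)) (cts_add ch cho)).
  transitivity (\int[mu]_(th in `[0, 2 * pi]) f th).
    apply: (@Rintegral_except2 _ _ _ _ (pi / 2) (2 * pi - pi / 2)) => //.
      by apply/eqP => h; have := pi_gt0 R; lra.
    move=> th th2 h1 h2; rewrite /f support_funE.
    apply: (plane_variation cb b0 M0 bM cK dB BM cB (udir_unit th)) => /=.
    by apply/eqP => /(cos_eq0_2pi th2)[/eqP|/eqP]; apply/negP.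
  have i1 := @integrable_cont _ _ 0 (2 * pi) ch.
  have i2 := @integrable_cont _ _ 0 (2 * pi) cho.
  have i12 := @integrable_cont _ _ 0 (2 * pi) (cts_add ch cho).
  have i3 := @integrable_cont _ _ 0 (2 * pi) (cts_mul (@cts_cst _ _ (B 0)) (cts_add ch cho)).
  have i4 := @integrable_cont _ _ 0 (2 * pi) (cts_add (cts_mul (@cts_cst _ _ (B 0)) (cts_add ch cho)) (@cts_cst _ _ (2 * S))).
  rewrite /f RintegralZl// RintegralD//; last exact: integrable_cont (@cts_cst _ _ (2 * S)).
  rewrite RintegralZl// RintegralD// (mwidth_opp cK) -/(mwidth K).
  have -> : \int[mu]_(x in `[0, 2 * pi]) (2 * S) = 2 * pi * (2 * S).
    have dc : forall x : R, is_derive x 1 (fun x => (2 * S) * x) (2 * S).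
      by move=> x; apply: (deq (derZ (2 * S) (derI x))); rewrite mulr1.
    by rewrite (Rint_FTC pi2_ge0 (@cts_cst _ _ (2 * S)) dc); ring.
  by ring.
have [L L0 KL] := compact_box (let: And3 h _ _ := cK in h).
have bsupp : bmc (fun x => 2 * b (sqd K x) * enorm (resid K x)).
  apply: (@bmc_continuous _ _ (L + M)).
    apply: cts_mul; first exact: cts_mul (@cts_cst _ _ 2) (cts_comp (sqd_cont cK) cb).
    exact: (cts_comp (sqd_cont cK) (@sqrt_continuous R)).
  move=> x h; apply: (sqd_far M0 bM cK KL); apply: contra_neq h => ->.
  by rewrite mulr0 mul0r.
have {E1} -> : I2 (fun x => 2 * b (sqd K x) * enorm (resid K x)) = B 0 * mwidth K + 2 * pi * S.
  by move: E1; rewrite I2Z// => /mulfI; apply.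
have dB2 : forall s : R, is_derive s 1 (fun s => B (s ^+ 2)) (- (2 * s * b (s ^+ 2))).
  move=> s; have h : is_derive s 1 (fun s : R => s ^+ 2) (2 * s).
    by apply: (deq (derM (derI s) (derI s))); ring.
  have h2 := @dercomp _ B (fun s : R => s ^+ 2) s _ _ (dB (s ^+ 2)) h.
  by apply: (deq h2); ring.
have c1 : continuous (fun s : R => 2 * s * b (s ^+ 2)).
  by apply: cts_mul cbs; apply: cts_mul (@cts_cst _ _ 2) _ => x; exact: cvg_id.
have [E dE] := antideriv cBs.
(* A primitive found by parts: [E] has derivative [B (s ^+ 2)], whose own derivative is
   [- (2 * s * b (s ^+ 2))]. *)
have dG : forall s : R, is_derive s 1 (fun s => - mwidth K * B (s ^+ 2) + 2 * pi * (E s - s * B (s ^+ 2)))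
    (2 * s * b (s ^+ 2) * (mwidth K + 2 * pi * s)).
  move=> s; apply: (deq (derD (derZ (- mwidth K) (dB2 s))
     (derZ (2 * pi) (derB (dE s) (derM (derI s) (dB2 s)))))).
  by ring.
have c2 : continuous (fun s : R => 2 * s * b (s ^+ 2) * (mwidth K + 2 * pi * s)).
  apply: (cts_mul c1); apply: (cts_add (@cts_cst _ _ (mwidth K))).
  by apply: cts_mul (@cts_cst _ _ (2 * pi)) _ => x; exact: cvg_id.
rewrite (Rint_FTC (ltW M0) c2 dG) /S (Rint_FTC (ltW M0) cBs dE).
rewrite (BM (M ^+ 2))// expr0n/=; ring.
Qed.

End steiner_formula.

(** * A smoothed maximum of affine functions *)

Section softmax.
Context {R : realType}.
Notation mu := (@lebesgue_measure R).
Notation T2 := (measurableTypeR R * measurableTypeR R)%type.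
Implicit Types K : set (R * R).

Lemma I2_dct (f : nat -> R * R -> R) (g h : R * R -> R) :
  (forall n, bmc (f n)) -> bmc g -> bmc h -> (forall n x, `|f n x| <= h x) ->
  (forall x, f ^~ x @ \oo --> g x) -> I2 (f n) @[n --> \oo] --> I2 g.
Proof.
move=> bf bg bh fh fg.
have [|||||_ _ cv] := @dominated_convergence _ _ _ (@leb2 R) setT measurableT
  (fun n x => (f n x)%:E) (fun x => (g x)%:E) (fun x => (h x)%:E).
- by move=> n; apply/measurable_EFinP; exact: (bf n).1.
- by apply/measurable_EFinP; exact: bg.1.
- by apply: aeW => x _; apply: cvg_EFin; [exact: nearW|exact: fg].
- exact: bmc_int.
- by apply: aeW => x n _; rewrite lee_fin.
move: cv; rewrite (I2_fin bg) (_ : (fun n => _) = (fun n => (I2 (f n))%:E)); last first.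
  by apply/funext => n; rewrite I2_fin.
by move=> /fine_cvgP[].
Qed.

Lemma lip_derive (F f : R -> R) (C : R) : (forall x : R, is_derive x 1 F (f x)) ->
  (forall x, `|f x| <= C) -> forall x y, `|F x - F y| <= C * `|x - y|.
Proof.
move=> dF fC x y.
wlog xy : x y / y < x => [H|].
  have [xy|xy|->] := ltgtP x y; last by rewrite !subrr normr0 mulr0.
    by rewrite distrC (distrC x); exact: H.
  exact: H.
have [c _ ->] := @MVT _ F f y x xy (fun z _ => dF z)
  (continuous_subspaceT (fun z => is_derive_continuous (dF z))).
by rewrite normrM ler_wpM2r.
Qed.

Lemma cts_sum (T : topologicalType) n (f : 'I_n -> T -> R) : (forall i, continuous (f i)) ->
  continuous (fun x => \sum_(i < n) f i x).
Proof.
elim: n f => [|n IH] f cf.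
  by rewrite (_ : (fun x => _) = cst 0); [exact: cts_cst|apply/funext => y; rewrite big_ord0].
rewrite (_ : (fun x => _) = (fun x => \sum_(i < n) f (widen_ord (leqnSn n) i) x + f ord_max x)).
  exact: (cts_add (IH _ (fun i => cf _)) (cf _)).
by apply/funext => x; rewrite big_ord_recr.
Qed.

Lemma C1_sum n (f : 'I_n -> R * R -> R) : (forall i, C1 (f i)) ->
  C1 (fun x => \sum_(i < n) f i x) /\
  forall x, d1 (fun x => \sum_(i < n) f i x) x = \sum_(i < n) d1 (f i) x /\
            d2 (fun x => \sum_(i < n) f i x) x = \sum_(i < n) d2 (f i) x.
Proof.
elim: n f => [|n IH] f Cf.
  have [||C E] := @C1_intro _ (fun x => \sum_(i < 0) f i x) (fun _ => (0, 0)).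
  - move=> x; rewrite (_ : (fun x => _) = cst 0); first exact: grad_cst.
    by apply/funext => y; rewrite big_ord0.
  - exact: cts_cst2.
  - by split => // x; rewrite !big_ord0; have [] := E x.
have [C E] := IH (fun i => f (widen_ord (leqnSn n) i)) (fun i => Cf _).
have e : (fun x => \sum_(i < n.+1) f i x) =
  (fun x => \sum_(i < n) f (widen_ord (leqnSn n) i) x + f ord_max x).
  by apply/funext => x; rewrite big_ord_recr.
have [C' E'] := C1_D C (Cf ord_max).
rewrite e; split => // x; rewrite !big_ord_recr /=.
by have [-> ->] := E' x; have [-> ->] := E x.
Qed.

Variables (n : nat) (nu : 'I_n.+1 -> R * R) (a : 'I_n.+1 -> R) (eps : R).
Hypothesis eps0 : 0 < eps.

(* [smean] is the gradient of the convex function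
   [eps ln (sum_i exp ((x . nu_i - a_i) / eps))], a smooth surrogate of the outer
   normal; hence its divergence is nonnegative. *)
Definition smaff i (x : R * R) := dotp x (nu i) - a i.
Definition smexp i x := expR (eps^-1 * smaff i x).
Definition smsum x := \sum_(i < n.+1) smexp i x.
Definition smw i x := smexp i x / smsum x.
Definition smean x := (\sum_(i < n.+1) (nu i).1 * smw i x, \sum_(i < n.+1) (nu i).2 * smw i x).

Lemma smsum_gt0 x : 0 < smsum x.
Proof.
rewrite /smsum (bigD1 ord0)//= ltr_pwDl ?expR_gt0// sumr_ge0// => i _.
by rewrite /smexp expR_ge0.
Qed.

Lemma smw_ge0 i x : 0 <= smw i x.
Proof. by rewrite /smw divr_ge0 ?expR_ge0// ltW ?smsum_gt0. Qed.

Lemma smw_sum x : \sum_(i < n.+1) smw i x = 1.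
Proof. by rewrite -mulr_suml divff// gt_eqF// smsum_gt0. Qed.

Lemma smaff_grad i x : grad (smaff i) x (nu i).
Proof.
have h := gradB (gradD (gradZ (nu i).1 (grad_fst x)) (gradZ (nu i).2 (grad_snd x))) (grad_cst (a i) x).
have -> : smaff i = (fun y => (nu i).1 * y.1 + (nu i).2 * y.2 - cst (a i) y).
  by apply/funext => y; rewrite /smaff /dotp /=; ring.
apply: (grad_eq h); rewrite [RHS]surjective_pairing.
by apply/pair_equal_spec; split; rewrite /= /GRing.scale/=; ring.
Qed.

Lemma smexp_grad i x : grad (smexp i) x ((smexp i x / eps) *: nu i).
Proof.
apply: (grad_eq (grad_comp (gradZ eps^-1 (smaff_grad i x)) (is_derive_expR _))).
by rewrite -scalerA.
Qed.

Lemma cts_expR_comp (f : R * R -> R) : continuous f -> continuous (fun x => expR (f x)).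
Proof. by move=> cf; exact: (cts_comp cf (@continuous_expR R)). Qed.

Lemma smexp_cont i : continuous (smexp i).
Proof. by move=> x; exact: grad_continuous (smexp_grad i x). Qed.

Lemma cts_scale (f : R * R -> R) (p : R * R) : continuous f -> continuous (fun x => f x *: p).
Proof.
move=> cf; have h := continuous_pair (cts_mul cf (@cts_cst _ _ p.1)) (cts_mul cf (@cts_cst _ _ p.2)).
exact: h.
Qed.

Lemma smexp_C1 i : C1 (smexp i) /\ forall x, (d1 (smexp i) x, d2 (smexp i) x) = (smexp i x / eps) *: nu i.
Proof.
apply: C1_intro; first exact: smexp_grad.
apply: cts_scale; exact: (cts_mul (@smexp_cont i) (@cts_cst _ _ eps^-1)).
Qed.

Lemma smsum_grad x : grad smsum x ((smsum x / eps) *: smean x).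
Proof.
have [C E] := @C1_sum _ smexp (fun i => (smexp_C1 i).1).
apply: (grad_eq (C1_grad x C)); have [-> ->] := E x.
have s0 := gt_eqF (smsum_gt0 x).
apply/pair_equal_spec; split; rewrite /= /GRing.scale/= mulr_sumr; apply: eq_bigr => i _;
  have [e1 e2] := (smexp_C1 i).2 x.
  by rewrite e1 /smw /GRing.scale/=; field; rewrite s0 gt_eqF.
by rewrite e2 /smw /GRing.scale/=; field; rewrite s0 gt_eqF.
Qed.

Lemma smsum_cont : continuous smsum.
Proof. by move=> x; exact: grad_continuous (smsum_grad x). Qed.

Lemma smw_cont i : continuous (smw i).
Proof.
move=> x; apply: cvgM; first exact: smexp_cont.
by apply: cvgV; [rewrite gt_eqF// smsum_gt0|exact: smsum_cont].
Qed.

Lemma smw_grad i x : grad (smw i) x ((smw i x / eps) *: (nu i - smean x)).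
Proof.
have s0 : smsum x != 0 by rewrite gt_eqF// smsum_gt0.
have dV : is_derive (smsum x) 1 (fun y : R => y^-1) (- (smsum x) ^- 2).
  by apply: (deq (is_deriveV s0 (derI (smsum x)))); rewrite /GRing.scale/= mulr1.
apply: (grad_eq (gradM (smexp_grad i x) (grad_comp (smsum_grad x) dV))).
rewrite [RHS]surjective_pairing; apply/pair_equal_spec; split;
 rewrite /= /GRing.scale/= /smw; field; by rewrite s0 gt_eqF.
Qed.

Lemma smean_cont : continuous smean.
Proof.
have h (c : 'I_n.+1 -> R) : continuous (fun x => \sum_(i < n.+1) c i * smw i x).
  exact: cts_sum (fun i => cts_mul (@cts_cst _ _ (c i)) (@smw_cont i)).
exact: (continuous_pair (h _) (h _)).
Qed.

Lemma smw_C1 i : C1 (smw i) /\ forall x, (d1 (smw i) x, d2 (smw i) x) = (smw i x / eps) *: (nu i - smean x).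
Proof.
apply: C1_intro; first exact: smw_grad.
have c0 := cts_mul (@smw_cont i) (@cts_cst _ _ eps^-1).
have cm : continuous (fun x => nu i - smean x) := cts_sub2 (@cts_cst2 _ (nu i)) smean_cont.
have c1 := cts_comp cm (fun x => grad_continuous (grad_fst x)).
have c2 := cts_comp cm (fun x => grad_continuous (grad_snd x)).
exact: (continuous_pair (cts_mul c0 c1) (cts_mul c0 c2)).
Qed.

(** Each weight has gradient (w_i / eps) (nu_i - mean), so the divergence of the mean is the
    variance of the [nu i] divided by [eps]. *)
Lemma smean_C1 : [/\ C1 (fun x => (smean x).1), C1 (fun x => (smean x).2) &
  forall x, d1 (fun x => (smean x).1) x + d2 (fun x => (smean x).2) x =
    eps^-1 * (\sum_(i < n.+1) smw i x * dotp (nu i) (nu i) - dotp (smean x) (smean x))].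
Proof.
have [C E] := @C1_sum _ (fun i x => (nu i).1 * smw i x) (fun i => (C1_Z _ (smw_C1 i).1).1).
have [C' E'] := @C1_sum _ (fun i x => (nu i).2 * smw i x) (fun i => (C1_Z _ (smw_C1 i).1).1).
split => // x; have [-> _] := E x; have [_ ->] := E' x.
have -> : dotp (smean x) (smean x) = \sum_(i < n.+1) smw i x * dotp (nu i) (smean x).
  rewrite {1}/dotp {1 3}/smean /= !mulr_suml -big_split /=; apply: eq_bigr => i _.
  by rewrite /dotp /smean/=; ring.
rewrite -big_split -sumrB mulr_sumr /=; apply: eq_bigr => i _.
have [e1 _] := (C1_Z (nu i).1 (smw_C1 i).1).2 x; rewrite e1.
have [_ e2] := (C1_Z (nu i).2 (smw_C1 i).1).2 x; rewrite e2.
have [-> ->] := (smw_C1 i).2 x; rewrite /dotp /= /GRing.scale/=; ring.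
Qed.

(** The difference is the weighted sum of |nu_i - mean|^2. It yields the nonnegative divergence of
    [smean] and, for unit normals, |smean| <= 1. *)
Lemma smean_var x : dotp (smean x) (smean x) <= \sum_(i < n.+1) smw i x * dotp (nu i) (nu i).
Proof.
have h : 0 <= \sum_(i < n.+1) smw i x * dotp (nu i - smean x) (nu i - smean x).
  by rewrite sumr_ge0// => i _; rewrite mulr_ge0 ?smw_ge0 ?dotp_ge0.
have e1 : \sum_(i < n.+1) smw i x * dotp (nu i) (smean x) = dotp (smean x) (smean x).
  rewrite {2}/dotp {2 4}/smean /= !mulr_suml -big_split /=; apply: eq_bigr => i _.
  by rewrite /dotp /smean/=; ring.
have e2 : \sum_(i < n.+1) smw i x * dotp (nu i - smean x) (nu i - smean x) =
  \sum_(i < n.+1) smw i x * dotp (nu i) (nu i) - dotp (smean x) (smean x).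
  transitivity (\sum_(i < n.+1) (smw i x * dotp (nu i) (nu i) -
     2 * (smw i x * dotp (nu i) (smean x)) + smw i x * dotp (smean x) (smean x))).
    by apply: eq_bigr => i _; rewrite !dotpE [dotp (smean x) (nu i)]dotpC; ring.
  by rewrite big_split sumrB /= -mulr_sumr e1 -mulr_suml smw_sum; ring.
by move: h; rewrite e2 subr_ge0.
Qed.

(* With [u := (a i - a j) / eps] the bound is [u exp(-u) <= 1]. *)
Lemma smaff_le_mean i x :
  smaff i x - n.+1%:R * eps <= \sum_(j < n.+1) smw j x * smaff j x.
Proof.
have key j : smw j x * smaff i x - eps <= smw j x * smaff j x.
  have [h|h] := lerP (smaff i x) (smaff j x).
    by have := ler_wpM2l (smw_ge0 j x) h; have e0 := eps0; lra.
  rewrite lerBlDr -lerBlDl -mulrBr.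
  set d := smaff i x - smaff j x; have d0 : 0 < d by rewrite /d; lra.
  have wle : smw j x <= expR (- (d / eps)).
    rewrite /smw ler_pdivrMr ?smsum_gt0//.
    have -> : smexp j x = expR (- (d / eps)) * smexp i x.
      by rewrite /smexp -expRD; congr expR; rewrite /d; field; rewrite gt_eqF.
    rewrite ler_pM2l ?expR_gt0// /smsum (bigD1 i)//= lerDl sumr_ge0// => k _.
    by rewrite /smexp expR_ge0.
  have := expR_ge1Dx (d / eps); have := expR_gt0 (d / eps) => e0 e1.
  apply: (@le_trans _ _ (expR (- (d / eps)) * d)); first by rewrite ler_wpM2r// ltW.
  rewrite expRN mulrC ler_pdivrMr//.
  have du : d = eps * (d / eps) by field; rewrite gt_eqF.
  by rewrite {1}du ler_pM2l//; lra.
have : \sum_(j < n.+1) (smw j x * smaff i x - eps) <= \sum_(j < n.+1) smw j x * smaff j x.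
  by apply: ler_sum => j _; exact: key.
by rewrite sumrB -mulr_suml smw_sum mul1r sumr_const card_ord mulr_natl.
Qed.

End softmax.

(** * The perimeter of a convex body *)

Section cauchy_perimeter.
Context {R : realType}.
Notation mu := (@lebesgue_measure R).
Notation T2 := (measurableTypeR R * measurableTypeR R)%type.
Implicit Types K : set (R * R).

(** A profile in the squared distance, linear on [0, d^2] and zero afterwards; the factor 2 / d^2
    makes its integral over that interval equal to one. *)
Definition hat (d s : R) : R := 2 / d ^+ 2 * Num.max 0 (1 - s / d ^+ 2).

Lemma hat_cont d : continuous (hat d).
Proof.
apply: cts_mul; first exact: cts_cst.
apply: cts_max; first exact: cts_cst.
move=> x; apply: cvgB; first exact: cvg_cst.
by apply: cvgM; [exact: cvg_id|exact: cvg_cst].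
Qed.

Lemma hat_ge0 d s : 0 <= hat d s.
Proof. by rewrite /hat mulr_ge0 ?divr_ge0 ?sqr_ge0// le_max lexx. Qed.

Lemma hat_eq0 d s : 0 < d -> d ^+ 2 <= s -> hat d s = 0.
Proof.
move=> d0 ds; rewrite /hat max_l ?mulr0// subr_le0 ler_pdivlMr ?mul1r// exprn_gt0//.
Qed.

(** With this [B], the function [B (sqd K)] is a C^1 cut-off, equal to 1 on [K] and to 0 from
    distance [d] on. *)
Lemma hat_primitive d : 0 < d -> exists B : R -> R,
  [/\ forall s : R, is_derive s 1 B (- hat d s), forall s, d ^+ 2 <= s -> B s = 0,
      continuous B, B 0 = 1 & forall s, 0 <= s -> 0 <= B s <= 1].
Proof.
move=> d0; have [B [dB BM cB B0]] := profile_primitive (@hat_cont d) (hat_ge0 d) (fun s => hat_eq0 d0).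
have d20 : 0 < d ^+ 2 by rewrite exprn_gt0.
have cN : continuous (fun s => - hat d s) := cts_opp (@hat_cont d).
have B1 : B 0 = 1.
  have h := Rint_FTC (ltW d20) cN dB.
  rewrite (BM (d ^+ 2) (lexx _)) sub0r in h.
  rewrite -[LHS]opprK -h.
  have dP : forall s : R, is_derive s 1 (fun s => - (2 / d ^+ 2) * (s - s * s / (2 * d ^+ 2))) (- (2 / d ^+ 2) * (1 - s / d ^+ 2)).
    move=> s; have e := derM (derM (derI s) (derI s)) (derC ((2 * d ^+ 2)^-1) s).
    apply: (deq (derZ (- (2 / d ^+ 2)) (derB (derI s) e))).
    by field; lra.
  have cP : continuous (fun s : R => - (2 / d ^+ 2) * (1 - s / d ^+ 2)).
    apply: (cts_mul (@cts_cst _ _ _)) => x; apply: cvgB; first exact: cvg_cst.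
    by apply: cvgM; [exact: cvg_id|exact: cvg_cst].
  have -> : \int[mu]_(x in `[0, d ^+ 2]) - hat d x =
    \int[mu]_(x in `[0, d ^+ 2]) (- (2 / d ^+ 2) * (1 - x / d ^+ 2)).
    apply: eq_Rintegral => x /set_mem; rewrite /= in_itv/= => /andP[x0 x1].
    by rewrite /hat max_r ?mulNr// subr_ge0 ler_pdivrMr// mul1r.
  by rewrite (Rint_FTC (ltW d20) cP dP); field; lra.
exists B; split => // s s0; rewrite B0 /= -subr_ge0 -B1.
have dB' : forall s : R, is_derive s 1 (fun s => - B s) (hat d s).
  by move=> t; apply: (deq (derN (dB t))); rewrite opprK.
have := Rint_FTC s0 (@hat_cont d) dB'; rewrite opprK addrC => <-.
by apply: Rintegral_ge0 => x _; exact: hat_ge0.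
Qed.

Lemma hat_int d : 0 < d -> \int[mu]_(s in `[0, d]) (2 * s * hat d (s ^+ 2)) = 1.
Proof.
move=> d0; have [B [dB BM cB B1 _]] := hat_primitive d0.
have cs2 : continuous (fun s : R => s ^+ 2) by apply: cts_sqr => x; exact: cvg_id.
have c1 : continuous (fun s : R => 2 * s * hat d (s ^+ 2)).
  apply: cts_mul (cts_comp cs2 (@hat_cont d)).
  by apply: cts_mul (@cts_cst _ _ 2) _ => x; exact: cvg_id.
have dG : forall s : R, is_derive s 1 (fun s => - B (s ^+ 2)) (2 * s * hat d (s ^+ 2)).
  move=> s; have h : is_derive s 1 (fun s : R => s ^+ 2) (2 * s).
    by apply: (deq (derM (derI s) (derI s))); ring.
  by apply: (deq (derN (@dercomp _ B (fun s : R => s ^+ 2) s _ _ (dB (s ^+ 2)) h))); ring.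
by rewrite (Rint_FTC (ltW d0) c1 dG) BM// expr0n/= B1 oppr0 add0r opprK.
Qed.

Lemma hat_int_cont d : continuous (fun s : R => 2 * s * hat d (s ^+ 2)).
Proof.
have cs2 : continuous (fun s : R => s ^+ 2) by apply: cts_sqr => x; exact: cvg_id.
apply: cts_mul (cts_comp cs2 (@hat_cont d)).
by apply: cts_mul (@cts_cst _ _ 2) _ => x; exact: cvg_id.
Qed.

(** The integrand is the norm of the gradient of the cut-off [B (sqd K)]. The Steiner formula makes
    its integral an average of [mwidth K + 2 * pi * s], the perimeters of the parallel bodies, over
    s in [0, d]. *)
Lemma hat_steiner d K : 0 < d -> ccn K ->
  mwidth K <= I2 (fun x => 2 * hat d (sqd K x) * enorm (resid K x)) <= mwidth K + 2 * pi * d.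
Proof.
move=> d0 cK; rewrite (steiner (@hat_cont d) (hat_ge0 d) d0 (fun s => hat_eq0 d0) cK).
have c1 := @hat_int_cont d.
have cc (a : R) : continuous (fun s : R => 2 * s * hat d (s ^+ 2) * a) := cts_mul c1 (@cts_cst _ _ a).
have cm : continuous (fun s : R => 2 * s * hat d (s ^+ 2) * (mwidth K + 2 * pi * s)).
  apply: (cts_mul c1); apply: (cts_add (@cts_cst _ _ (mwidth K))).
  by apply: cts_mul (@cts_cst _ _ (2 * pi)) _ => x; exact: cvg_id.
have E (a : R) : \int[mu]_(s in `[0, d]) (2 * s * hat d (s ^+ 2) * a) = a.
  by rewrite RintegralZr ?hat_int ?mul1r//; exact: integrable_cont.
have nn s : 0 <= s -> 0 <= 2 * s * hat d (s ^+ 2).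
  by move=> s0; rewrite mulr_ge0 ?hat_ge0// mulr_ge0.
have p0 := pi_gt0 R.
apply/andP; split.
  rewrite -[leLHS]E; apply: le_Rintegral => //; try exact: integrable_cont.
  move=> s /=; rewrite in_itv/= => /andP[s0 s1].
  by rewrite ler_wpM2l ?nn// lerDl mulr_ge0// mulr_ge0// ltW.
rewrite -[leRHS]E; apply: le_Rintegral => //; try exact: integrable_cont.
move=> s /=; rewrite in_itv/= => /andP[s0 s1].
by rewrite ler_wpM2l ?nn// lerD2l ler_wpM2l// mulr_ge0// ltW.
Qed.

Lemma kappa_C1 (b B : R -> R) K : ccn K -> continuous b -> (forall s : R, is_derive s 1 B (- b s)) ->
  C1 (fun x => B (sqd K x)) /\
  forall x, (d1 (fun x => B (sqd K x)) x, d2 (fun x => B (sqd K x)) x) = (- (2 * b (sqd K x))) *: resid K x.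
Proof.
move=> cK cb dB; apply: C1_intro.
  move=> x; apply: (grad_eq (grad_comp (sqd_grad x cK) (dB _))).
  by rewrite scalerA; congr (_ *: _); ring.
have c0 := cts_opp (cts_mul (@cts_cst _ _ 2) (cts_comp (sqd_cont cK) cb)).
have c1 := cts_comp (resid_cont cK) (fun x => grad_continuous (grad_fst x)).
have c2 := cts_comp (resid_cont cK) (fun x => grad_continuous (grad_snd x)).
exact: (continuous_pair (cts_mul c0 c1) (cts_mul c0 c2)).
Qed.

Lemma kappa_C1c (b B : R -> R) (M : R) K (Omega : set (R * R)) : ccn K -> continuous b ->
  (forall s : R, is_derive s 1 B (- b s)) -> 0 < M -> (forall s, M ^+ 2 <= s -> B s = 0) ->
  (forall x, sqd K x <= M ^+ 2 -> Omega x) -> C1c Omega (fun x => B (sqd K x)).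
Proof.
move=> cK cb dB M0 BM KO; have [C _] := kappa_C1 cK cb dB.
have [L L0 KL] := compact_box (let: And3 h _ _ := cK in h).
apply: (@C1c_intro _ _ [set x | sqd K x <= M ^+ 2] Omega (L + (M + 1)) C).
- apply: (@closed_comp _ _ (sqd K) [set s | s <= M ^+ 2]).
    by move=> x _; exact: sqd_cont.
  exact: closed_le.
(* [sqd_far] speaks of a profile; the indicator of s < (M + 1)^2 turns it into a bound for the set,
   with room for the points where [sqd K x = M ^+ 2]. *)
- move=> x /= xM; have := @sqd_far _ (fun s => if (M + 1) ^+ 2 <= s then 0 else 1) (M + 1) _ _ K L cK KL x.
  apply; first lra; first by move=> s ->.
  rewrite ifF ?oner_neq0//; apply/negbTE; rewrite -ltNge (le_lt_trans xM)//.
  by rewrite ltr_pXn2r// ?nnegrE; lra.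
- by move=> x; exact: KO.
- by move=> x h /=; rewrite leNgt; apply: contra h => /ltW/BM/eqP.
Qed.

Lemma div_by_parts (Omega : set (R * R)) f X1 X2 : C1c Omega f -> C1 X1 -> C1 X2 ->
  I2 (fun x => f x * (d1 X1 x + d2 X2 x)) = - I2 (fun x => d1 f x * X1 x + d2 f x * X2 x).
Proof.
move=> Hf C_1 C_2; have [bf b1 b2] := C1c_bmc Hf.
have [_ c11 _] := C_1; have [_ _ c22] := C_2.
rewrite (_ : (fun x => _) = (fun x => f x * d1 X1 x + f x * d2 X2 x)); last first.
  by apply/funext => x; rewrite mulrDr.
rewrite I2D ?I2D; try (by apply: bmc_cont => //; exact: C1_continuous).
by rewrite (I2_by_parts Hf C_1).1 (I2_by_parts Hf C_2).2 opprD.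
Qed.

Lemma compact_measurable2 K : compact K -> measurable (K : set T2).
Proof. by move=> /compact_closed cK; apply: closed_measurable2; apply: cK; exact: norm_hausdorff. Qed.

Lemma indic_bmc K L (f : R * R -> R) : measurable (K : set T2) -> K `<=` box L -> continuous f ->
  bmc (fun x => f x * \1_K x).
Proof.
move=> mK KL cf.
rewrite (_ : (fun x => _) = (fun x => (\1_(box L) x * f x) * \1_K x)).
  by apply: bmc_indic => //; apply: bmc_cont cf; exact: bmc_box.
apply/funext => x; rewrite !indicE; case: (boolP (x \in K)) => [/set_mem/KL xL|_].
  by rewrite (mem_set xL) mul1r.
by rewrite !mulr0.
Qed.

(* [hat d] has mass one near 0: as [d -> 0], the function [B (sqd K)] tends to the
   indicator of [K] and the L^1 norm of its gradient to [mwidth K]. *)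
Lemma perimeter_le K X1 X2 : ccn K -> C1c setT X1 -> C1c setT X2 ->
  (forall x, enorm (X1 x, X2 x) <= 1) ->
  \int[@leb2 R]_(x in K) (d1 X1 x + d2 X2 x) <= mwidth K.
Proof.
move=> cK H1 H2 X1le; have [_ b1 _] := C1c_bmc H1; have [_ _ b2] := C1c_bmc H2.
have [_ c1 _ _ _] := H1; have [_ _ c2 _ _] := H2.
have C_1 := C1c_C1 H1; have C_2 := C1c_C1 H2.
have K_c : compact K by case: cK.
have [L L0 KL] := compact_box K_c.
pose F x := d1 X1 x + d2 X2 x.
have bF : bmc F by exact: bmcD.
have cF : continuous F by exact: cts_add.
have mK := compact_measurable2 K_c.
rewrite I2_mkcond.
pose dl (n : nat) : R := n.+1%:R^-1.
have dl0 n : 0 < dl n by rewrite /dl invr_gt0 ltr0n.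
have dl1 n : dl n <= 1 by rewrite /dl invf_le1 ?ltr0n// ler1n.
pose B n := proj1_sig (cid (hat_primitive (dl0 n))).
have BP n := proj2_sig (cid (hat_primitive (dl0 n))).
pose k n x := B n (sqd K x).
have kC n : C1c setT (k n).
  have [dB BM _ _ _] := BP n.
  exact: (@kappa_C1c (hat (dl n)) (B n) (dl n) K setT cK (@hat_cont _) dB (dl0 n) BM).
have bound n : I2 (fun x => F x * k n x) <= mwidth K + 2 * pi * dl n.
  have [dB BM _ _ _] := BP n.
  have [_ kd] := kappa_C1 cK (@hat_cont (dl n)) dB.
  rewrite (_ : (fun x => _) = (fun x => k n x * (d1 X1 x + d2 X2 x))); last first.
    by apply/funext => x; rewrite mulrC.
  rewrite (div_by_parts (kC n) C_1 C_2) -I2N; last first.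
    have [_ k1 k2] := C1c_bmc (kC n).
    by apply: bmcD; apply: bmc_cont => //; exact: C1_continuous.
  have /andP[_] := hat_steiner (dl0 n) cK; apply: le_trans; apply: I2_le.
  - apply: bmcN; have [_ k1 k2] := C1c_bmc (kC n).
    by apply: bmcD; apply: bmc_cont => //; exact: C1_continuous.
  - apply: (@bmc_continuous _ _ (L + dl n)).
      apply: cts_mul; first exact: cts_mul (@cts_cst _ _ 2) (cts_comp (sqd_cont cK) (@hat_cont _)).
      exact: (cts_comp (sqd_cont cK) (@sqrt_continuous R)).
    move=> x h; apply: (sqd_far (dl0 n) (fun s => hat_eq0 (dl0 n)) cK KL).
    by apply: contra_neq h => ->; rewrite mulr0 mul0r.
  - move=> x; have [e1 e2] := kd x; rewrite /k e1 e2.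
    have h := dotp_le (resid K x) (X1 x, X2 x).
    have h2 : enorm (resid K x) * enorm (X1 x, X2 x) <= enorm (resid K x).
      by rewrite ler_piMr ?enorm_ge0.
    have h3 : 0 <= 2 * hat (dl n) (sqd K x) by rewrite mulr_ge0 ?hat_ge0.
    have := ler_wpM2l h3 (le_trans h h2); rewrite /dotp /= /GRing.scale/=; lra.
have cv : I2 (fun x => F x * k n x) @[n --> \oo] --> I2 (fun x => F x * \1_K x).
  apply: (@I2_dct _ _ _ (fun x => `|F x|)).
  - by move=> n; apply: bmc_cont bF _; exact: C1_continuous (C1c_C1 (kC n)).
  - exact: bmc_indic.
  - exact: bmc_norm.
  - move=> n x; rewrite normrM ler_piMr//.
    have [_ _ _ _ BB] := BP n; have /andP[h1 h2] := BB _ (sqd_ge0 K x).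
    by rewrite /k ger0_norm.
  - move=> x; apply: cvgM; first exact: cvg_cst.
    rewrite indicE; case: (boolP (x \in K)) => [/set_mem Kx|/negP xK].
      rewrite (_ : (fun n => _) = cst 1); first exact: cvg_cst.
      by apply/funext => n; rewrite /k sqd_in//; have [] := BP n.
    have s0 : 0 < sqd K x.
      rewrite lt_def sqd_ge0 andbT; apply/eqP => h; apply: xK.
      exact/mem_set/(sqd0_in cK).
    apply: cvg_near_cst; near=> n.
    have [_ BM _ _ _] := BP n; apply: BM.
    apply: (@le_trans _ _ (dl n)); first by rewrite expr2 ler_piMr// ltW.
    near: n; have := near_infty_natSinv_lt (PosNum s0).
    by apply: filterS => n /= /ltW.
have cd : (mwidth K + 2 * pi * dl n) @[n --> \oo] --> mwidth K + 2 * pi * 0.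
  by apply: cvgD; [exact: cvg_cst|apply: cvgM; [exact: cvg_cst|exact: cvg_harmonic]].
rewrite -[leRHS]addr0 -[X in _ + X](mulr0 (2 * pi)).
by apply: (ler_cvg_to cv cd); exact: nearW.
Unshelve. all: by end_near. Qed.

End cauchy_perimeter.

(** * Lower bound for the perimeter by smoothed normal fields *)

Section cauchy_perimeter_lower.
Context {R : realType}.
Notation mu := (@lebesgue_measure R).
Notation T2 := (measurableTypeR R * measurableTypeR R)%type.
Implicit Types K : set (R * R).

(** Makes [mwidth] insensitive to translations, hence to the centre of the homothety below. *)
Lemma integral_dir (z : R * R) : \int[mu]_(th in `[0, 2 * pi]) dotp z (udir th) = 0.
Proof.
have dF : forall th : R, is_derive th 1 (fun th => z.1 * sin th - z.2 * cos th) (dotp z (udir th)).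
  move=> th; apply: (deq (derB (derZ z.1 (is_derive_sin th)) (derZ z.2 (is_derive_cos th)))).
  by rewrite /dotp/=; ring.
have cf : continuous (fun th => dotp z (udir th)).
  rewrite (_ : (fun th => _) = (fun th => dotp (udir th) z)).
    exact: cts_comp udir_cont (@dotp_cont_r _ z).
  by apply/funext => th; rewrite dotpC.
by rewrite (Rint_FTC pi2_ge0 cf dF) mulr_natl sin2pi cos2pi sin0 cos0; ring.
Qed.

(** The homothety of centre [z0] and ratio [1 - s], which leaves room inside [K] for a cut-off
    supported in [K]. *)
Definition shrink K (s : R) (z0 : R * R) : set (R * R) := [set (1 - s) *: k + s *: z0 | k in K].

Lemma shrink_ccn K s z0 : ccn K -> ccn (shrink K s z0).
Proof.
move=> [cK vK [k Kk]]; split.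
- apply: continuous_compact cK; apply: continuous_subspaceT => x.
  have h : continuous (fun k : R * R => (1 - s) *: k) by move=> y; exact: (cvgZ (cvg_cst (1 - s)) (@cvg_id _ (nbhs y))).
  exact: (cvgD (h x) (cvg_cst _)).
- move=> _ _ a [x Kx <-] [y Ky <-] a01.
  exists ((1 - a) *: x + a *: y); first exact: vK.
  by apply/pair_equal_spec; split; rewrite /= /GRing.scale/=; ring.
- by exists ((1 - s) *: k + s *: z0), k.
Qed.

Lemma shrink_hsup K s z0 u : ccn K -> 0 <= s <= 1 ->
  hsup (shrink K s z0) u = (1 - s) * hsup K u + s * dotp z0 u.
Proof.
move=> cK /andP[s0 s1]; apply/eqP; rewrite eq_le; apply/andP; split.
  apply: hsup_le; first exact: shrink_ccn.
  move=> _ [k Kk <-]; rewrite dotpDl !dotpZl lerD2r ler_wpM2l ?subr_ge0//.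
  exact: hsup_ge.
have [k Kk <-] := hsup_att u cK.
rewrite -!dotpZl -dotpDl; apply: hsup_ge; first exact: shrink_ccn.
by exists k.
Qed.

Lemma shrink_mwidth K s z0 : ccn K -> 0 <= s <= 1 -> mwidth (shrink K s z0) = (1 - s) * mwidth K.
Proof.
move=> cK s01; rewrite /mwidth.
have ch := support_cont cK.
have cd : continuous (fun th => dotp z0 (udir th)).
  rewrite (_ : (fun th => _) = (fun th => dotp (udir th) z0)).
    exact: cts_comp udir_cont (@dotp_cont_r _ z0).
  by apply/funext => th; rewrite dotpC.
have i1 := @integrable_cont _ _ 0 (2 * pi) ch.
have i2 := @integrable_cont _ _ 0 (2 * pi) cd.
have i3 := @integrable_cont _ _ 0 (2 * pi) (cts_mul (@cts_cst _ _ (1 - s)) ch).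
have i4 := @integrable_cont _ _ 0 (2 * pi) (cts_mul (@cts_cst _ _ s) cd).
transitivity (\int[mu]_(th in `[0, 2 * pi]) ((1 - s) * support_fun K th + s * dotp z0 (udir th))).
  by apply: eq_Rintegral => th _; rewrite !support_funE shrink_hsup.
by rewrite RintegralD// !RintegralZl// integral_dir mulr0 addr0.
Qed.

(** By convexity [K] contains (1 - s) K plus s times the disk of centre [z0] and radius [rho], that
    is, the parallel body of the shrunk copy at distance [s * rho]. *)
Lemma shrink_inner K s z0 rho x : ccn K -> 0 < s -> s < 1 -> 0 < rho ->
  (forall w, dotp w w <= rho ^+ 2 -> K (z0 + w)) ->
  sqd (shrink K s z0) x <= (s * rho) ^+ 2 -> K x.
Proof.
move=> cK s0 s1 r0 zK hx;
have [[k Kk kp] _] := projP x (shrink_ccn s z0 cK).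
pose r := resid (shrink K s z0) x.
have -> : x = (1 - s) *: k + s *: (z0 + s^-1 *: r).
  rewrite scalerDr scalerA divff ?gt_eqF// scale1r addrA kp /r /resid addrC subrK//.
case: cK => _ vK _; apply: vK => //; last by rewrite !ltW.
apply: zK; rewrite dotpZl dotpZr -/(sqd _ _).
have := hx; rewrite exprMn => h.
rewrite mulrA -expr2 exprVn ler_pdivrMl ?exprn_gt0//.
Qed.

Lemma unit_angle_pi (v : R * R) : dotp v v = 1 -> exists al : R, [/\ - pi <= al <= pi & v = udir al].
Proof.
move=> h; have ha : -1 <= v.1 <= 1.
  by move: h; rewrite /dotp => h; have := sqr_ge0 v.2; rewrite expr2 => hb; apply/andP; split; nra.
have hs : sin (acos v.1) = `|v.2|.
  by rewrite sin_acos// -h /dotp -!expr2 addrC addKr sqrtr_sqr.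
have p0 := pi_gt0 R.
have a0 := acos_ge0 ha; have ap := acos_lepi ha.
have ce : cos (acos v.1) = v.1 by rewrite acosK ?in_itv//=.
have [b0|b0] := lerP 0 v.2.
  exists (acos v.1); split; first by lra.
  by rewrite [LHS]surjective_pairing /udir ce hs ger0_norm.
exists (- acos v.1); split; first by lra.
by rewrite [LHS]surjective_pairing /udir cosN sinN ce hs ltr0_norm// opprK.
Qed.

(** The angle is rounded down to a grid of step 2 pi / N, and sine and cosine are 1-Lipschitz. The
    angle pi takes the index [N], hence the [N + 1] nodes. *)
Lemma angle_net (N : nat) (v : R * R) : (0 < N)%N -> dotp v v = 1 ->
  exists i : 'I_N.+1, `|v.1 - (udir (- pi + 2 * pi * i%:R / N%:R)).1| <= 2 * pi / N%:R /\
    `|v.2 - (udir (- pi + 2 * pi * i%:R / N%:R)).2| <= 2 * pi / N%:R.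
Proof.
move=> N0 /unit_angle_pi[al [/andP[al1 al2] ->]].
have p0 := pi_gt0 R; have n0 : 0 < N%:R :> R by rewrite ltr0n.
pose y := (al + pi) * N%:R / (2 * pi).
have y0 : 0 <= y by rewrite /y divr_ge0 ?mulr_ge0//; lra.
have yN : y <= N%:R by rewrite /y ler_pdivrMr; [nra|lra].
have /andP[t1 t2] := truncn_itv y0.
have tN : (Num.truncn y < N.+1)%N.
  by rewrite ltnS -(ler_nat R) (le_trans t1).
exists (Ordinal tN) => /=.
set th := - pi + _.
have close : `|al - th| <= 2 * pi / N%:R.
  have -> : al - th = (2 * pi / N%:R) * (y - (Num.truncn y)%:R).
    have p20 : 2 * pi != 0 :> R by rewrite mulf_neq0// gt_eqF.
    have aE : al = y * (2 * pi) / N%:R - pi by rewrite /y divfK// mulfK ?gt_eqF// addrK.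
    by rewrite {1}aE /th; ring.
  rewrite ger0_norm; last by rewrite mulr_ge0 ?divr_ge0//; lra.
  rewrite ler_piMr ?divr_ge0//; try lra.
have l1 : `|cos al - cos th| <= 1 * `|al - th|.
  by apply: (lip_derive (@is_derive_cos R)) => x; rewrite normrN ler_norml sin_geN1 sin_le1.
have l2 : `|sin al - sin th| <= 1 * `|al - th|.
  by apply: (lip_derive (@is_derive_sin R)) => x; rewrite ler_norml cos_geN1 cos_le1.
by split; rewrite /=; lra.
Qed.

Lemma dotp_box (L : R) (x v : R * R) : box L x -> `|dotp x v| <= L * (`|v.1| + `|v.2|).
Proof.
move=> /in_box[x1 x2]; rewrite /dotp (le_trans (ler_normD _ _))// !normrM mulrDr.
by rewrite lerD// ler_wpM2r.
Qed.

Section lower.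
Variables (K : set (R * R)) (L : R).
Hypotheses (cK : ccn K) (L0 : 0 < L) (KL : K `<=` box L).
Variables (N : nat) (eps : R).
Hypotheses (N0 : (0 < N)%N) (eps0 : 0 < eps).

Let nu (i : 'I_N.+1) : R * R := udir (- pi + 2 * pi * i%:R / N%:R).
Let X := smean nu (fun i => hsup K (nu i)) eps.

(** The field [X] nearly follows the outer normal. [N.+1%:R * eps] is the error of the smoothed
    maximum; the other term is the error of the net of directions, half from the variation of
    [dotp x] and half from that of the support function. *)
Lemma smean_resid (L' : R) x : box L' x -> L <= L' ->
  enorm (resid K x) - (N.+1%:R * eps + 8 * L' * pi / N%:R) <= dotp (X x) (resid K x).
Proof.
move=> xL LL'; have e0 := eps0; have p0 := pi_gt0 R; have l0 := L0.
have n0 : 0 < N%:R :> R by rewrite ltr0n.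
have err0 : 0 <= N.+1%:R * eps + 8 * L' * pi / N%:R.
  by rewrite addr_ge0 ?mulr_ge0 ?invr_ge0//; lra.
have [r0|r0] := eqVneq (enorm (resid K x)) 0.
  have -> : resid K x = 0 by apply: dotp_eq0; rewrite -enormE r0 expr0n.
  by rewrite /enorm {1 2}/dotp /= !mul0r addr0 sqrtr0 !mulr0 addr0; lra.
have rp : 0 < enorm (resid K x) by rewrite lt_def r0 enorm_ge0.
pose n := (enorm (resid K x))^-1 *: resid K x.
have nn : dotp n n = 1.
  by rewrite /n dotpZl dotpZr -enormE; field.
have rn : resid K x = enorm (resid K x) *: n by rewrite /n scalerA divff// scale1r.
have [i [i1 i2]] := angle_net N0 nn.
pose a := smaff nu (fun i => hsup K (nu i)).
have ai : enorm (resid K x) - 8 * L' * pi / N%:R <= a i x.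
  have hn : dotp (cproj K x) n = hsup K n.
    have := resid_hsup x cK; rewrite rn dotpZr.
    have hz : hsup K (enorm (resid K x) *: n) = enorm (resid K x) * hsup K n.
      apply/eqP; rewrite eq_le; apply/andP; split.
        by apply: hsup_le => // z Kz; rewrite dotpZr ler_wpM2l ?enorm_ge0//; exact: hsup_ge.
      by have [z Kz <-] := hsup_att n cK; rewrite -dotpZr; exact: hsup_ge.
    by rewrite hz => /(mulfI r0).
  have e1 : enorm (resid K x) = dotp x n - hsup K n.
    rewrite -hn -dotpBl -/(resid K x) {2}rn dotpZl nn mulr1//.
  have hl := hsup_lip n (nu i) cK KL.
  have [x1 x2] := (in_box _ _).1 xL.
  have xd : `|dotp x (n - nu i)| <= L' * (`|n.1 - (nu i).1| + `|n.2 - (nu i).2|).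
    exact: dotp_box.
  have ll : `|n.1 - (nu i).1| + `|n.2 - (nu i).2| <= 4 * pi / N%:R.
    by have := lerD i1 i2; rewrite -/nu; lra.
  have l1 : L' * (`|n.1 - (nu i).1| + `|n.2 - (nu i).2|) <= L' * (4 * pi / N%:R).
    by rewrite ler_wpM2l//; lra.
  have l2 : L * (`|n.1 - (nu i).1| + `|n.2 - (nu i).2|) <= L' * (4 * pi / N%:R).
    by apply: le_trans l1; rewrite ler_wpM2r// addr_ge0.
  rewrite e1 /a /smaff.
  have := ler_norm (dotp x (n - nu i)); have := ler_norm (hsup K (nu i) - hsup K n).
  rewrite distrC dotpBr => h1 h2; rewrite dotpBr in xd.
  have -> : 8 * L' * pi / N%:R = L' * (4 * pi / N%:R) + L' * (4 * pi / N%:R) by ring.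
  lra.
(* The foot of [x] lies in [K], so its product with [nu j] is at most [hsup K (nu j)], whence
   [a j x <= dotp (resid K x) (nu j)]. *)
have key : \sum_(j < N.+1) smw nu (fun i => hsup K (nu i)) eps j x * a j x <= dotp (X x) (resid K x).
  rewrite /X /dotp /smean /= !mulr_suml -big_split /=; apply: ler_sum => j _.
  set w := smw _ _ _ _ _.
  have -> : (nu j).1 * w * (resid K x).1 + (nu j).2 * w * (resid K x).2 = w * dotp (resid K x) (nu j).
    by rewrite /dotp; ring.
  rewrite ler_wpM2l ?smw_ge0// /a /smaff /resid dotpBl lerD2l lerN2.
  by apply: hsup_ge => //; have [] := projP x cK.
have := smaff_le_mean nu (fun i => hsup K (nu i)) e0 i x; rewrite -/a => h.
lra.
Qed.

Lemma smean_div x : 0 <= d1 (fun x => (X x).1) x + d2 (fun x => (X x).2) x.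
Proof.
have [_ _ ->] := smean_C1 nu (fun i => hsup K (nu i)) eps0.
by rewrite mulr_ge0 ?invr_ge0 ?(ltW eps0)// subr_ge0 smean_var.
Qed.

Lemma smean_le1 x : dotp (X x) (X x) <= 1.
Proof.
apply: le_trans (smean_var _ _ _ _) _; rewrite -(smw_sum nu (fun i => hsup K (nu i)) eps x).
by apply: ler_sum => i _; rewrite udir_unit mulr1.
Qed.

End lower.

Lemma box_ccn (L : R) : 0 <= L -> ccn (box L).
Proof.
move=> L0; split.
- by apply: compact_setX; exact: segment_compact.
- move=> x y s /in_box[x1 x2] /in_box[y1 y2] /andP[s0 s1]; apply/in_box.
  move: x1 x2 y1 y2; rewrite !ler_norml /= /GRing.scale/= => /andP[? ?] /andP[? ?] /andP[? ?] /andP[? ?].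
  by split; apply/andP; split; nra.
- by exists (0, 0); apply/in_box; rewrite /= normr0.
Qed.

(* [\int_K div X >= \int kappa div X = - \int grad kappa . X] since [div X >= 0],
   where [kappa <= 1_K] is a function of the distance to a shrunk copy of [K] and
   [X] is the softmax normal field. *)
Lemma perimeter_ge K z0 rho e : ccn K -> 0 < rho ->
  (forall w, dotp w w <= rho ^+ 2 -> K (z0 + w)) -> 0 < e ->
  exists Y1 Y2 : R * R -> R, [/\ C1c setT Y1, C1c setT Y2,
    forall x, enorm (Y1 x, Y2 x) <= 1 &
    mwidth K - e <= \int[@leb2 R]_(x in K) (d1 Y1 x + d2 Y2 x)].
Proof.
move=> cK r0 zK e0; have K_c : compact K by case: cK.
have [L L0 KL] := compact_box K_c.
(* Shrinking by this factor lowers [mwidth] by at most e / 2; the two errors of [smean_resid] will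
   take e / 4 each. *)
pose s := Num.min (1 / 2) (e / (2 * (`|mwidth K| + 1))).
have m0 : 0 < 2 * (`|mwidth K| + 1) by rewrite mulr_gt0// ltr_wpDl.
have s0 : 0 < s by rewrite /s lt_min divr_gt0//= divr_gt0.
have s1 : s < 1 by rewrite /s gt_min; apply/orP; left; lra.
have sm : s * mwidth K <= e / 2.
  apply: (@le_trans _ _ (s * `|mwidth K|)); first by rewrite ler_pM2l// ler_norm.
  have h : s <= e / (2 * (`|mwidth K| + 1)) by rewrite /s ge_min lexx orbT.
  apply: (@le_trans _ _ (s * (`|mwidth K| + 1))); first by rewrite ler_pM2l// lerDl.
  have := ler_wpM2r (ltW m0) h; rewrite divfK ?gt_eqF//; lra.
pose K' := shrink K s z0; have cK' : ccn K' := shrink_ccn s z0 cK.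
have K'm : mwidth K' = (1 - s) * mwidth K by apply: shrink_mwidth => //; rewrite !ltW.
pose dl := s * rho; have dl0 : 0 < dl by rewrite mulr_gt0.
have inK x : sqd K' x <= dl ^+ 2 -> K x by apply: shrink_inner.
have K'K : K' `<=` K by move=> x K'x; apply: inK; rewrite sqd_in// exprn_ge0// ltW.
have [B [dB BM cB B1 B01]] := hat_primitive dl0.
pose kap x := B (sqd K' x).
have kC : C1c K kap := kappa_C1c cK' (@hat_cont _ dl) dB dl0 BM inK.
have [_ kd] := kappa_C1 cK' (@hat_cont _ dl) dB.
pose w x := 2 * hat dl (sqd K' x).
have cw : continuous w := cts_mul (@cts_cst _ _ 2) (cts_comp (sqd_cont cK') (@hat_cont _ dl)).
have wL x : w x != 0 -> box L x.
  move=> h; apply/KL/inK; rewrite leNgt; apply: contra h => /ltW h.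
  by rewrite /w (hat_eq0 dl0 h) mulr0.
have bw : bmc w := bmc_continuous cw wL.
have w0 x : 0 <= w x by rewrite /w mulr_ge0 ?hat_ge0.
(* Bounds the total mass against which the pointwise error is integrated; the 1 makes it
   positive. *)
pose C := I2 w + 1; have C0 : 0 < C by rewrite /C ltr_wpDl// I2_ge0.
have p0 := pi_gt0 R.
pose N := (Num.truncn (32 * L * pi * C / e)).+1.
have N0 : (0 < N)%N by [].
have n0 : 0 < N%:R :> R by rewrite ltr0n.
have NC : 8 * L * pi / N%:R * C <= e / 4.
  have h0 : 0 <= 32 * L * pi * C / e by rewrite divr_ge0 ?mulr_ge0//; lra.
  have /andP[_ h] := truncn_itv h0; rewrite -/N in h.
  have h1 : 32 * L * pi * C < N%:R * e by rewrite -ltr_pdivrMr.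
  by rewrite mulrAC ler_pdivrMr//; lra.
pose eps := e / (4 * N.+1%:R * C).
have eps0 : 0 < eps by rewrite /eps divr_gt0// !mulr_gt0.
have eC : N.+1%:R * eps * C = e / 4 by rewrite /eps; field; rewrite gt_eqF//= pnatr_eq0.
pose nu (i : 'I_N.+1) : R * R := udir (- pi + 2 * pi * i%:R / N%:R).
pose X := smean nu (fun i => hsup K' (nu i)) eps.
have [CX1 CX2 _] := smean_C1 nu (fun i => hsup K' (nu i)) eps0.
have K'L : K' `<=` box L := subset_trans K'K KL.
have bc : ccn (box L) := box_ccn (ltW L0).
have [Bo [dBo BoM cBo Bo1 Bo01]] := hat_primitive (@ltr01 R).
(* A cut-off equal to 1 on a box containing [K]: it makes the field compactly supported without
   changing its divergence on [K]. *)
pose om x := Bo (sqd (box L) x).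
have omC : C1c setT om.
  exact: (@kappa_C1c _ (hat 1) Bo 1 (box L) setT bc (@hat_cont _ 1) dBo ltr01 BoM).
have [_ omd] := kappa_C1 bc (@hat_cont _ 1) dBo.
have [CY1 E1] := C1_M (C1c_C1 omC) CX1; have [CY2 E2] := C1_M (C1c_C1 omC) CX2.
exists (fun x => om x * (X x).1), (fun x => om x * (X x).2); split.
- exact: C1c_M omC CX1.
- exact: C1c_M omC CX2.
- move=> x; rewrite -(@ler_pXn2r _ 2) ?nnegrE ?enorm_ge0// enormE expr1n.
  have /andP[q0 q1] := Bo01 _ (sqd_ge0 (box L) x).
  have -> : (om x * (X x).1, om x * (X x).2) = om x *: X x by [].
  rewrite dotpZl dotpZr mulrA; apply: (@le_trans _ _ (1 * 1)); last by rewrite mulr1.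
  apply: ler_pM; rewrite ?mulr_ge0 ?dotp_ge0//.
    by rewrite -[leRHS](mulr1 1) ler_pM.
  exact: smean_le1.
pose F x := d1 (fun x => (X x).1) x + d2 (fun x => (X x).2) x.
have cF : continuous F by have [_ h1 _] := CX1; have [_ _ h2] := CX2; exact: cts_add h1 h2.
have divE x : K x -> d1 (fun x => om x * (X x).1) x + d2 (fun x => om x * (X x).2) x = F x.
  move=> /KL xL; have [-> _] := E1 x; have [_ ->] := E2 x.
  have [q1 q2] := omd x; rewrite /om q1 q2 sqd_in// Bo1 /resid proj_in// subrr /F.
  by rewrite /= ?subrr !scaler0 !mul1r !mul0r !addr0.
have -> : \int[@leb2 R]_(x in K) (d1 (fun x => om x * (X x).1) x + d2 (fun x => om x * (X x).2) x) =
    \int[@leb2 R]_(x in K) F x.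
  by apply: eq_Rintegral => x /set_mem; exact: divE.
rewrite I2_mkcond.
have mK := compact_measurable2 K_c.
have bk := C1c_bmc kC; have [b0 b1 b2] := bk.
have step1 : I2 (fun x => kap x * F x) <= I2 (fun x => F x * \1_K x).
  apply: I2_le; first exact: bmc_cont.
    exact: (indic_bmc mK KL).
  move=> x; rewrite mulrC; apply: ler_wpM2l; first exact: smean_div.
  have /andP[k0 k1] := B01 _ (sqd_ge0 K' x).
  rewrite indicE; case: (boolP (x \in K)) => [//|/negP xK] /=.
  rewrite /kap BM// ltW// ltNge; apply/negP => h; apply: xK.
  exact/mem_set/inK.
apply: le_trans step1; rewrite (div_by_parts kC CX1 CX2) -I2N; last first.
  by apply: bmcD; apply: bmc_cont => //; exact: C1_continuous.
have cr : continuous (fun x => enorm (resid K' x)) := cts_comp (sqd_cont cK') (@sqrt_continuous R).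
pose err : R := N.+1%:R * eps + 8 * L * pi / N%:R.
have /andP[h1 _] := hat_steiner dl0 cK'.
apply: (@le_trans _ _ (I2 (fun x => w x * enorm (resid K' x) - err * w x))).
  rewrite (I2B (bmc_cont bw cr) (bmcZ err bw)) (I2Z _ bw).
  apply: (@le_trans _ _ (mwidth K' - err * I2 w)); last by rewrite lerD2r.
  have a1 : 0 < N.+1%:R * eps by rewrite mulr_gt0.
  have a2 : 0 < 8 * L * pi / N%:R by rewrite divr_gt0// !mulr_gt0.
  have err0 : 0 <= err by rewrite /err; lra.
  have : err * I2 w <= err * C by rewrite ler_wpM2l// /C lerDl.
  have : err * C <= e / 2 by rewrite /err mulrDl; lra.
  rewrite K'm; lra.
apply: I2_le.
- by apply: bmcB; [exact: bmc_cont|exact: bmcZ].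
- by apply: bmcN; apply: bmcD; apply: bmc_cont => //; exact: C1_continuous.
move=> x; have [e1 e2] := kd x; rewrite /kap e1 e2.
rewrite [leRHS](_ : _ = w x * dotp (X x) (resid K' x)); last first.
  by rewrite /w /dotp /= /GRing.scale/=; ring.
rewrite [err * _]mulrC -mulrBr.
have [->|wx] := eqVneq (w x) 0; first by rewrite !mul0r.
rewrite ler_wpM2l//; exact: (smean_resid cK' L0 K'L N0 eps0 (wL _ wx) (lexx L)).
Qed.

Lemma convex_set_convex2 K : convex_set K -> convex2 K.
Proof.
move=> vK x y s Kx Ky /andP[s0 s1].
have s1' : 1 - s <= 1 by rewrite gerBl.
have s0' : 0 <= 1 - s by rewrite subr_ge0.
have := vK x y (Itv01 s0' s1') (mem_set Kx) (mem_set Ky) => /set_mem.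
by rewrite /conv /= /unstable.onem subKr.
Qed.

Lemma convex_body_ccn K : convex_body K -> ccn K.
Proof.
move=> [K_c vK [z0 iK]]; split => //; first exact: convex_set_convex2.
by exists z0; exact: interior_subset.
Qed.

Lemma interior_ball K z0 : K° z0 -> exists2 rho : R, 0 < rho &
  forall w, dotp w w <= rho ^+ 2 -> K (z0 + w).
Proof.
move=> /nbhs_ballP[e /= e0 He]; exists (e / 2); first by rewrite divr_gt0.
move=> w ww; apply: He; have [w1 w2] := dotp_normle w.
have hh (a : R) : `|a| ^+ 2 <= dotp w w -> `|a| < e.
  move=> ha; apply: (@le_lt_trans _ _ (e / 2)); last by lra.
  have e2 : 0 <= e / 2 by lra.
  by rewrite -(@ler_pXn2r _ 2) ?nnegrE//; exact: le_trans ha ww.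
by split; rewrite /ball /= opprD addrA subrr sub0r normrN; apply: hh.
Qed.

(** Cauchy's formula. An interior point provides the disk around which [K] is shrunk for the lower
    bound. *)
Lemma perimeterE K : convex_body K -> perimeter K = (mwidth K)%:E.
Proof.
move=> bK; have cK := convex_body_ccn bK; case: bK => [K_c vK [z0 iK]].
have [rho r0 zK] := interior_ball iK.
apply/eqP; rewrite eq_le; apply/andP; split.
  by apply: ge_ereal_sup => _ [X1 [X2 [h1 h2 h3 ->]]]; rewrite lee_fin; exact: perimeter_le.
apply/lee_addgt0Pr => e e0.
have [Y1 [Y2 [y1 y2 y3 y4]]] := perimeter_ge cK r0 zK e0.
apply: (@le_trans _ _ ((\int[@leb2 R]_(x in K) (d1 Y1 x + d2 Y2 x))%:E + e%:E)%E).
  by rewrite -EFinD lee_fin -lerBlDr.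
by rewrite leeD2r//; apply: ereal_sup_ubound; exists Y1, Y2.
Qed.

Lemma disk_ccn (r : R) : 0 <= r -> ccn (disk r).
Proof.
move=> r0.
have E : disk r = [set x | dotp x x <= r ^+ 2].
  apply/seteqP; split => x; rewrite /disk /=.
    by move=> h; rewrite -enormE ler_pXn2r ?nnegrE ?enorm_ge0.
  by rewrite -enormE ler_pXn2r ?nnegrE ?enorm_ge0.
split.
- rewrite E; apply: (@bounded_closed_compact2 _ _ r).
    apply: (@closed_comp _ _ (fun x => dotp x x) [set s | s <= r ^+ 2]); last exact: closed_le.
    by move=> x _; exact: (dotp_cont (@cts_id2 R) (@cts_id2 R)).
  move=> x /= h; have [h1 h2] := dotp_normle x; apply/in_box.
  by split; rewrite -(@ler_pXn2r _ 2) ?nnegrE//; lra.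
- move=> x y s; rewrite E /= => hx hy /andP[s0 s1].
  have h := dotp_young x y.
  have -> : dotp ((1 - s) *: x + s *: y) ((1 - s) *: x + s *: y) =
    (1 - s) ^+ 2 * dotp x x + s ^+ 2 * dotp y y + s * (1 - s) * (2 * dotp x y).
    by rewrite /dotp /= /GRing.scale/=; ring.
  have h2 : s * (1 - s) * (2 * dotp x y) <= s * (1 - s) * (dotp x x + dotp y y).
    by rewrite ler_wpM2l// mulr_ge0// subr_ge0.
  have h3 : (1 - s) * dotp x x <= (1 - s) * r ^+ 2 by rewrite ler_wpM2l// subr_ge0.
  have h4 : s * dotp y y <= s * r ^+ 2 by rewrite ler_wpM2l.
  by rewrite !expr2 in h3 h4 *; lra.
- by exists 0; rewrite /disk /= /enorm /dotp /= mul0r addr0 sqrtr0.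
Qed.

Lemma disk_support (r th : R) : 0 <= r -> support_fun (disk r) th = r.
Proof.
move=> r0; rewrite support_funE -/(udir th); apply/eqP; rewrite eq_le; apply/andP; split.
  apply: hsup_le; first exact: disk_ccn.
  move=> z zr; apply: (le_trans (dotp_le _ _)).
  by rewrite /enorm udir_unit sqrtr1 mulr1.
have : dotp (r *: udir th) (udir th) <= hsup (disk r) (udir th).
  apply: hsup_ge; first exact: disk_ccn.
  by rewrite /disk /= /enorm dotpZl dotpZr udir_unit mulr1 -expr2 sqrtr_sqr ger0_norm.
by rewrite dotpZl udir_unit mulr1.
Qed.

Lemma disk_convex_body (r : R) : 0 < r -> convex_body (disk r).
Proof.
move=> r0; have [c v n] := disk_ccn (ltW r0); split => //.
  move=> x y l /set_mem xr /set_mem yr; apply/mem_set.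
  have e : conv l x y = (1 - (1 - l%:num)) *: x + (1 - l%:num) *: y by rewrite subKr.
  by rewrite e; apply: v => //; rewrite subr_ge0 gerBl ge0 le1.
exists 0; apply/nbhs_ballP; exists (r / 2); first by rewrite /= divr_gt0.
move=> x [h1 h2]; rewrite /disk /= -(@ler_pXn2r _ 2) ?nnegrE ?enorm_ge0 ?ltW// enormE.
move: h1 h2; rewrite /ball /= !sub0r !normrN => h1 h2.
have q1 : `|x.1| ^+ 2 <= (r / 2) ^+ 2 by rewrite ler_pXn2r ?nnegrE// ?ltW//; lra.
have q2 : `|x.2| ^+ 2 <= (r / 2) ^+ 2 by rewrite ler_pXn2r ?nnegrE// ?ltW//; lra.
rewrite !real_normK ?num_real// !expr2 in q1 q2; rewrite /dotp expr2; nra.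
Qed.

Lemma mwidth_disk (r : R) : 0 <= r -> mwidth (disk r) = 2 * pi * r.
Proof.
move=> r0; rewrite /mwidth.
have -> : \int[mu]_(th in `[0, 2 * pi]) support_fun (disk r) th = \int[mu]_(th in `[0, 2 * pi]) cst r th.
  by apply: eq_Rintegral => th _; rewrite disk_support.
have dc : forall x : R, is_derive x 1 (fun x => r * x) (cst r x).
  by move=> x; apply: (deq (derZ r (derI x))); rewrite mulr1.
by rewrite (Rint_FTC pi2_ge0 (@cts_cst _ _ r) dc); ring.
Qed.

End cauchy_perimeter_lower.

(** * Completeness and the gaussian inner product *)

Section riesz_fischer.
Context {R : realType}.

(** The increments are at most (1 + A) (3 / 4)^n, because 2^n (3 / 4)^(2 n) = (9 / 8)^n is at least
    1. *)
Lemma fast_cauchy_cvg (f : nat -> R) (A : R) : 0 <= A ->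
  (forall n, 2 ^+ n * (f n - f n.+1) ^+ 2 <= A) -> cvgn f.
Proof.
move=> A0 fA; have : cvgn (series (telescope f)).
  apply: normed_cvg; apply: (@series_le_cvg _ _ (geometric (1 + A) (3 / 4))).
  - by move=> n; exact: normr_ge0.
  - by move=> n; rewrite /geometric /= mulr_ge0// ?exprn_ge0; lra.
  - move=> n; rewrite /geometric /telescope /=.
    set d := f n.+1 - f n; have dA : 2 ^+ n * d ^+ 2 <= A by have := fA n; rewrite -sqrrN opprB.
    set c : R := (3 / 4) ^+ n; have c0 : 0 < c by apply: exprn_gt0; lra.
    have h0 : 0 < (2 : R) ^+ n by apply: exprn_gt0; lra.
    have h : 1 <= 2 ^+ n * c ^+ 2 by rewrite /c exprAC -exprMn exprn_ege1//; lra.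
    have hd : `|d| ^+ 2 <= A * c ^+ 2.
      rewrite real_normK ?num_real//; apply: (@le_trans _ _ (2 ^+ n * d ^+ 2 * c ^+ 2)).
        rewrite mulrAC -{1}(mul1r (d ^+ 2)) ler_wpM2r ?sqr_ge0//.
      by rewrite ler_wpM2r ?sqr_ge0.
    have n0 := normr_ge0 d.
    have : `|d| ^+ 2 <= ((1 + A) * c) ^+ 2.
      apply: le_trans hd _; rewrite exprMn ler_wpM2r ?sqr_ge0//.
      by rewrite expr2 mulrDl !mulrDr !mul1r mulr1 -expr2; have := sqr_ge0 A; lra.
    by rewrite ler_sqr ?nnegrE// mulr_ge0//; lra.
  - by apply: is_cvg_geometric_series; rewrite ger0_norm; lra.
move=> cs; have -> : f = (fun n => f 0%N + series (telescope f) n).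
  by apply/funext => n; exact: eq_sum_telescope.
by apply: is_cvgD => //; exact: is_cvg_cst.
Qed.

(** The decay 4^-k leaves room for the weights 2^k: the sum of 2^k (f_k - f_(k+1))^2 is integrable,
    hence finite almost everywhere, which gives pointwise convergence. Fatou's lemma carries the
    bound to the limit. *)
Lemma riesz_fischer d (T : measurableType d) (mu : {measure set T -> \bar R})
    (f : nat -> T -> R) (C : R) : 0 <= C ->
  (forall n, measurable_fun setT (f n)) ->
  (forall k l, (k <= l)%N ->
     (\int[mu]_x ((f k x - f l x) ^+ 2)%:E <= (C / 4 ^+ k)%:E)%E) ->
  exists2 g : T -> R, measurable_fun setT g &
    forall n, (\int[mu]_x ((f n x - g x) ^+ 2)%:E <= (C / 4 ^+ n)%:E)%E.
Proof.
move=> C0 mf fC.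
pose t k x := (2 ^+ k * (f k x - f k.+1 x) ^+ 2)%:E.
have t0 k x : (0 <= t k x)%E by rewrite lee_fin mulr_ge0 ?sqr_ge0 ?exprn_ge0.
have md k l : measurable_fun setT (fun x => (f k x - f l x) ^+ 2).
  by apply: measurable_funX; exact: measurable_funB.
have mt k : measurable_fun setT (t k).
  by apply/measurable_EFinP; apply: measurable_funM => //.
have it : mu.-integrable setT (fun x => (\sum_(k <oo) t k x)%E).
  apply/integrableP; split.
    by apply: ge0_emeasurable_sum => // k x _ _; exact: t0.
  rewrite (eq_integral (fun x => (\sum_(k <oo) t k x)%E)); last first.
    by move=> x _; rewrite gee0_abs//; apply: nneseries_ge0 => k _ _.
  rewrite integral_nneseries//.
  apply: (@le_lt_trans _ _ (\sum_(k <oo) (2 * C / (2 ^ k.+1)%:R)%:E)%E).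
    apply: lee_nneseries => [k _ _|k _]; first by apply: integral_ge0 => x _; exact: t0.
    rewrite /t; under eq_integral do rewrite EFinM.
    rewrite ge0_integralZl//; first last.
    - by move=> x _; rewrite lee_fin sqr_ge0.
    - by apply/measurable_EFinP.
    apply: (@le_trans _ _ ((2 ^+ k)%:E * (C / 4 ^+ k)%:E)%E).
      by rewrite lee_pmul2l ?fC// ?lte_fin ?exprn_gt0.
    rewrite -EFinM lee_fin natrX exprS invfM mulrACA divff// mul1r.
    have -> : (4 : R) = 2 * 2 by ring.
    rewrite exprMn invfM mulrCA !mulrA mulfK// expf_neq0//.
  apply: le_lt_trans (epsilon_trick0 _ _) _; last exact: ltry.
  by rewrite mulr_ge0.
have cv : {ae mu, forall x, cvgn (fun n => f n x)}.
  have := integrable_ae measurableT it; apply: filterS => x /(_ I) fx.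
  apply: (@fast_cauchy_cvg _ (fine (\sum_(k <oo) t k x)%E)).
    by apply: fine_ge0; apply: nneseries_ge0.
  move=> n; rewrite -lee_fin fineK//.
  apply: le_trans (nneseries_lim_ge n.+1 _) => //.
  rewrite big_nat_recr//= leeDr//; exact: sume_ge0.
(* The upper limit exists and is measurable everywhere; where the sequence diverges [g] takes a
   default value on a null set. *)
pose g x := fine (limn_esup (fun n => (f n x)%:E)).
have mg : measurable_fun setT g.
  apply: (measurableT_comp (fine_measurable _)) => //.
  by apply: measurable_fun_limn_esup => n; apply/measurable_EFinP.
have gE x : cvgn (fun n => f n x) -> f n x @[n --> \oo] --> g x.
  move=> cx; rewrite /g is_cvg_limn_esupE; first by rewrite EFin_lim.
  by apply/cvg_ex; exists (limn (fun n => f n x))%:E; apply: cvg_EFin => //; exact: nearW.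
exists g => // n.
have mgn : measurable_fun setT (fun x => ((f n x - g x) ^+ 2)%:E).
  by apply/measurable_EFinP; apply: measurable_funX; exact: measurable_funB.
apply: (@le_trans _ _ (\int[mu]_x limn_einf (fun l => ((f n x - f l x) ^+ 2)%:E))%E).
  apply: ae_ge0_le_integral => //.
  - by move=> x _; rewrite lee_fin sqr_ge0.
  - move=> x _; rewrite limn_einf_lim; apply: lime_ge; first exact: is_cvg_einfs.
    by apply: nearW => l; apply: le_ereal_inf_tmp => _ [m _ <-]; rewrite lee_fin sqr_ge0.
  - under eq_fun do rewrite limn_einf_lim.
    apply: (@emeasurable_fun_cvg _ _ _ _ (fun k x => einfs (fun l => ((f n x - f l x) ^+ 2)%:E) k)).
      by move=> k; apply: measurable_fun_einfs => l; exact/measurable_EFinP.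
    by move=> x _; exact: is_cvg_einfs.
  - apply: filterS cv => x /gE gx _.
    have h : ((f n x - f l x) ^+ 2)%:E @[l --> \oo] --> ((f n x - g x) ^+ 2)%:E.
      apply: cvg_EFin; first exact: nearW.
      rewrite expr2; under eq_fun do rewrite expr2.
      by apply: cvgM; apply: cvgB => //; exact: cvg_cst.
    rewrite is_cvg_limn_einfE; last by apply/cvg_ex; eexists; exact: h.
    by rewrite (cvg_lim _ h).
apply: le_trans (fatou _ _ _ _) _ => //.
- by move=> l; apply/measurable_EFinP.
- by move=> l x _; rewrite lee_fin sqr_ge0.
rewrite limn_einf_lim; apply: lime_le; first exact: is_cvg_einfs.
near=> l; apply: (@le_trans _ _ (\int[mu]_x ((f n x - f l x) ^+ 2)%:E)%E).
  by apply: ereal_inf_lbound; exists l => //=.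
by apply: fC; near: l; exists n.
Unshelve. all: by end_near. Qed.
End riesz_fischer.

Lemma ecvg0_lt (R : realType) (u : nat -> \bar R) (c : R) : 0 < c -> u n @[n --> \oo] --> 0%E ->
  \forall n \near \oo, (u n < c%:E)%E.
Proof.
move=> c0 u0; have /u0 : nbhs (0%E : \bar R) [set y | (y < c%:E)%E].
  by apply: open_nbhs_nbhs; split; [exact: open_ereal_lt_ereal|rewrite /= lte_fin].
by [].
Qed.

Section gauss_L2.
Context {R : realType}.
Notation T2 := (measurableTypeR R * measurableTypeR R)%type.
Implicit Types f g h : R * R -> R.

Lemma gaussE (x : R * R) : gauss x = (2 * pi)^-1 * expR (- (dotp x x) / 2).
Proof. by rewrite /gauss /enorm sqr_sqrtr// dotp_ge0. Qed.

Lemma gauss_gt0 (x : R * R) : 0 < gauss x.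
Proof. by rewrite /gauss mulr_gt0 ?expR_gt0// invr_gt0 mulr_gt0// pi_gt0. Qed.

Lemma gauss_le1 (x : R * R) : gauss x <= 1.
Proof.
rewrite gaussE mulr_ile1//.
- by rewrite invr_ge0 mulr_ge0// pi_ge0.
- by rewrite invf_le1 ?mulr_gt0 ?pi_gt0//; have := @pi_ge2 R; lra.
- rewrite -[leRHS]expR0 ler_expR; have := dotp_ge0 (x : R * R); lra.
Qed.

Lemma gauss_cont : continuous (@gauss R).
Proof.
have -> : @gauss R = fun x => (2 * pi)^-1 * expR (- (1 / 2) * dotp x x).
  by apply/funext => x; rewrite gaussE; congr (_ * expR _); field.
have cd := dotp_cont (@cts_id2 R) (@cts_id2 R).
apply: cts_mul; [exact: cts_cst|apply: cts_expR_comp; apply: cts_mul; [exact: cts_cst|exact: cd]].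
Qed.

Lemma gauss_meas : measurable_fun (setT : set T2) (@gauss R).
Proof. exact: continuous_measurable2 gauss_cont. Qed.

Variable Omega : set (R * R).
Hypothesis mO : measurable (Omega : set T2).

Definition L2 f := measurable_fun (Omega : set T2) f /\
  (\int[@leb2 R]_(x in Omega) (f x ^+ 2 * gauss x)%:E < +oo)%E.

Definition ip f g := \int[@leb2 R]_(x in Omega) (f x * g x * gauss x).

Let mgauss : measurable_fun (Omega : set T2) (@gauss R).
Proof. by apply: measurable_funTS; exact: gauss_meas. Qed.

Let msq f : measurable_fun (Omega : set T2) f ->
  measurable_fun (Omega : set T2) (fun x => (f x ^+ 2 * gauss x)%:E).
Proof.
by move=> mf; apply/measurable_EFinP; apply: measurable_funM => //; exact: measurable_funX.
Qed.

Lemma sq_gauss_ge0 (a : R) (x : R * R) : (0 <= (a ^+ 2 * gauss x)%:E)%E.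
Proof. by rewrite lee_fin mulr_ge0 ?sqr_ge0// ltW// gauss_gt0. Qed.

Lemma L2_dom f g h (c : R) : 0 <= c -> measurable_fun (Omega : set T2) f -> L2 g -> L2 h ->
  (forall x, f x ^+ 2 <= c * (g x ^+ 2 + h x ^+ 2)) -> L2 f.
Proof.
move=> c0 mf [mg fg] [mh fh] fgh; split => //.
apply: (@le_lt_trans _ _ (c%:E * (\int[@leb2 R]_(x in Omega) (g x ^+ 2 * gauss x)%:E +
   \int[@leb2 R]_(x in Omega) (h x ^+ 2 * gauss x)%:E))%E); last first.
  by rewrite lte_mul_pinfty// lte_add_pinfty.
rewrite -ge0_integralD//; [|by move=> x _; exact: sq_gauss_ge0|exact: msq|
  by move=> x _; exact: sq_gauss_ge0|exact: msq].
rewrite -ge0_integralZl//; [|by apply: emeasurable_funD; exact: msq|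
  by move=> x _; apply: adde_ge0; exact: sq_gauss_ge0].
apply: ge0_le_integral => //.
- by move=> x _; exact: sq_gauss_ge0.
- exact: msq.
- by apply: measurable_funeM; apply: emeasurable_funD; exact: msq.
- move=> x _; rewrite -EFinD -EFinM lee_fin -mulrDl mulrA.
  by rewrite ler_wpM2r// ltW// gauss_gt0.
Qed.

Lemma L2_D f g : L2 f -> L2 g -> L2 (fun x => f x + g x).
Proof.
move=> hf hg; apply: (L2_dom (c := 2) _ _ hf hg) => //.
  by apply: measurable_funD; [exact: hf.1|exact: hg.1].
by move=> x; have := sqr_ge0 (f x - g x); nra.
Qed.

Lemma L2_Z (a : R) f : L2 f -> L2 (fun x => a * f x).
Proof.
move=> hf; apply: (L2_dom (c := a ^+ 2) _ _ hf hf) => //.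
- exact: sqr_ge0.
- by apply: measurable_funM => //; exact: hf.1.
- by move=> x; rewrite exprMn ler_wpM2l ?sqr_ge0// lerDl sqr_ge0.
Qed.

Lemma L2_B f g : L2 f -> L2 g -> L2 (fun x => f x - g x).
Proof.
move=> hf /(L2_Z (-1)) hg; have := L2_D hf hg.
by under eq_fun do rewrite mulN1r.
Qed.

Lemma L2_int f g : L2 f -> L2 g ->
  (@leb2 R).-integrable Omega (fun x => (f x * g x * gauss x)%:E).
Proof.
move=> hf hg; have [mf If] := hf; have [mg Ig] := hg.
have I1 k : L2 k -> (@leb2 R).-integrable Omega (fun x => (k x ^+ 2 * gauss x)%:E).
  move=> [mk Ik]; apply/integrableP; split; first exact: msq.
  by under eq_integral do rewrite gee0_abs ?sq_gauss_ge0//.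
have := integrableD mO (I1 _ hf) (I1 _ hg); apply: le_integrable => //.
  by apply/measurable_EFinP; apply: measurable_funM => //; exact: measurable_funM.
move=> x _; rewrite -EFinD !abse_EFin lee_fin -mulrDl !normrM.
rewrite ler_wpM2r// [leRHS]ger0_norm ?addr_ge0 ?sqr_ge0//.
rewrite -(real_normK (num_real (f x))) -(real_normK (num_real (g x))).
have := sqr_ge0 (`|f x| - `|g x|); have := sqr_ge0 (`|f x| + `|g x|); set a := `|f x|; set b := `|g x|; nra.
Qed.

Lemma ipC f g : ip f g = ip g f.
Proof. by rewrite /ip; under eq_Rintegral do rewrite (mulrC (f _)). Qed.

Lemma ipDl f g h : L2 f -> L2 g -> L2 h -> ip (fun x => f x + g x) h = ip f h + ip g h.
Proof.
move=> hf hg hh; rewrite /ip -RintegralD//; [|exact: L2_int|exact: L2_int].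
by apply: eq_Rintegral => x _; rewrite /=; ring.
Qed.

Lemma ipZl a f h : L2 f -> L2 h -> ip (fun x => a * f x) h = a * ip f h.
Proof.
move=> hf hh; rewrite /ip -RintegralZl//; last exact: L2_int.
by apply: eq_Rintegral => x _; rewrite /=; ring.
Qed.

Lemma ipBl f g h : L2 f -> L2 g -> L2 h -> ip (fun x => f x - g x) h = ip f h - ip g h.
Proof.
move=> hf hg hh; rewrite /ip -RintegralB//; [|exact: L2_int|exact: L2_int].
by apply: eq_Rintegral => x _; rewrite /=; ring.
Qed.

Lemma ip_ge0 f : 0 <= ip f f.
Proof.
apply: Rintegral_ge0 => x _; rewrite mulr_ge0 ?(ltW (gauss_gt0 _))//.
by rewrite -expr2 sqr_ge0.
Qed.

Lemma ipE f : L2 f -> (\int[@leb2 R]_(x in Omega) (f x ^+ 2 * gauss x)%:E)%E = (ip f f)%:E.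
Proof.
move=> hf; rewrite /ip /Rintegral fineK; last by apply: integrable_fin_num => //; exact: L2_int.
by apply: eq_integral => x _; rewrite expr2.
Qed.

Lemma ip_young (a : R) f g : L2 f -> L2 g -> 2 * a * ip f g <= a ^+ 2 * ip f f + ip g g.
Proof.
move=> hf hg; have := ip_ge0 (fun x => a * f x - g x).
have haf := L2_Z a hf; have hd := L2_B haf hg.
rewrite ipBl// ipZl// (ipC f) (ipC g) !ipBl// !ipZl// (ipC g f); lra.
Qed.

Lemma cauchy_schwarz f g : L2 f -> L2 g -> ip f g ^+ 2 <= ip f f * ip g g.
Proof.
move=> hf hg; have f0 := ip_ge0 f; have g0 := ip_ge0 g.
have [f1|] := ltP 0 (ip f f).
  have := ip_young (ip f g / ip f f) hf hg => h.
  have : 2 * (ip f g / ip f f) * ip f g * ip f f <=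
     ((ip f g / ip f f) ^+ 2 * ip f f + ip g g) * ip f f by rewrite ler_pM2r.
  have -> : 2 * (ip f g / ip f f) * ip f g * ip f f = 2 * ip f g ^+ 2 by field; exact: lt0r_neq0.
  have -> : ((ip f g / ip f f) ^+ 2 * ip f f + ip g g) * ip f f = ip f g ^+ 2 + ip f f * ip g g.
    by field; exact: lt0r_neq0.
  by lra.
move=> f1; have {f0 f1} f0 : ip f f = 0 by apply/le_anti; rewrite f0 f1.
rewrite f0 mul0r; case: (eqVneq (ip f g) 0) => [->|n0]; first by rewrite expr0n.
(* With [ip f f = 0] the bound is linear in the parameter, and this value makes it read
   [ip g g + 1 <= ip g g]. *)
have := ip_young ((ip g g + 1) / (2 * ip f g)) hf hg; rewrite f0 mulr0 add0r.
have -> : 2 * ((ip g g + 1) / (2 * ip f g)) * ip f g = ip g g + 1 by field.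
by lra.
Qed.

(** [cvgL2] asks only measurability of the limit; a term at squared distance less than 1 from it
    gives the integrability. *)
Lemma cvgL2_L2 (f : nat -> R * R -> R) g : (forall n, L2 (f n)) -> cvgL2 Omega f g -> L2 g.
Proof.
move=> hf [mg fg]; have [n fn] : exists n,
    (\int[@leb2 R]_(x in Omega) ((f n x - g x) ^+ 2 * gauss x)%:E < 1%:E)%E.
  have [n _ /(_ n (leqnn n)) hn] : \forall n \near \oo,
      (\int[@leb2 R]_(x in Omega) ((f n x - g x) ^+ 2 * gauss x)%:E < 1%:E)%E.
    by exact: ecvg0_lt fg.
  by exists n.
have hd : L2 (fun x => f n x - g x).
  split; first by apply: measurable_funB => //; exact: (hf n).1.
  by apply: lt_trans fn _; exact: ltry.
have := L2_B (hf n) hd; rewrite (_ : (fun x => _) = g)//.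
by apply/funext => x; ring.
Qed.

Lemma cvgL2_ip (f : nat -> R * R -> R) g h : (forall n, L2 (f n)) -> cvgL2 Omega f g -> L2 h ->
  ip (f n) h @[n --> \oo] --> ip g h.
Proof.
move=> hf fg hh; have hg := cvgL2_L2 hf fg; have [_ c0] := fg.
have h0 := ip_ge0 h.
apply/cvgrPdist_lt => e e0; pose c := e ^+ 2 / (ip h h + 1).
have cp : 0 < c by rewrite divr_gt0 ?exprn_gt0//; lra.
have [N _ hN] : \forall n \near \oo,
    (\int[@leb2 R]_(x in Omega) ((f n x - g x) ^+ 2 * gauss x)%:E < c%:E)%E.
  by exact: ecvg0_lt c0.
exists N => // n /= Nn; have hd := L2_B (hf n) hg.
have := hN n Nn; rewrite (ipE hd) lte_fin => dc.
have := cauchy_schwarz hd hh; rewrite ipBl// => cs.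
rewrite distrC -ltr_sqr ?nnegrE ?(ltW e0)// real_normK ?num_real//.
apply: le_lt_trans cs _; apply: (@le_lt_trans _ _ (c * ip h h)); first by rewrite ler_wpM2r// ltW.
have ce : c * (ip h h + 1) = e ^+ 2 by rewrite /c; field; lra.
by lra.
Qed.

Lemma bmc_L2 f : bmc f -> L2 f.
Proof.
move=> bf; split; first by apply: measurable_funTS; exact: bf.1.
have [mf [L [M [L0 fM fL]]]] := bf.
have b2 : bmc (fun x => f x ^+ 2 * gauss x).
  under eq_fun do rewrite expr2.
  apply: (bmc_cont _ gauss_cont); apply: (bmc_bounded bf mf fM).
have := integrableS measurableT mO (@subsetT _ _) (bmc_int b2).
by move=> /integrableP[_]; under eq_integral do rewrite gee0_abs ?sq_gauss_ge0//.
Qed.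

Lemma L2_1 (L : R) : Omega `<=` box L -> L2 (cst 1).
Proof.
move=> OL; have [_ h] := bmc_L2 (bmc_box L); split => //.
apply: le_lt_trans h; rewrite le_eqVlt; apply/orP; left; apply/eqP.
by apply: eq_integral => x /set_mem/OL xL; rewrite indicE mem_set.
Qed.

Lemma ip1 f : ip f (cst 1) = \int[@leb2 R]_(x in Omega) (f x * gauss x).
Proof. by rewrite /ip; under eq_Rintegral do rewrite mulr1. Qed.

End gauss_L2.

(** * Variational principles for the torsional rigidity *)

Section torsion.
Context {R : realType}.
Notation T2 := (measurableTypeR R * measurableTypeR R)%type.
Implicit Types f g h phi psi : R * R -> R.

Lemma C1_fst : C1 (fun x : R * R => x.1) /\
  forall x : R * R, d1 (fun x : R * R => x.1) x = 1 /\ d2 (fun x : R * R => x.1) x = 0.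
Proof.
have [||C E] := @C1_intro R (fun x : R * R => x.1) (fun=> (1, 0)).
- by move=> x; exact: grad_fst.
- exact: cts_cst2.
- by split => // x; have [-> ->] := E x.
Qed.

Lemma C1_snd : C1 (fun x : R * R => x.2) /\
  forall x : R * R, d1 (fun x : R * R => x.2) x = 0 /\ d2 (fun x : R * R => x.2) x = 1.
Proof.
have [||C E] := @C1_intro R (fun x : R * R => x.2) (fun=> (0, 1)).
- by move=> x; exact: grad_snd.
- exact: cts_cst2.
- by split => // x; have [-> ->] := E x.
Qed.

Lemma bmc_sq f : bmc f -> bmc (fun x => f x ^+ 2).
Proof.
move=> bf; have [mf [L [M [L0 fM fL]]]] := bf; under eq_fun do rewrite expr2.
exact: (bmc_bounded bf mf fM).
Qed.

(** Integrating [phi] against the derivative of x_1 phi gives that the integral of phi^2 is minus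
    twice that of x_1 phi d_1 phi; Young's inequality with |x_1| <= L absorbs half of it. *)
Lemma poincare (Omega : set (R * R)) L phi : 0 < L -> Omega `<=` box L -> C1c Omega phi ->
  I2 (fun x => phi x ^+ 2) <= 4 * L ^+ 2 * I2 (fun x => d1 phi x ^+ 2).
Proof.
move=> L0 OL Hf; have [bf b1 b2] := C1c_bmc Hf.
have [Cx Ex] := C1_fst; have Cf := C1c_C1 Hf.
have [Cxf Exf] := C1_M Cx Cf.
have [+ _] := I2_by_parts Hf Cxf.
have cx := C1_continuous Cx.
have e1 x : phi x * d1 (fun x : R * R => x.1 * phi x) x =
    phi x ^+ 2 + d1 phi x * (x.1 * phi x).
  by have [-> _] := Exf x; have [-> _] := Ex x; ring.
under eq_fun do rewrite e1.
have bp : bmc (fun x : R * R => d1 phi x * (x.1 * phi x)).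
  exact: (bmc_cont b1 (C1_continuous Cxf)).
rewrite I2D//; last exact: bmc_sq.
have : I2 (fun x => -2 * (d1 phi x * (x.1 * phi x))) <=
       I2 (fun x => 2^-1 * phi x ^+ 2 + 2 * L ^+ 2 * d1 phi x ^+ 2).
  apply: I2_le; first exact: bmcZ.
    by apply: bmcD; apply: bmcZ; exact: bmc_sq.
  move=> x; have [/C1c_outside|] := pselect (~ closure [set x | phi x != 0] x).
    by move=> /(_ _ Hf)[-> -> _]; rewrite !mulr0 expr0n !mulr0 addr0.
  move=> /contrapT cx1; have [_ _ _ _ sub] := Hf.
  have /in_box[+ _] := OL _ (sub _ cx1); rewrite ler_norml => /andP[h1 h2].
  have h : x.1 ^+ 2 <= L ^+ 2 by nra.
  have : 0 <= (L ^+ 2 - x.1 ^+ 2) * d1 phi x ^+ 2 by rewrite mulr_ge0 ?sqr_ge0// subr_ge0.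
  have := sqr_ge0 (phi x + 2 * x.1 * d1 phi x); lra.
rewrite I2Z// I2D; [|by apply: bmcZ; exact: bmc_sq|by apply: bmcZ; exact: bmc_sq].
rewrite I2Z; last exact: bmc_sq.
by rewrite I2Z; last exact: bmc_sq; lra.
Qed.

Lemma gauss_box_ge (L : R) : exists2 m : R, 0 < m & forall x, box L x -> m <= gauss x.
Proof.
exists ((2 * pi)^-1 * expR (- L ^+ 2)).
  by rewrite mulr_gt0 ?expR_gt0// invr_gt0 mulr_gt0// pi_gt0.
move=> x /in_box[h1 h2]; rewrite gaussE ler_pM2l ?invr_gt0 ?mulr_gt0 ?pi_gt0//.
rewrite ler_expR; have : x.1 ^+ 2 <= L ^+ 2 /\ x.2 ^+ 2 <= L ^+ 2.
  have L0 : 0 <= L by exact: le_trans h1.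
  by rewrite -(real_normK (num_real x.1)) -(real_normK (num_real x.2)) !ler_sqr ?nnegrE.
by move=> [a b]; rewrite /dotp -!expr2; lra.
Qed.

(** Parallelogram identity for a concave quadratic: [ek] and [el] are the energies of two functions,
    [q] the Dirichlet form of their difference, [S] the supremum, which bounds the energy at the
    midpoint. *)
Lemma midpoint_bound (S ek el p q a b : R) :
  ek + 2 * (- 2^-1) * p - (- 2^-1) ^+ 2 * q <= S -> ek + 2 * -1 * p - (-1) ^+ 2 * q = el ->
  S - a < ek -> S - b < el -> b <= a -> q <= 4 * a.
Proof. lra. Qed.

Lemma quarter_pow k l : (k <= l)%N -> (4^-1 : R) ^+ l <= 4^-1 ^+ k.
Proof. by move=> kl; apply: ler_wiXn2l => //; lra. Qed.

(** A linear term dominated by a quadratic one vanishes; t = x / (D + 1) is close to the optimal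
    choice and defined for D = 0. *)
Lemma quadratic_zero (x D : R) : 0 <= D -> (forall t, 2 * t * x <= t ^+ 2 * D) -> x = 0.
Proof.
move=> d0 key; have := key (x / (D + 1)).
have -> : 2 * (x / (D + 1)) * x = (2 * x ^+ 2 * (D + 1)) / (D + 1) ^+ 2 by field; lra.
have -> : (x / (D + 1)) ^+ 2 * D = (x ^+ 2 * D) / (D + 1) ^+ 2 by field; lra.
rewrite ler_pM2r ?invr_gt0 ?exprn_gt0//; last lra.
have s0 := sqr_ge0 x; have h1 : 0 <= x ^+ 2 * D by rewrite mulr_ge0.
move=> h2; have h3 : x ^+ 2 <= 0 by lra.
by apply/eqP; rewrite -(sqrf_eq0 x) eq_le h3 s0.
Qed.

Local Opaque d1 d2.
Section existence.
Variables (Omega : set (R * R)) (L : R).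
Hypotheses (oO : open Omega) (L0 : 0 < L) (OL : Omega `<=` box L).
Local Notation ipO := (ip Omega).

Let mO : measurable (Omega : set T2). Proof. exact: open_measurable2. Qed.
Let one_L2 : L2 Omega (cst 1). Proof. exact: (L2_1 mO OL). Qed.

Lemma C1c_L2 phi : C1c Omega phi -> [/\ L2 Omega phi, L2 Omega (d1 phi) & L2 Omega (d2 phi)].
Proof. by move=> /C1c_bmc[b b1 b2]; split; exact: bmc_L2. Qed.

Definition Dir phi psi := ipO (d1 phi) (d1 psi) + ipO (d2 phi) (d2 psi).
Definition energy phi := 2 * ipO phi (cst 1) - Dir phi phi.

Lemma Dir_ge0 phi : 0 <= Dir phi phi.
Proof. by rewrite addr_ge0// ip_ge0. Qed.

Lemma DirC phi psi : Dir phi psi = Dir psi phi.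
Proof. by rewrite /Dir ipC (ipC _ (d2 phi)). Qed.

Lemma DirDl phi psi chi : C1c Omega phi -> C1c Omega psi -> C1c Omega chi ->
  Dir (fun x => phi x + psi x) chi = Dir phi chi + Dir psi chi.
Proof.
move=> Hf Hg Hh; have [f0 f1 f2] := C1c_L2 Hf; have [g0 g1 g2] := C1c_L2 Hg.
have [h0 h1 h2] := C1c_L2 Hh.
have [_ E] := C1_D (C1c_C1 Hf) (C1c_C1 Hg).
rewrite /Dir (_ : d1 (fun x => _) = fun x => d1 phi x + d1 psi x); last first.
  by apply/funext => x; exact: (E x).1.
rewrite (_ : d2 (fun x => _) = fun x => d2 phi x + d2 psi x); last first.
  by apply/funext => x; exact: (E x).2.
exact: etrans (f_equal2 +%R (ipDl mO f1 g1 h1) (ipDl mO f2 g2 h2)) (addrACA _ _ _ _).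
Qed.

Lemma DirZl a phi chi : C1c Omega phi -> C1c Omega chi ->
  Dir (fun x => a * phi x) chi = a * Dir phi chi.
Proof.
move=> Hf Hh; have [f0 f1 f2] := C1c_L2 Hf; have [h0 h1 h2] := C1c_L2 Hh.
have [_ E] := C1_Z a (C1c_C1 Hf).
rewrite /Dir (_ : d1 (fun x => _) = fun x => a * d1 phi x); last first.
  by apply/funext => x; exact: (E x).1.
rewrite (_ : d2 (fun x => _) = fun x => a * d2 phi x); last first.
  by apply/funext => x; exact: (E x).2.
exact: etrans (f_equal2 +%R (ipZl mO a f1 h1) (ipZl mO a f2 h2)) (esym (mulrDr _ _ _)).
Qed.

Lemma energy_perturb phi psi (t : R) : C1c Omega phi -> C1c Omega psi ->
  energy (fun x => phi x + t * psi x) =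
  energy phi + 2 * t * (ipO psi (cst 1) - Dir phi psi) - t ^+ 2 * Dir psi psi.
Proof.
move=> Hf Hg; have Ht := C1c_Z t Hg; have Hs := C1c_D Hf Ht.
have [f0 _ _] := C1c_L2 Hf; have [g0 _ _] := C1c_L2 Hg; have [h0 _ _] := C1c_L2 Ht.
rewrite /energy (DirDl Hf Ht Hs) (ipDl mO f0 h0 one_L2) (ipZl mO t g0 one_L2) (DirZl t Hg Hs).
rewrite (DirC phi) (DirC psi) (DirDl Hf Ht Hf) (DirDl Hf Ht Hg) (DirZl t Hg Hf) (DirZl t Hg Hg).
rewrite (DirC psi phi).
set a := ipO phi _; set b := ipO psi _; set c := Dir phi phi; set d := Dir phi psi; set e := Dir psi psi.
ring.
Qed.

(** Coercivity: on a bounded set the gaussian weight is bounded below, and [poincare] controls the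
    function itself. The left-hand sides use Lebesgue measure, for which the completeness argument
    is run. *)
Lemma Dir_lower : exists2 m : R, 0 < m & forall phi, C1c Omega phi ->
  [/\ I2 (fun x => d1 phi x ^+ 2) <= m * Dir phi phi,
      I2 (fun x => d2 phi x ^+ 2) <= m * Dir phi phi &
      I2 (fun x => phi x ^+ 2) <= m * Dir phi phi].
Proof.
have [c c0 cg] := gauss_box_ge L.
have key f : bmc f -> (forall x, f x != 0 -> Omega x) -> I2 (fun x => f x ^+ 2) <= c^-1 * ipO f f.
  move=> bf fO; rewrite /ip I2_mkcond -I2Z; last first.
    apply: bmc_indic => //; apply: bmc_cont gauss_cont.
    by have := bmc_sq bf; under eq_fun do rewrite expr2.
  apply: I2_le; first exact: bmc_sq.
    apply: bmcZ; apply: bmc_indic => //; apply: bmc_cont gauss_cont.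
    by have := bmc_sq bf; under eq_fun do rewrite expr2.
  move=> x; case: (eqVneq (f x) 0) => [->|fx]; first by rewrite expr0n !mul0r mulr0.
  have xO := fO x fx; rewrite indicE mem_set// mulr1 -expr2 mulrCA.
  by rewrite ler_peMr ?sqr_ge0// mulrC ler_pdivlMr// mul1r; exact/cg/OL.
have i0 : 0 < c^-1 by rewrite invr_gt0.
pose m := c^-1 + 4 * L ^+ 2 * c^-1.
have p0 : 0 <= 4 * L ^+ 2 * c^-1 by rewrite !mulr_ge0 ?sqr_ge0// ltW.
exists m => [|phi Hf]; first by rewrite /m; lra.
have [bf b1 b2] := C1c_bmc Hf.
have out x : ~ Omega x -> [/\ phi x = 0, d1 phi x = 0 & d2 phi x = 0].
  by move=> nx; apply: (C1c_outside Hf) => h; have [_ _ _ _ sub] := Hf; exact/nx/sub.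
have k1 := key _ b1 ltac:(by move=> x /eqP h; apply: contrapT => /out[]).
have k2 := key _ b2 ltac:(by move=> x /eqP h; apply: contrapT => /out[]).
have a1 := ip_ge0 Omega (d1 phi); have a2 := ip_ge0 Omega (d2 phi).
have q : c^-1 * Dir phi phi <= m * Dir phi phi by rewrite ler_wpM2r ?Dir_ge0// lerDl.
have q' : 4 * L ^+ 2 * c^-1 * Dir phi phi <= m * Dir phi phi.
  by rewrite ler_wpM2r ?Dir_ge0// lerDr ltW.
have d0 : c^-1 * ipO (d1 phi) (d1 phi) <= c^-1 * Dir phi phi.
  rewrite (ler_pM2l i0) /Dir lerDl; exact: a2.
have d0' : c^-1 * ipO (d2 phi) (d2 phi) <= c^-1 * Dir phi phi.
  rewrite (ler_pM2l i0) /Dir lerDr; exact: a1.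
split.
- exact: le_trans k1 (le_trans d0 q).
- exact: le_trans k2 (le_trans d0' q).
- apply: le_trans (poincare L0 OL Hf) _; apply: le_trans q'.
  rewrite -[leRHS]mulrA; apply: ler_wpM2l; first by rewrite mulr_ge0 ?sqr_ge0.
  exact: le_trans k1 d0.
Qed.

(** Young's inequality splits the linear term into a part absorbed by the Dirichlet form and [m]
    times the gaussian measure of [Omega]. *)
Lemma energy_bounded : exists A : R, forall phi, C1c Omega phi -> energy phi <= A.
Proof.
have [m m0 Hm] := Dir_lower; exists (m * ipO (cst 1) (cst 1)) => phi Hf.
have [_ _ h] := Hm _ Hf; have [f0 _ _] := C1c_L2 Hf; have [bf _ _] := C1c_bmc Hf.
have h1 : ipO phi phi <= m * Dir phi phi.
  apply: le_trans h; rewrite /ip I2_mkcond.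
  apply: I2_le; last 1 first.
  - move=> x; have g0 := gauss_gt0 x; have g1 := gauss_le1 x.
    rewrite -expr2 -mulrA ler_piMr ?sqr_ge0// indicE; case: (_ \in _); rewrite ?mulr1 ?mulr0//.
  - apply: bmc_indic => //; apply: bmc_cont gauss_cont.
    by have := bmc_sq bf; under eq_fun do rewrite expr2.
  - exact: bmc_sq.
have := ip_young mO m^-1 f0 one_L2; rewrite /energy => hy.
have : 2 * ipO phi (cst 1) <= m^-1 * ipO phi phi + m * ipO (cst 1) (cst 1).
  rewrite -(ler_pM2l (_ : 0 < m^-1)) ?invr_gt0//.
  have -> : m^-1 * (m^-1 * ipO phi phi + m * ipO (cst 1) (cst 1)) =
     m^-1 ^+ 2 * ipO phi phi + ipO (cst 1) (cst 1) by field; exact: lt0r_neq0.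
  by move: hy; lra.
have : m^-1 * ipO phi phi <= Dir phi phi.
  by rewrite ler_pdivrMl.
lra.
Qed.

(* By the parallelogram identity a maximizing sequence of [energy] is Cauchy. *)
Lemma torsion_exists : exists u, is_torsion_fun Omega u.
Proof.
have [A HA] := energy_bounded.
pose E := [set energy phi | phi in C1c Omega].
have C0 : C1c Omega (fun=> 0 : R).
  apply: (@C1c_intro _ _ set0 _ L); [|exact: closed0|by []|by []|by move=> x; rewrite eqxx].
  have [||C _] := @C1_intro R (fun=> 0) (fun=> (0, 0)) => //.
    by move=> x; exact: grad_cst.
  exact: cts_cst2.
have hE : has_sup E.
  split; first by exists (energy (fun=> 0)), (fun=> 0).
  by exists A => _ [phi Hf <-]; exact: HA.
pose S := sup E.
have leS phi : C1c Omega phi -> energy phi <= S.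
  by move=> Hf; apply: ub_le_sup; [exact: hE.2|exists phi].
(* Approaching the supremum at the rate 4^-n provides the rate that [riesz_fischer] requires. *)
have /choice[F HF] n : exists phi, C1c Omega phi /\ S - 4^-1 ^+ n < energy phi.
  have e0 : (0 : R) < 4^-1 ^+ n by rewrite exprn_gt0.
  by have [_ [phi Hf <-] h] := sup_adherent e0 hE; exists phi.
have CF n := (HF n).1.
have fast k l : (k <= l)%N -> C1c Omega (fun x => F k x - F l x) /\
   Dir (fun x => F k x - F l x) (fun x => F k x - F l x) <= 4 / 4 ^+ k.
  move=> kl; have Hd : C1c Omega (fun x => F k x - F l x).
    by have := C1c_D (CF k) (C1c_Z (-1) (CF l)); under eq_fun do rewrite mulN1r.
  split => //.
  have e1 := energy_perturb (- 2^-1) (CF k) Hd.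
  have e2 := energy_perturb (-1) (CF k) Hd.
  have e3 : energy (fun x => F k x + -1 * (F k x - F l x)) = energy (F l).
    by congr energy; apply/funext => x; ring.
  have h1 := leS _ (C1c_D (CF k) (C1c_Z (- 2^-1) Hd)).
  rewrite -exprVn; apply: (@midpoint_bound S (energy (F k)) (energy (F l)) (ipO (fun x => F k x - F l x) (cst 1) - Dir (F k) (fun x => F k x - F l x)) _ _ _ _ _ (HF k).2 (HF l).2 (quarter_pow kl)).
    by rewrite -e1; exact: h1.
  by rewrite -e2; exact: e3.
have [m m0 Hm] := Dir_lower.
have Cm : 0 <= m * 4 by lra.
have bound k l (D : (R * R -> R) -> R * R -> R) :
  (forall phi, C1c Omega phi -> bmc (D phi) /\ I2 (fun x => D phi x ^+ 2) <= m * Dir phi phi) ->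
  (forall phi psi, C1c Omega phi -> C1c Omega psi -> forall x,
     D (fun x => phi x - psi x) x = D phi x - D psi x) -> (k <= l)%N ->
   (\int[@leb2 R]_x ((D (F k) x - D (F l) x) ^+ 2)%:E <= (m * 4 / 4 ^+ k)%:E)%E.
  move=> h1 h2 kl; have [Hd dd] := fast k l kl.
  under eq_integral do rewrite -h2//.
  have [bD ID] := h1 _ Hd; rewrite I2_fin; last exact: bmc_sq.
  rewrite lee_fin; apply: le_trans ID _; rewrite -[leRHS]mulrA ler_pM2l//.
have C1B phi psi : C1c Omega phi -> C1c Omega psi -> forall x,
    d1 (fun x => phi x - psi x) x = d1 phi x - d1 psi x /\
    d2 (fun x => phi x - psi x) x = d2 phi x - d2 psi x.
  move=> Hf Hg x; have [_ Ez] := C1_Z (-1) (C1c_C1 Hg).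
  have [_ Ed] := C1_D (C1c_C1 Hf) (C1c_C1 (C1c_Z (-1) Hg)).
  have := Ed x; have [-> ->] := Ez x; under eq_fun do rewrite mulN1r.
  by rewrite !mulN1r.
have mb f : bmc f -> measurable_fun (setT : set T2) f by case.
have sub_cvg (D : (R * R -> R) -> R * R -> R) :
  (forall phi, C1c Omega phi -> bmc (D phi) /\ I2 (fun x => D phi x ^+ 2) <= m * Dir phi phi) ->
  (forall phi psi, C1c Omega phi -> C1c Omega psi -> forall x,
     D (fun x => phi x - psi x) x = D phi x - D psi x) ->
  exists g, cvgL2 Omega (fun n => D (F n)) g.
  move=> h1 h2; have mD n := mb _ (h1 _ (CF n)).1.
  have [g mg hg] := riesz_fischer Cm mD (fun k l => bound k l D h1 h2).
  have mq n : measurable_fun (setT : set T2) (fun x => (D (F n) x - g x) ^+ 2).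
    by apply: measurable_funX; exact: measurable_funB.
  exists g; split; first exact: measurable_funTS.
  apply: (@squeeze_cvge _ _ _ _ (fun=> 0%E) _ (fun n => (m * 4 * 4^-1 ^+ n)%:E)).
  - apply: nearW => n; apply/andP; split.
      by apply: integral_ge0 => x _; exact: sq_gauss_ge0.
    rewrite exprVn; apply: le_trans (hg n).
    apply: (@le_trans _ _ (\int[@leb2 R]_(x in Omega) ((D (F n) x - g x) ^+ 2)%:E)%E).
      apply: ge0_le_integral => //.
      + by move=> x _; exact: sq_gauss_ge0.
      + apply/measurable_EFinP; apply: measurable_funM; first exact: measurable_funTS.
        by apply: measurable_funTS; exact: gauss_meas.
      + by apply/measurable_EFinP; exact: measurable_funTS.
      + by move=> x _; rewrite lee_fin ler_piMr ?sqr_ge0// gauss_le1.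
    apply: ge0_subset_integral => //; first exact/measurable_EFinP.
    by move=> x _; rewrite lee_fin sqr_ge0.
  - exact: cvg_cst.
  - apply: cvg_EFin; first exact: nearW.
    rewrite -[X in _ --> X](mulr0 (m * 4)); apply: cvgM; first exact: cvg_cst.
    by apply: cvg_expr; rewrite ger0_norm; lra.
have [|//|u hu] := sub_cvg id.
  by move=> phi Hf; split; [exact: (let: And3 h _ _ := C1c_bmc Hf in h)|have [] := Hm _ Hf].
have [||g1 hg1] := sub_cvg (@d1 R).
- by move=> phi Hf; split; [exact: (let: And3 _ h _ := C1c_bmc Hf in h)|have [] := Hm _ Hf].
- by move=> phi psi Hf Hg x; have [] := C1B _ _ Hf Hg x.
have [||g2 hg2] := sub_cvg (@d2 R).
- by move=> phi Hf; split; [exact: (let: And3 _ _ h := C1c_bmc Hf in h)|have [] := Hm _ Hf].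
- by move=> phi psi Hf Hg x; have [] := C1B _ _ Hf Hg x.
exists u, g1, g2; split; first by exists F; split.
move=> psi Hg; have [p0 p1 p2] := C1c_L2 Hg.
have l1 n : L2 Omega (d1 (F n)) by have [] := C1c_L2 (CF n).
have l2 n : L2 Omega (d2 (F n)) by have [] := C1c_L2 (CF n).
have L1 := cvgL2_L2 mO l1 hg1; have L2' := cvgL2_L2 mO l2 hg2.
transitivity (ipO g1 (d1 psi) + ipO g2 (d2 psi)).
  rewrite /ip -RintegralD//; [|exact: L2_int|exact: L2_int].
  by apply: eq_Rintegral => x _; rewrite /=; ring.
set I := _ + _; pose dl := ipO psi (cst 1) - I.
have cD : Dir (F n) psi @[n --> \oo] --> I.
  exact: (cvgD (cvgL2_ip mO l1 hg1 p1) (cvgL2_ip mO l2 hg2 p2)).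
(* First-order optimality in the limit: the energy of [F n] perturbed by [t] times [psi] stays below
   the supremum, which [F n] approaches. *)
have key (t : R) : 2 * t * dl <= t ^+ 2 * Dir psi psi.
  have c1 : (fun n : nat => 2 * t * (ipO psi (cst 1) - Dir (F n) psi) - (4^-1 : R) ^+ n) @ \oo -->
     2 * t * dl - 0.
    apply: cvgB; last by apply: cvg_expr; rewrite ger0_norm; lra.
    by apply: cvgM; [exact: cvg_cst|apply: cvgB => //; exact: cvg_cst].
  rewrite subr0 in c1; rewrite -(cvg_lim _ c1)//; apply: limr_le.
    by apply/cvg_ex; eexists; exact: c1.
  apply: nearW => n; have := leS _ (C1c_D (CF n) (C1c_Z t Hg)).
  rewrite (energy_perturb t (CF n) Hg); have := (HF n).2.
  move: (energy _) (Dir psi psi) (ipO _ _ - _) => e D p h1 h2; lra.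
have : dl = 0 by exact: quadratic_zero (Dir_ge0 psi) key.
by rewrite /dl => /eqP; rewrite subr_eq0 => /eqP <-; exact: ip1.
Qed.

(** The access to [torsion_fun]: by [torsion_exists] the chosen function is a genuine weak solution.
    It enters only through test functions [F n] approaching it and through its weak gradient. *)
Lemma Tgamma_weak : exists F : nat -> R * R -> R, exists g1 g2 : R * R -> R,
  [/\ forall n, C1c Omega (F n), L2 Omega g1 /\ L2 Omega g2,
   forall psi, C1c Omega psi -> ipO g1 (d1 psi) + ipO g2 (d2 psi) = ipO psi (cst 1),
   ipO (F n) (cst 1) @[n --> \oo] --> Tgamma Omega &
   forall h1 h2, L2 Omega h1 -> L2 Omega h2 ->
     ipO h1 (d1 (F n)) + ipO h2 (d2 (F n)) @[n --> \oo] --> ipO h1 g1 + ipO h2 g2].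
Proof.
have /xgetPex : exists u, [set u | is_torsion_fun Omega u] u by exact: torsion_exists.
move=> /(_ (cst 0)) [g1 [g2 [[F [CF cu c1 c2]] wk]]].
have l0 n : L2 Omega (F n) by have [] := C1c_L2 (CF n).
have l1 n : L2 Omega (d1 (F n)) by have [] := C1c_L2 (CF n).
have l2 n : L2 Omega (d2 (F n)) by have [] := C1c_L2 (CF n).
have L1 := cvgL2_L2 mO l1 c1; have L2' := cvgL2_L2 mO l2 c2.
exists F, g1, g2; split=> //.
- move=> psi Hf; have [p0 p1 p2] := C1c_L2 Hf; have wkp := wk psi Hf.
  apply: etrans (esym (ip1 Omega psi)); apply: etrans wkp; rewrite /ip -RintegralD//; [|exact: L2_int|exact: L2_int].
  by apply: eq_Rintegral => x _; rewrite /=; ring.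
- rewrite /Tgamma -/(torsion_fun Omega) -[X in _ --> X](ip1 Omega (torsion_fun Omega)).
  exact: (cvgL2_ip mO l0 cu one_L2).
- move=> h1 h2 H1 H2; rewrite (ipC _ h1 g1) (ipC _ h2 g2).
  under eq_fun do rewrite (ipC _ h1) (ipC _ h2).
  exact: (cvgD (cvgL2_ip mO l1 c1 H1) (cvgL2_ip mO l2 c2 H2)).
Qed.

(** Testing the weak form with [F n] shows that the rigidity is the squared norm of the weak
    gradient g. Then 2 <phi, 1> = 2 <g, grad phi>, and Young's inequality concludes. *)
Lemma Tgamma_energy phi : C1c Omega phi -> energy phi <= Tgamma Omega.
Proof.
move=> Hf; have [F [g1 [g2 [CF [G1 G2] wk cT cg]]]] := Tgamma_weak.
have [p0 p1 p2] := C1c_L2 Hf.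
have -> : Tgamma Omega = ipO g1 g1 + ipO g2 g2.
  apply: (@cvg_unique _ (@Rhausdorff R) _ _ _ _ cT).
  have -> : (fun n => ipO (F n) (cst 1)) = fun n => ipO g1 (d1 (F n)) + ipO g2 (d2 (F n)).
    by apply/funext => n; rewrite wk.
  exact: cg.
have y1 := ip_young mO 1 p1 G1; have y2 := ip_young mO 1 p2 G2.
rewrite /energy -wk// /Dir (ipC _ g1 (d1 phi)) (ipC _ g2 (d2 phi)).
move: y1 y2; move: (ipO (d1 phi) g1) (ipO (d2 phi) g2) (ipO (d1 phi) (d1 phi)) => a b c.
by move: (ipO (d2 phi) (d2 phi)) (ipO g1 g1) (ipO g2 g2) => d e k; lra.
Qed.

(** Tested with [F n], both fields give the rigidity T: T = |g|^2 and T = <V, g>. Young's inequality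
    2 <V, g> <= |V|^2 + |g|^2 then leaves T <= |V|^2. *)
Lemma Tgamma_dual V1 V2 : L2 Omega V1 -> L2 Omega V2 ->
  (forall phi, C1c Omega phi -> ipO V1 (d1 phi) + ipO V2 (d2 phi) = ipO phi (cst 1)) ->
  Tgamma Omega <= ipO V1 V1 + ipO V2 V2.
Proof.
move=> H1 H2 wV; have [F [g1 [g2 [CF [G1 G2] wk cT cg]]]] := Tgamma_weak.
have e1 : Tgamma Omega = ipO g1 g1 + ipO g2 g2.
  apply: (@cvg_unique _ (@Rhausdorff R) _ _ _ _ cT).
  have -> : (fun n => ipO (F n) (cst 1)) = fun n => ipO g1 (d1 (F n)) + ipO g2 (d2 (F n)).
    by apply/funext => n; rewrite wk.
  exact: cg.
have e2 : Tgamma Omega = ipO V1 g1 + ipO V2 g2.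
  apply: (@cvg_unique _ (@Rhausdorff R) _ _ _ _ cT).
  have -> : (fun n => ipO (F n) (cst 1)) = fun n => ipO V1 (d1 (F n)) + ipO V2 (d2 (F n)).
    by apply/funext => n; rewrite wV.
  exact: cg.
have := ip_young mO 1 H1 G1; have := ip_young mO 1 H2 G2; move: e1 e2.
move: (Tgamma Omega) (ipO V1 g1) (ipO V2 g2) (ipO V1 V1) (ipO V2 V2) => a b c d e.
by move: (ipO g1 g1) (ipO g2 g2) => k l; lra.
Qed.

End existence.
End torsion.

(** * The radial torsion function *)

Ltac cts := lazymatch goal with
  | |- continuous (fun x => (@?f x * @?g x)%R) => refine (@cts_mul _ _ f g _ _); cbn beta; cts
  | |- continuous (fun x => (@?f x + @?g x)%R) => refine (@cts_add _ _ f g _ _); cbn beta; cts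
  | |- continuous (fun x => (- @?f x)%R) => refine (@cts_opp _ _ f _); cbn beta; cts
  | |- continuous (fun x => (@?f x ^+ 2)%R) => refine (@cts_sqr _ _ f _); cbn beta; cts
  | |- continuous (fun x => x) => by move=> ?; exact: cvg_id
  | |- continuous (fun x => ?h x) => first [assumption | idtac]
  | |- continuous (fun x => ?h (@?f x)) =>
      first [by move=> ?; exact: cvg_cst | refine (@cts_comp _ _ _ h f _ _); cbn beta; [cts | first [assumption | idtac]]]
  | |- _ => first [assumption | by move=> ?; exact: cvg_cst | idtac]
  end.

Section radial_profile.
Context {R : realType}.
Notation mu := (@lebesgue_measure R).

(* [Dp = - u_2'], [Eg] is the radial gaussian weight, and the torsional rigidity
   of a disk is the integral of [kp]. *)
Definition qexp (s : R) : R := if s == 0 then 2^-1 else (expR (s / 2) - 1) / s.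
Definition Dp (s : R) : R := (expR (s ^+ 2 / 2) - 1) / s.
Definition Eg (s : R) : R := expR (- s ^+ 2 / 2).
Definition kp (s : R) : R := s * Dp s ^+ 2 * Eg s.

Lemma mul_qexp (s : R) : s * qexp s = expR (s / 2) - 1.
Proof.
rewrite /qexp; case: eqVneq => [->|s0]; first by rewrite !mul0r expR0 subrr.
by rewrite mulrC divfK.
Qed.

(** Makes - grad u_2 the field [qexp (|x|^2)] times x, continuous at the origin. At [s = 0] the
    identity relies on division by zero giving 0. *)
Lemma Dp_qexp (s : R) : Dp s = s * qexp (s ^+ 2).
Proof.
rewrite /Dp /qexp sqrf_eq0; case: eqVneq => [->|s0]; first by rewrite invr0 mulr0 mul0r.
by field.
Qed.

Lemma is_derive_expR_half (s : R) : is_derive s 1 (fun y : R => expR (y / 2)) (expR (s / 2) / 2).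
Proof.
have h : is_derive s 1 (fun y : R => y / 2) (2^-1).
  under eq_fun do rewrite mulrC.
  by apply: deq (derZ 2^-1 (derI s)) _; rewrite mulr1.
have k := @is_derive_expR R (s / 2).
exact: (@dercomp R expR (fun y : R => y / 2) s _ _ k h).
Qed.

Lemma qexp_cont : continuous qexp.
Proof.
move=> s; case: (eqVneq s 0) => [->|s0].
  have d := is_derive_expR_half 0.
  have := @ex_derive _ _ _ _ _ _ _ d; rewrite /derivable => dv.
  pose f (y : R) := expR (y / 2).
  have k : h^-1 *: ((f \o shift 0) (h *: 1) - f 0) @[h --> (0 : R)^'] --> 'D_1 f 0 := dv.
  have e := @derive_val _ _ _ _ _ _ _ d; rewrite mul0r expR0 mul1r in e; rewrite e in k.
  apply/continuous_withinNx.
  rewrite [X in _ --> X]/qexp eqxx; apply: cvg_trans k; apply: near_eq_cvg.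
  near=> h; have h0 : h != 0 by near: h; exact: nbhs_dnbhs_neq.
  by rewrite /qexp (negbTE h0) /f /= mul0r expR0 /GRing.scale/= mulr1 addr0 mulrC.
have c1 : {for s, continuous (fun y : R => (expR (y / 2) - 1) / y)}.
  apply: cvgM; last exact: cvgV.
  by apply: cvgB; [exact: is_derive_continuous (is_derive_expR_half s)|exact: cvg_cst].
rewrite /continuous_at {2}/qexp (negbTE s0); apply: cvg_trans c1; apply: near_eq_cvg.
have : nbhs s [set y : R | y != 0].
  by apply: open_nbhs_nbhs; split => //; exact: open_neq.
by apply: filterS => h /= h0; rewrite /qexp (negbTE h0).
Unshelve. all: by end_near. Qed.

Lemma qexp_ge0 (s : R) : 0 <= qexp s.
Proof.
rewrite /qexp; case: eqVneq => // s0.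
case: (ltP 0 s) => [s1|s1].
  by rewrite divr_ge0 ?(ltW s1)// subr_ge0 -[leLHS]expR0 ler_expR; lra.
rewrite -mulrNN; apply: mulr_ge0; first by rewrite opprB subr_ge0 -[leRHS]expR0 ler_expR; lra.
by rewrite -invrN invr_ge0; lra.
Qed.

Lemma qexp_le (s : R) : 0 <= s -> qexp s <= expR (s / 2).
Proof.
move=> s0; have [s1|s1] := ltP 0 s; last first.
  have -> : s = 0 by lra.
  by rewrite /qexp eqxx mul0r expR0; lra.
rewrite -(ler_pM2l s1) mul_qexp.
have h1 := expR_ge1Dx (- (s / 2)); have h2 := expR_gt0 (s / 2).
have : expR (s / 2) * (1 + - (s / 2)) <= 1.
  by rewrite -[leRHS](expRxMexpNx_1 (s / 2)) ler_pM2l.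
have : 0 <= s * expR (s / 2) by rewrite mulr_ge0// ltW.
lra.
Qed.

Lemma Dp_deriv (s : R) : is_derive s 1 Dp (expR (s ^+ 2 / 2) - qexp (s ^+ 2)).
Proof.
case: (eqVneq s 0) => [->|s0].
  rewrite expr0n mul0r expR0 /qexp eqxx.
  have k : h^-1 *: ((Dp \o shift 0) (h *: 1) - Dp 0) @[h --> (0 : R)^'] --> (2^-1 : R).
    have c : qexp (h ^+ 2) @[h --> (0 : R)^'] --> (2^-1 : R).
      have c1 : continuous (fun h : R => qexp (h ^+ 2)) by have e := qexp_cont; cts.
      have /continuous_withinNx := c1 0.
      by rewrite expr0n /qexp eqxx.
    apply: cvg_trans c; apply: near_eq_cvg; near=> h.
    have h0 : h != 0 by near: h; exact: nbhs_dnbhs_neq.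
    rewrite /= !Dp_qexp mul0r subr0 addr0 /GRing.scale/= mulr1.
    by rewrite mulrA mulVf// mul1r.
  have -> : 1 - 2^-1 = 2^-1 :> R by field.
  apply: DeriveDef; first by apply/cvg_ex; exists (2^-1).
  by apply: cvg_lim k.
have h2 : is_derive s 1 (fun y : R => y ^+ 2 / 2) s.
  under eq_fun do rewrite expr2 mulrC.
  by apply: deq (derZ 2^-1 (derM (derI s) (derI s))) _; field.
have h1 : is_derive s 1 (fun y : R => expR (y ^+ 2 / 2) - 1) (expR (s ^+ 2 / 2) * s).
  apply: deq (derB (dercomp (is_derive_expR _) h2) (derC 1 s)) _.
  by rewrite subr0.
have h3 : is_derive s 1 (fun y : R => y^-1) (- s ^- 2).
  by apply: deq (is_deriveV _ (derI s)) _ => //; rewrite /GRing.scale/= mulr1.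
apply: deq (derM h1 h3) _.
by rewrite /qexp sqrf_eq0 (negbTE s0); field.
Unshelve. all: by end_near. Qed.

Lemma Dp_cont : continuous Dp.
Proof. by move=> s; exact: is_derive_continuous (Dp_deriv s). Qed.

Lemma Eg_deriv (s : R) : is_derive s 1 Eg (- (s * Eg s)).
Proof.
have h2 : is_derive s 1 (fun y : R => - y ^+ 2 / 2) (- s).
  rewrite (_ : (fun y => _) = fun y => - 2^-1 * (y * y)); last by apply/funext => y; field.
  by apply: deq (derZ (- 2^-1) (derM (derI s) (derI s))) _; field.
by apply: deq (dercomp (is_derive_expR _) h2) _; rewrite /Eg; ring.
Qed.

Lemma Eg_cont : continuous Eg.
Proof. by move=> s; exact: is_derive_continuous (Eg_deriv s). Qed.

Lemma Eg_gt0 s : 0 < Eg s. Proof. exact: expR_gt0. Qed.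

Lemma Eg_le1 s : Eg s <= 1.
Proof. by rewrite -[leRHS]expR0 ler_expR; have := sqr_ge0 s; lra. Qed.

Lemma expR_Eg s : expR (s ^+ 2 / 2) * Eg s = 1.
Proof. by rewrite /Eg mulNr expRxMexpNx_1. Qed.

Lemma Dp_Eg s : s * Dp s * Eg s = 1 - Eg s.
Proof.
by rewrite Dp_qexp mulrA -expr2 mul_qexp mulrBl expR_Eg mul1r.
Qed.

Lemma Dp_ge0 s : 0 <= s -> 0 <= Dp s.
Proof. by move=> s0; rewrite Dp_qexp mulr_ge0// qexp_ge0. Qed.

Lemma Dp_gt0 s : 0 < s -> 0 < Dp s.
Proof.
by move=> s0; rewrite /Dp divr_gt0// subr_gt0 -[ltLHS]expR0 ltr_expR divr_gt0// exprn_gt0.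
Qed.

Lemma Dp_mono a b : 0 <= a -> a <= b -> Dp a <= Dp b.
Proof.
move=> a0; rewrite le_eqVlt => /predU1P[->//|ab].
have [c _ h] := MVT ab (fun x _ => Dp_deriv x) (@continuous_subspaceT _ _ _ _ Dp_cont).
rewrite -subr_ge0 h mulr_ge0//; last lra.
by rewrite subr_ge0 qexp_le// sqr_ge0.
Qed.

Lemma kpE s : kp s = (1 - Eg s) * Dp s.
Proof. by rewrite -Dp_Eg /kp; ring. Qed.

Lemma kp_ge0 s : 0 <= s -> 0 <= kp s.
Proof. by move=> s0; rewrite kpE mulr_ge0 ?Dp_ge0// subr_ge0 Eg_le1. Qed.

Lemma kp_mono a b : 0 <= a -> a <= b -> kp a <= kp b.
Proof.
move=> a0 ab; rewrite !kpE ler_pM ?Dp_ge0 ?Dp_mono ?subr_ge0 ?Eg_le1//.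
by rewrite lerD2l lerN2 /Eg ler_expR; nra.
Qed.

Lemma kp_cont : continuous kp.
Proof.
rewrite (_ : kp = fun s => (1 - Eg s) * Dp s); last by apply/funext => s; exact: kpE.
have c1 := Eg_cont; have c2 := Dp_cont; cts.
Qed.

(** Written in the form in which it combines with integration by parts in
    [torsion_integral_width]. *)
Lemma kp_deriv (s : R) : is_derive s 1 kp (2 * Dp s * s * Eg s - Dp s ^+ 2 * ((1 - s ^+ 2) * Eg s)).
Proof.
rewrite (_ : kp = fun s => (1 - Eg s) * Dp s); last by apply/funext => y; exact: kpE.
apply: deq (derM (derB (derC 1 s) (Eg_deriv s)) (Dp_deriv s)) _.
have h1 := expR_Eg s; have h2 := Dp_Eg s; have h3 := mul_qexp (s ^+ 2).
have h4 := Dp_qexp s.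
rewrite -h2 sub0r opprK h4.
set q := qexp _ in h3 *; set x := expR _ in h3 *; set e := Eg s.
have -> : x = s ^+ 2 * q + 1 by rewrite h3; ring.
ring.
Qed.

Lemma kp_lip (r : R) : 0 <= r -> exists2 C : R, 0 <= C &
  forall a, 0 <= a -> a <= r -> kp r - kp a <= C * (r - a).
Proof.
move=> r0; have D0 := Dp_ge0 r0; exists (2 * Dp r * r + Dp r ^+ 2 * r ^+ 2).
  by have h1 := sqr_ge0 (Dp r * r); nra.
move=> a a0; rewrite le_eqVlt => /predU1P[->|ar]; first by rewrite !subrr mulr0.
have [c /[!in_itv]/= /andP[ac cr] ->] := MVT ar (fun x _ => kp_deriv x) (@continuous_subspaceT _ _ _ _ kp_cont).
rewrite ler_wpM2r//; first lra.
have c0 : 0 <= c by lra.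
have e0 := Eg_gt0 c; have e1 := Eg_le1 c; have d0 := Dp_ge0 c0.
have d1 := Dp_mono c0 (ltW cr).
have p1 : Dp c * c <= Dp r * r by rewrite ler_pM// ltW.
have p2 : (Dp c * c) ^+ 2 <= (Dp r * r) ^+ 2 by have := mulr_ge0 d0 c0; nra.
have p0 : 0 <= Dp c * c by rewrite mulr_ge0.
have p3 : Dp c * c * Eg c <= Dp c * c by rewrite ler_piMr.
have p4 : (Dp c * c) ^+ 2 * Eg c <= (Dp c * c) ^+ 2 by rewrite ler_piMr ?sqr_ge0.
have p5 : 0 <= Dp c ^+ 2 * Eg c by rewrite mulr_ge0 ?sqr_ge0 ?ltW.
rewrite -exprMn.
have -> : 2 * Dp c * c * Eg c - Dp c ^+ 2 * ((1 - c ^+ 2) * Eg c) =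
  2 * (Dp c * c * Eg c) - Dp c ^+ 2 * Eg c + (Dp c * c) ^+ 2 * Eg c by ring.
lra.
Qed.

Section torsion_integrals.
Variables (G : R -> R) (rho : R).
Hypotheses (rho0 : 0 <= rho) (dG : forall s : R, is_derive s 1 G (- Dp s)) (Grho : G rho = 0).

(** [G] is u_2 - u_2(rho), the torsion function of the disk of radius [rho]. The identity is an
    integration by parts with [1 - Eg] as primitive of [s * Eg s]. *)
Lemma torsion_integral_area :
  \int[mu]_(s in `[0, rho]) ((2 * G s - Dp s ^+ 2) * (s * Eg s)) = \int[mu]_(s in `[0, rho]) kp s.
Proof.
have cG : continuous G by move=> s; exact: is_derive_continuous (dG s).
pose h s := (2 * G s - Dp s ^+ 2) * (s * Eg s) - kp s.
have c1 : continuous (fun s => (2 * G s - Dp s ^+ 2) * (s * Eg s)).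
  by have e1 := Eg_cont; have e2 := Dp_cont; cts.
have ch : continuous h := cts_add c1 (cts_opp kp_cont).
apply/eqP; rewrite -subr_eq0 -RintegralB//; [|exact: (integrable_cont 0 rho c1)|exact: (integrable_cont 0 rho kp_cont)].
have dF (s : R) : is_derive s 1 (fun s => 2 * G s * (1 - Eg s)) (h s).
  apply: deq (derM (derZ 2 (dG s)) (derB (derC 1 s) (Eg_deriv s))) _.
  by rewrite /h /kp -(Dp_Eg s); ring.
rewrite (Rint_FTC rho0 ch dF) Grho /Eg expr0n oppr0 mul0r expR0 subrr !mulr0 mul0r subrr.
by [].
Qed.

(** [s * Eg s] is a primitive of [(1 - s ^+ 2) * Eg s]. Only the boundary term at [rho] survives,
    and it is the source of the constant c_R. *)
Lemma torsion_integral_width :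
  \int[mu]_(s in `[0, rho]) ((2 * G s - Dp s ^+ 2) * ((1 - s ^+ 2) * Eg s)) = kp rho.
Proof.
have cG : continuous G by move=> s; exact: is_derive_continuous (dG s).
have c0 : continuous (fun s : R => s) by move=> x; exact: cvg_id.
have c1 : continuous (fun s => (2 * G s - Dp s ^+ 2) * ((1 - s ^+ 2) * Eg s)).
  by have e1 := Eg_cont; have e2 := Dp_cont; cts.
have dF (s : R) : is_derive s 1 (fun s => 2 * (G s * (s * Eg s)) + kp s)
    ((2 * G s - Dp s ^+ 2) * ((1 - s ^+ 2) * Eg s)).
  apply: deq (derD (derZ 2 (derM (dG s) (derM (derI s) (Eg_deriv s)))) (kp_deriv s)) _.
  ring.
by rewrite (Rint_FTC rho0 c1 dF) Grho /kp !mul0r !mulr0; ring.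
Qed.

End torsion_integrals.
End radial_profile.

(** * Piecewise linear cut-off *)

Section cutoff.
Context {R : realType}.

Definition cutoff (a d s : R) : R := Num.max 0 (1 - Num.max 0 ((s - a) / d)).

Lemma cutoff_ge0 a d s : 0 <= cutoff a d s.
Proof. by rewrite le_max lexx. Qed.

Lemma cutoff_le1 a d s : cutoff a d s <= 1.
Proof. by rewrite ge_max ler01 /= gerBl le_max lexx. Qed.

Lemma cutoff1 a d s : 0 < d -> s <= a -> cutoff a d s = 1.
Proof.
move=> d0 sa; have h : (s - a) / d <= 0 by rewrite ler_pdivrMr// mul0r; lra.
by rewrite /cutoff (max_idPl h) subr0; apply/max_idPr.
Qed.

Lemma cutoff0 a d s : 0 < d -> a + d <= s -> cutoff a d s = 0.
Proof.
move=> d0 sa; apply/max_idPl; rewrite subr_le0 le_max ler_pdivlMr// mul1r.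
by apply/orP; right; lra.
Qed.

Lemma cutoff_cont a d : continuous (cutoff a d).
Proof.
apply: cts_max; first by move=> ?; exact: cvg_cst.
apply: cts_add; first by move=> ?; exact: cvg_cst.
apply: cts_opp; apply: cts_max; first by move=> ?; exact: cvg_cst.
by cts.
Qed.
End cutoff.

(** * Radial integrals and the torsion of disks *)

Section steiner_profile.
Context {R : realType}.
Notation mu := (@lebesgue_measure R).
Notation T2 := (measurableTypeR R * measurableTypeR R)%type.

(** The exempted point will be s = 0, where the quotients s / max (1 / n, s) stay at 0 instead of
    tending to 1. *)
Lemma Rint_dct (f : nat -> R -> R) (g h : R -> R) (a b z : R) :
  (forall n, continuous (f n)) -> continuous g -> continuous h ->
  (forall n x, a <= x <= b -> `|f n x| <= h x) ->
  (forall x, a <= x <= b -> x != z -> f ^~ x @ \oo --> g x) ->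
  \int[mu]_(x in `[a, b]) f n x @[n --> \oo] --> \int[mu]_(x in `[a, b]) g x.
Proof.
move=> cf cg ch fh fg.
have mc (k : R -> R) : continuous k -> measurable_fun (`[a, b] : set (measurableTypeR R)) (EFin \o k).
  move=> ck; apply/measurable_EFinP; apply: measurable_funTS; exact: continuous_measurable_fun.
have [|||||_ _ cv] := @dominated_convergence _ _ _ mu `[a, b]%classic (measurable_itv _)
  (fun n x => (f n x)%:E) (fun x => (g x)%:E) (fun x => (h x)%:E).
- by move=> n; exact: mc.
- exact: mc.
- exists [set z]; split; [exact: measurable_set1|exact: lebesgue_measure_set1|].
  move=> x /= nx; apply: contrapT => xz; apply: nx; rewrite /= in_itv/= => xab.
  by apply: cvg_EFin; [exact: nearW|apply: fg => //; exact/eqP].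
- exact: integrable_cont.
- by apply: aeW => x n; rewrite /= in_itv/= => xab; rewrite lee_fin; exact: fh.
have fin (k : R -> R) : continuous k ->
    (\int[mu]_(x in `[a, b]) (k x)%:E)%E = (\int[mu]_(x in `[a, b]) k x)%:E.
  by move=> ck; rewrite /Rintegral fineK//; apply: integrable_fin_num => //; exact: integrable_cont.
move: cv; rewrite (fin g cg) (_ : (fun n => _) = (fun n => (\int[mu]_(x in `[a, b]) f n x)%:E)); last first.
  by apply/funext => n; rewrite /= fin.
by move=> /fine_cvgP[].
Qed.

Lemma ge_sqrt (M s : R) : 0 < M -> M ^+ 2 <= s -> M <= Num.sqrt s.
Proof.
move=> M0 Ms; rewrite -(ger0_norm (ltW M0)) -sqrtr_sqr ler_sqrt//.
by rewrite (le_trans _ Ms)// sqr_ge0.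
Qed.

Lemma dist_cont (K : set (R * R)) : ccn K -> continuous (fun x => enorm (resid K x)).
Proof. by move=> cK; exact: (cts_comp (sqd_cont cK) (@sqrt_continuous R)). Qed.

Lemma dist_profile_bmc (f : R -> R) (M L : R) (K : set (R * R)) : 0 < M -> continuous f ->
  (forall s, M <= s -> f s = 0) -> ccn K -> K `<=` box L ->
  bmc (fun x => f (enorm (resid K x))) /\
  forall x, f (enorm (resid K x)) != 0 -> box (L + M) x.
Proof.
move=> M0 cf fM cK KL.
have h x : f (enorm (resid K x)) != 0 -> box (L + M) x.
  apply: (@sqd_far _ (fun s => f (Num.sqrt s)) _ M0 _ _ L cK KL) => s Ms.
  by apply: fM; exact: ge_sqrt.
split => //; exact: (bmc_continuous (cts_comp (dist_cont cK) cf) h).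
Qed.

(* [steiner] applied to [b s = f (sqrt s) / (2 max(sqrt s, n^-1))], which is
   continuous at 0, then [n -> oo]. *)
Lemma steiner_profile_ge0 (f : R -> R) (M : R) K : continuous f -> 0 < M ->
  (forall s, M <= s -> f s = 0) -> (forall s, 0 <= f s) -> ccn K ->
  I2 (fun x => f (enorm (resid K x)) * \1_(~` K) x) =
  \int[mu]_(s in `[0, M]) (f s * (mwidth K + 2 * pi * s)).
Proof.
move=> cf M0 fM f0 cK; have K_c : compact K by case: cK.
have mK : measurable (~` K : set T2) by apply: measurableC; exact: compact_measurable2.
pose e n : R := (n.+1%:R)^-1; have e0 n : 0 < e n by rewrite invr_gt0.
pose m n (s : R) := Num.max (e n) s.
have m0 n s : 0 < m n s by rewrite lt_max e0.
have cm n : continuous (m n) by apply: cts_max; [exact: cts_cst|move=> x; exact: cvg_id].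
have cmV n : continuous (fun s => (m n s)^-1).
  by move=> x; apply: cvgV; [rewrite gt_eqF|exact: cm].
have csq : continuous (@Num.sqrt R) := @sqrt_continuous R.
pose b n (s : R) := f (Num.sqrt s) * (2^-1 * (m n (Num.sqrt s))^-1).
have cb n : continuous (b n).
  have c1 : continuous (fun s => (m n (Num.sqrt s))^-1) := cts_comp csq (cmV n).
  refine (cts_mul (cts_comp csq cf) (cts_mul _ c1)).
  by move=> ?; exact: cvg_cst.
have b0 n s : 0 <= b n s by rewrite !mulr_ge0// ?invr_ge0 ?ltW.
have bM n s : M ^+ 2 <= s -> b n s = 0.
  by move=> Ms; rewrite /b fM ?mul0r//; exact: ge_sqrt.
have st n := steiner (cb n) (b0 n) M0 (bM n) cK.
set W := fun s : R => mwidth K + 2 * pi * s.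
have cW : continuous W by rewrite /W; cts.
pose d x := enorm (resid K x).
have d0 x : 0 <= d x by exact: enorm_ge0.
have cd : continuous d := dist_cont cK.
have [L L0 KL] := compact_box K_c.
have [bf fL] := dist_profile_bmc M0 cf fM cK KL.
have h1 (n : nat) (s : R) : 0 <= s -> 0 <= s / m n s <= 1.
  move=> s0; rewrite divr_ge0 ?(ltW (m0 n s))//= ler_pdivrMr// mul1r.
  by rewrite /m le_max lexx orbT.
have lim (s : R) : 0 < s -> s / m n s @[n --> \oo] --> (1 : R).
  move=> s0; have [N _ hN] : \forall n \near \oo, e n < s.
    exact: (near_infty_natSinv_lt (PosNum s0)).
  apply: cvg_near_cst.
  exists N => // n /= /hN en; rewrite /m (max_idPr (ltW en)) divff//; exact: lt0r_neq0.
have inK x : d x = 0 <-> K x.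
  split=> [dx|Kx]; first by apply: (sqd0_in cK); rewrite /sqd -enormE -/(d x) dx expr0n.
  by rewrite /d /enorm -/(sqd K x) (sqd_in cK Kx) sqrtr0.
have cv1 : I2 (fun x => 2 * b n (sqd K x) * enorm (resid K x)) @[n --> \oo] -->
    I2 (fun x => f (d x) * \1_(~` K) x).
  (* The quotient d / m is 0 on [K] and tends to 1 off [K]: this produces the indicator. *)
  have E n x : 2 * b n (sqd K x) * d x = f (d x) * (d x / m n (d x)).
    by rewrite /b -/(enorm (resid K x)) -/(d x); field; exact: lt0r_neq0.
  apply: (@I2_dct _ (fun n x => 2 * b n (sqd K x) * d x) _ (fun x => f (d x))) => //.
  - move=> n; apply: (@bmc_continuous _ _ (L + M)).
      under eq_fun do rewrite E.
      exact: (cts_mul (cts_comp cd cf) (cts_mul cd (cts_comp cd (cmV n)))).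
    by move=> x h; apply: fL; apply: contra_neq h; rewrite E => ->; rewrite mul0r.
  - exact: bmc_indic.
  - move=> n x; rewrite E ger0_norm; last by rewrite mulr_ge0//; case/andP: (h1 n _ (d0 x)).
    by rewrite ler_piMr//; case/andP: (h1 n _ (d0 x)).
  - move=> x; under eq_fun do rewrite E; apply: cvgM; first exact: cvg_cst.
    rewrite indicE; have [Kx|Kx] := pselect (K x).
      rewrite memNset; last by apply.
      by rewrite (proj2 (inK x) Kx); under eq_fun do rewrite mul0r; exact: cvg_cst.
    rewrite mem_set//; apply: lim; rewrite lt_neqAle d0 andbT eq_sym.
    by apply/eqP => /inK.
have cv2 : \int[mu]_(s in `[0, M]) (2 * s * b n (s ^+ 2) * W s) @[n --> \oo] -->
    \int[mu]_(s in `[0, M]) (f s * W s).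
  have E n s : 0 <= s -> 2 * s * b n (s ^+ 2) * W s = f s * W s * (s / m n s).
    by move=> s0; rewrite /b sqrtr_sqr ger0_norm//; field; exact: lt0r_neq0.
  apply: (@Rint_dct _ _ (fun s => `|f s * W s|) 0 M 0).
  - by move=> n; have c1 := cb n; cts.
  - by cts.
  - by move=> x; apply: cvg_norm; exact: (cts_mul cf cW).
  - move=> n s /andP[s0 _]; rewrite E// normrM ler_piMr//.
    by have /andP[a1 a2] := h1 n s s0; rewrite ger0_norm.
  - move=> s /andP[s0 _] sn0.
    have k : f s * W s * (s / m n s) @[n --> \oo] --> f s * W s * 1.
      apply: cvgM; first exact: cvg_cst.
      by apply: lim; rewrite lt_neqAle eq_sym sn0.
    by rewrite mulr1 in k; under eq_fun do rewrite E//; exact: k.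
have Est : (fun n => I2 (fun x => 2 * b n (sqd K x) * enorm (resid K x))) =
   (fun n => \int[mu]_(s in `[0, M]) (2 * s * b n (s ^+ 2) * W s)) by apply/funext => n; exact: st.
by rewrite Est in cv1; apply: (@cvg_unique _ (@Rhausdorff R) _ _ _ _ cv1).
Qed.

(** Both sides are linear in [f], which is split into its positive and negative parts. *)
Lemma steiner_profile (f : R -> R) (M : R) K : continuous f -> 0 < M ->
  (forall s, M <= s -> f s = 0) -> ccn K ->
  I2 (fun x => f (enorm (resid K x)) * \1_(~` K) x) =
  \int[mu]_(s in `[0, M]) (f s * (mwidth K + 2 * pi * s)).
Proof.
move=> cf M0 fM cK; have K_c : compact K by case: cK.
pose p s := Num.max (f s) 0; pose q s := Num.max (- f s) 0.
have pq s : f s = p s - q s by rewrite /p /q; case: (leP (f s) 0) => h; case: leP; lra.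
have cp : continuous p by apply: cts_max => //; exact: cts_cst.
have cq : continuous q by apply: cts_max; [exact: cts_opp|exact: cts_cst].
have cW : continuous (fun s : R => mwidth K + 2 * pi * s) by cts.
have [L L0 KL] := compact_box K_c.
have bk (k : R -> R) : continuous k -> (forall s, M <= s -> k s = 0) ->
    bmc (fun x => k (enorm (resid K x)) * \1_(~` K) x).
  move=> ck kM; apply: bmc_indic; first by apply: measurableC; exact: compact_measurable2.
  by have [] := dist_profile_bmc M0 ck kM cK KL.
have pM s : M <= s -> p s = 0 by move=> /fM; rewrite /p => ->; rewrite maxxx.
have qM s : M <= s -> q s = 0 by move=> /fM; rewrite /q => ->; rewrite oppr0 maxxx.
have p0 s : 0 <= p s by rewrite le_max lexx orbT.
have q0 s : 0 <= q s by rewrite le_max lexx orbT.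
under eq_fun do rewrite pq mulrBl.
rewrite I2B; [|exact: bk|exact: bk].
rewrite (steiner_profile_ge0 cp M0 pM p0 cK) (steiner_profile_ge0 cq M0 qM q0 cK).
rewrite -RintegralB//; [|exact: (integrable_cont 0 M (cts_mul cp cW))|exact: (integrable_cont 0 M (cts_mul cq cW))].
by apply: eq_Rintegral => s _; rewrite pq mulrBl.
Qed.

End steiner_profile.

(** * Upper bound for the torsion of a disk *)

Section disk_torsion.
Context {R : realType}.
Notation mu := (@lebesgue_measure R).
Notation T2 := (measurableTypeR R * measurableTypeR R)%type.

Definition sq (x : R * R) : R := dotp x x.

Lemma sq_cont : continuous sq.
Proof. exact: (dotp_cont (@cts_id2 R) (@cts_id2 R)). Qed.

Lemma disk0 (x : R * R) : disk 0 x <-> x = 0.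
Proof.
rewrite /disk /=; split=> [h|->]; last by rewrite /enorm /dotp /= mul0r addr0 sqrtr0.
by apply: dotp_eq0; rewrite -enormE; have -> : enorm x = 0 by [apply/le_anti; rewrite h enorm_ge0]; rewrite expr0n.
Qed.

(** With the point [disk 0] as body, [steiner_profile] becomes integration in polar coordinates. *)
Lemma resid_disk0 (x : R * R) : resid (disk 0) x = x.
Proof.
have cK := @disk_ccn R 0 (lexx 0).
by have [/disk0 h _] := projP x cK; rewrite /resid h subr0.
Qed.

Lemma sqd_disk0 (x : R * R) : sqd (disk 0) x = sq x.
Proof. by rewrite /sqd resid_disk0. Qed.

Lemma leb2_origin : @leb2 R (disk 0) = 0%E.
Proof.
have -> : disk 0 = [set (0 : R)] `*` [set (0 : R)].
  apply/seteqP; split => [x /disk0->//|[a b] [/= -> ->]]; exact/disk0.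
rewrite /leb2 product_measure1E; [|exact: measurable_set1|exact: measurable_set1].
by rewrite [X in (X * _)%E]lebesgue_measure_set1 mul0e.
Qed.

Lemma measurable_disk0 : measurable (disk 0 : set T2).
Proof. by apply: compact_measurable2; case: (@disk_ccn R 0 (lexx 0)). Qed.

Lemma I2_off_origin (f : R * R -> R) : bmc f -> I2 (fun x => f x * \1_(~` disk 0) x) = I2 f.
Proof.
move=> bf; have mD := measurable_disk0.
have b1 : bmc (fun x => f x * \1_(disk 0) x) by exact: bmc_indic.
have b2 : bmc (fun x => f x * \1_(~` disk 0) x) by apply: bmc_indic => //; exact: measurableC.
have z : I2 (fun x => f x * \1_(disk 0) x) = 0.
  rewrite -I2_mkcond /Rintegral null_set_integral//; last exact: leb2_origin.
  by apply/measurable_EFinP; apply: measurable_funTS; exact: bf.1.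
have e := I2D b2 b1; rewrite z addr0 in e; rewrite -e; congr (I2 _); apply/funext => x.
by rewrite !indicE in_setC; case: (x \in disk 0); rewrite /= ?mulr0 ?mulr1 ?addr0 ?add0r.
Qed.

Lemma sq_grad x : grad sq x (2 *: x).
Proof.
have := sqd_grad x (@disk_ccn R 0 (lexx 0)); rewrite resid_disk0.
by rewrite (_ : sqd (disk 0) = sq)//; apply/funext => y; rewrite sqd_disk0.
Qed.

Lemma exp_half_le1 (s : R) : 0 <= s -> expR (- s / 2) <= 1.
Proof. by move=> s0; rewrite -[leRHS]expR0 ler_expR; lra. Qed.

Lemma qexp_expN (s : R) : s * (qexp s * expR (- s / 2)) = 1 - expR (- s / 2).
Proof. by rewrite mulrA mul_qexp mulrBl mul1r mulNr expRxMexpNx_1. Qed.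

Lemma qexp_expN_le1 (s : R) : 0 <= s -> 0 <= qexp s * expR (- s / 2) <= 1.
Proof.
move=> s0; rewrite mulr_ge0 ?qexp_ge0 ?expR_ge0//=.
have := qexp_le s0; rewrite -(ler_pM2r (expR_gt0 (- s / 2))).
by rewrite mulNr expRxMexpNx_1.
Qed.

(* [x (1 - e^{-|x|^2/2}) / (|x|^2 + e)] is a C^1 regularization of
   [- 2 pi gauss . grad u_2], whose divergence tends to [e^{-|x|^2/2}] off the
   origin. *)
Lemma gauss_field_weak phi Omega : C1c Omega phi ->
  I2 (fun x => - (qexp (sq x) * expR (- sq x / 2)) * (x.1 * d1 phi x + x.2 * d2 phi x)) =
  I2 (fun x => phi x * expR (- sq x / 2)).
Proof.
move=> Hf; have [bf b1 b2] := C1c_bmc Hf; have csq := sq_cont.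
have mD := measurable_disk0.
have [Cx Ex] := @C1_fst R; have [Cy Ey] := @C1_snd R.
have cx := C1_continuous Cx; have cy := C1_continuous Cy.
pose ex x := expR (- sq x / 2).
have cex : continuous ex.
  apply: cts_expR_comp; exact: (cts_mul (cts_opp csq) (@cts_cst _ _ 2^-1)).
pose e n : R := (n.+1%:R)^-1; have e0 n : 0 < e n by rewrite invr_gt0.
have s0 x : 0 <= sq x by exact: dotp_ge0.
have se n x : 0 < sq x + e n by have := s0 x; have := e0 n; lra.
(* The relative defect of the regularization: it tends to 0 off the origin and equals 1 there. *)
pose w n x := e n / (sq x + e n).
pose p n (s : R) := (1 - expR (- s / 2)) / (s + e n).
pose p' n (s : R) := expR (- s / 2) / 2 / (s + e n) - (1 - expR (- s / 2)) * (s + e n)^-1 ^+ 2.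
have dp n (s : R) : 0 <= s -> is_derive s 1 (p n) (p' n s).
  move=> s1; have h : s + e n != 0 by have := e0 n; lra.
  have h1 : is_derive s 1 (fun y : R => expR (- y / 2)) (expR (- s / 2) * - 2^-1).
    have h2 : is_derive s 1 (fun y : R => - y / 2) (- 2^-1).
      rewrite (_ : (fun y => _) = fun y => - 2^-1 * y); last by apply/funext => y; field.
      by apply: deq (derZ (- 2^-1) (derI s)) _; rewrite mulr1.
    exact: (@dercomp R expR (fun y : R => - y / 2) s _ _ (@is_derive_expR R _) h2).
  have h3 : is_derive s 1 (fun y : R => (y + e n)^-1) (- (s + e n) ^- 2).
    have h4 := derD (derI s) (derC (e n) s).
    apply: deq (@is_deriveV R (fun y => y + e n) s _ 1 h h4) _.
    by rewrite addr0 /GRing.scale/= mulr1.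
  apply: deq (derM (derB (derC 1 s) h1) h3) _; rewrite /p'; field.
  exact: h.
have csev n : continuous (fun x => (sq x + e n)^-1).
  move=> x; apply: cvgV; first by rewrite gt_eqF.
  by apply: cvgD; [exact: csq|exact: cvg_cst].
have cp n : continuous (fun x => p n (sq x)).
  exact: (cts_mul (cts_add (@cts_cst _ _ 1) (cts_opp cex)) (csev n)).
have cp' n : continuous (fun x => p' n (sq x)).
  apply: cts_add.
    exact: (cts_mul (cts_mul cex (@cts_cst _ _ 2^-1)) (csev n)).
  apply: cts_opp; apply: cts_mul; last exact: (cts_sqr (csev n)).
  exact: (cts_add (@cts_cst _ _ 1) (cts_opp cex)).
have Ep n : C1 (fun x => p n (sq x)) /\ forall x,
   (d1 (fun x => p n (sq x)) x, d2 (fun x => p n (sq x)) x) =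
   (2 * p' n (sq x) * x.1, 2 * p' n (sq x) * x.2).
  apply: C1_intro.
    move=> x; apply: (grad_eq (grad_comp (sq_grad x) (dp n _ (s0 x)))).
    by apply/pair_equal_spec; split; rewrite /= /GRing.scale/=; ring.
  have c2 := cts_mul (@cts_cst _ _ 2) (cp' n).
  exact: (continuous_pair (cts_mul c2 cx) (cts_mul c2 cy)).
pose a x := qexp (sq x) * ex x.
have sa x : sq x * a x = 1 - ex x by exact: qexp_expN.
have a01 x : 0 <= a x <= 1 by exact: qexp_expN_le1.
have ex01 x : 0 <= ex x <= 1 by rewrite expR_ge0 exp_half_le1.
have w01 n x : 0 <= w n x <= 1.
  rewrite divr_ge0 ?(ltW (e0 n)) ?(ltW (se n x))//= ler_pdivrMr// mul1r lerDr//.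
have pE n x : p n (sq x) = a x * (1 - w n x).
  rewrite /p -/(ex x) -sa /w; field; exact: lt0r_neq0.
have wlim x : ~ disk 0 x -> w n x @[n --> \oo] --> (0 : R).
  move=> nx; have sx : sq x != 0 by apply/eqP => h; apply: nx; apply/disk0; exact: dotp_eq0.
  have k : e n / (sq x + e n) @[n --> \oo] --> (0 : R) / (sq x + 0).
    apply: cvgM; first exact: cvg_harmonic.
    apply: cvgV; first by rewrite addr0.
    by apply: cvgD; [exact: cvg_cst|exact: cvg_harmonic].
  by rewrite mul0r in k.
have w0 n x : disk 0 x -> w n x = 1.
  by move=> /disk0 ->; rewrite /w /sq /dotp /= mul0r !add0r divff// lt0r_neq0.
pose y x := d1 phi x * x.1 + d2 phi x * x.2.
have by_ : bmc y by apply: bmcD; apply: bmc_cont.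
(* The divergence of the regularized field. It stays between 0 and 3, which allows dominated
   convergence. *)
pose dv n x := 2 * a x * (1 - w n x) * w n x + ex x * (1 - w n x).
have key n : I2 (fun x => phi x * dv n x) = - I2 (fun x => y x * p n (sq x)) /\
    continuous (fun x => dv n x).
  have [C_1 E1] := C1_M Cx (Ep n).1; have [C_2 E2] := C1_M Cy (Ep n).1.
  have dE x : d1 (fun x => x.1 * p n (sq x)) x + d2 (fun x => x.2 * p n (sq x)) x = dv n x.
    have [-> _] := E1 x; have [_ ->] := E2 x; have [[-> ->]] := (Ep n).2 x.
    have [-> _] := Ex x; have [_ ->] := Ey x.
    have sE : sq x = x.1 * x.1 + x.2 * x.2 by [].
    have -> : x.1 * (2 * p' n (sq x) * x.1) + 1 * p n (sq x) +
      (x.2 * (2 * p' n (sq x) * x.2) + 1 * p n (sq x)) = 2 * p n (sq x) + 2 * sq x * p' n (sq x).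
      by rewrite sE; ring.
    have h := lt0r_neq0 (se n x).
    rewrite pE /dv /p' -/(ex x) -sa.
    have -> : 1 - w n x = sq x / (sq x + e n) by rewrite /w; field.
    by rewrite /w; field.
  have [_ c11 _] := C_1; have [_ _ c22] := C_2.
  split; last by under eq_fun do rewrite -dE; exact: cts_add.
  have := div_by_parts Hf C_1 C_2; under eq_fun do rewrite dE; move=> ->.
  by congr (- I2 _); apply/funext => x; rewrite /y; ring.
have l1 : I2 (fun x => phi x * dv n x) @[n --> \oo] -->
    I2 (fun x => phi x * ex x * \1_(~` disk 0) x).
  have bpe : bmc (fun x => phi x * ex x) by exact: bmc_cont.
  apply: (@I2_dct _ _ _ (fun x => 3 * `|phi x|)).
  - by move=> n; apply: bmc_cont => //; have [] := key n.
  - by apply: bmc_indic => //; exact: measurableC.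
  - by apply: bmcZ; exact: bmc_norm.
  - move=> n x; rewrite normrM mulrC ler_wpM2r//.
    have /andP[a0 a1] := a01 x; have /andP[u0 u1] := ex01 x; have /andP[v0 v1] := w01 n x.
    have v2 : 0 <= 1 - w n x by lra.
    have t0 : 0 <= (1 - w n x) * w n x by rewrite mulr_ge0.
    have t1 : (1 - w n x) * w n x <= 1 by rewrite mulr_ile1//; lra.
    have t2 : 0 <= a x * ((1 - w n x) * w n x) by rewrite mulr_ge0.
    have t3 : a x * ((1 - w n x) * w n x) <= 1 by rewrite mulr_ile1.
    have t4 : 0 <= ex x * (1 - w n x) by rewrite mulr_ge0.
    have t5 : ex x * (1 - w n x) <= 1 by rewrite mulr_ile1//; lra.
    have -> : dv n x = 2 * (a x * ((1 - w n x) * w n x)) + ex x * (1 - w n x) by rewrite /dv; ring.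
    rewrite ger0_norm; lra.
  - move=> x; rewrite -mulrA; apply: cvgM; first exact: cvg_cst.
    have [dx|dx] := pselect (disk 0 x).
      rewrite indicE memNset; last by apply.
      rewrite mulr0 /dv; under eq_fun do rewrite w0// subrr !(mulr0, mul0r) addr0.
      exact: cvg_cst.
    rewrite indicE mem_set// /dv; have wl := wlim x dx.
    have k : 2 * a x * (1 - w n x) * w n x + ex x * (1 - w n x) @[n --> \oo] -->
       2 * a x * (1 - 0) * 0 + ex x * (1 - 0).
      have l0 : 1 - w n x @[n --> \oo] --> (1 - 0 : R) by apply: cvgB; [exact: cvg_cst|exact: wl].
      apply: cvgD; apply: cvgM => //; last exact: cvg_cst.
      by apply: cvgM => //; exact: cvg_cst.
    by rewrite subr0 mulr0 add0r in k.
have l2 : I2 (fun x => y x * p n (sq x)) @[n --> \oo] --> I2 (fun x => y x * a x).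
  have ca : continuous a.
    exact: (cts_mul (cts_comp csq (@qexp_cont R)) cex).
  apply: (@I2_dct _ _ _ (fun x => `|y x|)).
  - by move=> n; apply: bmc_cont.
  - exact: bmc_cont.
  - exact: bmc_norm.
  - move=> n x; rewrite normrM ler_piMr// pE.
    have /andP[a0 a1] := a01 x; have /andP[v0 v1] := w01 n x.
    have v2 : 0 <= 1 - w n x by lra.
    have t5 : a x * (1 - w n x) <= 1 by rewrite mulr_ile1//; lra.
    by rewrite (ger0_norm (mulr_ge0 a0 v2)).
  - move=> x; have [/disk0 ->|dx] := pselect (disk 0 x).
      by rewrite /y /= !mulr0 addr0 mul0r; under eq_fun do rewrite mul0r; exact: cvg_cst.
    apply: cvgM; first exact: cvg_cst.
    under eq_fun do rewrite pE.
    have k : a x * (1 - w n x) @[n --> \oo] --> a x * (1 - 0).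
      apply: cvgM; first exact: cvg_cst.
      by apply: cvgB; [exact: cvg_cst|exact: wlim].
    by rewrite subr0 mulr1 in k.
have e1 : I2 (fun x => phi x * ex x * \1_(~` disk 0) x) = - I2 (fun x => y x * a x).
  have E : (fun n => I2 (fun x => phi x * dv n x)) = (fun n => - I2 (fun x => y x * p n (sq x))).
    by apply/funext => n; have [] := key n.
  rewrite E in l1; apply: (@cvg_unique _ (@Rhausdorff R) _ _ _ _ l1).
  by apply: cvgN.
rewrite I2_off_origin in e1; last exact: bmc_cont.
rewrite [RHS]e1 -I2N; last by apply: bmc_cont => //; exact: (cts_mul (cts_comp csq (@qexp_cont R)) cex).
by congr (I2 _); apply/funext => x; rewrite /y /a -/(ex x); ring.
Qed.

Lemma cont_L2 (Omega : set (R * R)) (L : R) (f : R * R -> R) : measurable (Omega : set T2) ->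
  Omega `<=` box L -> continuous f -> L2 Omega f.
Proof.
move=> mO OL cf; have [_ h] := bmc_L2 mO (bmc_cont (bmc_box L) cf); split.
  by apply: measurable_funTS; exact: continuous_measurable2.
apply: le_lt_trans h; rewrite le_eqVlt; apply/orP; left; apply/eqP.
by apply: eq_integral => x /set_mem/OL xL; rewrite indicE mem_set// mul1r.
Qed.

Lemma gauss_sq (x : R * R) : gauss x = (2 * pi)^-1 * expR (- sq x / 2).
Proof. exact: gaussE. Qed.

Lemma disk_box (r : R) : disk r `<=` box r.
Proof.
move=> x xr; have r0 : 0 <= r by apply: le_trans xr; exact: enorm_ge0.
have [h1 h2] := dotp_normle x; have := enormE x.
have : enorm x ^+ 2 <= r ^+ 2 by rewrite ler_pXn2r ?nnegrE ?enorm_ge0.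
by move=> h3 h4; apply/in_box; split; rewrite -(@ler_pXn2r _ 2) ?nnegrE//; lra.
Qed.

(* The field [grad u_2] is admissible in [Tgamma_dual]. *)
Lemma Tgamma_disk_le (r : R) : 0 < r ->
  Tgamma_body (disk r) <= \int[mu]_(s in `[0, r]) kp s.
Proof.
move=> r0; set O := (disk r)°; have oO : open O by exact: open_interior.
have OD : O `<=` disk r by exact: interior_subset.
have OB : O `<=` box r by apply: subset_trans OD _; exact: disk_box.
have mO := open_measurable2 oO.
have [Cx _] := @C1_fst R; have [Cy _] := @C1_snd R.
have cx := C1_continuous Cx; have cy := C1_continuous Cy.
have cq := cts_comp sq_cont (@qexp_cont R).
pose V1 x := - qexp (sq x) * x.1; pose V2 x := - qexp (sq x) * x.2.
have c1 : continuous V1 := cts_mul (cts_opp cq) cx.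
have c2 : continuous V2 := cts_mul (cts_opp cq) cy.
have l1 := cont_L2 mO OB c1; have l2 := cont_L2 mO OB c2.
have wk phi : C1c O phi -> ip O V1 (d1 phi) + ip O V2 (d2 phi) = ip O phi (cst 1).
  move=> Hf; have [bf b1 b2] := C1c_bmc Hf.
  have out x : ~ O x -> [/\ phi x = 0, d1 phi x = 0 & d2 phi x = 0].
    by move=> nx; apply: (C1c_outside Hf) => h; have [_ _ _ _ sub] := Hf; exact/nx/sub.
  have [p0 p1 p2] : [/\ L2 O phi, L2 O (d1 phi) & L2 O (d2 phi)] by split; exact: bmc_L2.
  rewrite /ip -RintegralD//; [|exact: L2_int|exact: L2_int].
  rewrite !I2_mkcond.
  have E := gauss_field_weak Hf.
  have bE : continuous (fun x : R * R => expR (- sq x / 2)).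
    by apply: cts_expR_comp; exact: (cts_mul (cts_opp sq_cont) (@cts_cst _ _ 2^-1)).
  have := congr1 (fun z => (2 * pi)^-1 * z) E; rewrite -!I2Z; first last.
  - under eq_fun do rewrite mulrC; apply: bmc_cont.
      by apply: bmcD; under eq_fun do rewrite mulrC; exact: bmc_cont.
    apply: cts_opp; exact: (cts_mul cq bE).
  - exact: bmc_cont.
  move=> E2; apply: etrans (etrans _ E2) _; congr (I2 _); apply/funext => x.
  + rewrite indicE; have [xO|nO] := pselect (O x).
      by rewrite mem_set// mulr1 gauss_sq /V1 /V2; ring.
    by rewrite memNset//; have [_ -> ->] := out x nO; rewrite !(mulr0, addr0).
  + rewrite indicE; have [xO|nO] := pselect (O x).
      by rewrite mem_set// mulr1 gauss_sq /cst; ring.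
    by rewrite memNset//; have [-> _ _] := out x nO; rewrite !(mulr0, mul0r).
have [C C0 kC] : exists2 C : R, 0 <= C & forall s, 0 <= s -> s <= r + 1 -> kp s <= C.
  exists (kp (r + 1)); first by apply: kp_ge0; lra.
  by move=> s s0 s1; exact: kp_mono.
rewrite /Tgamma_body -/O; apply: le_trans (Tgamma_dual oO r0 OB l1 l2 wk) _.
apply/ler_addgt0Pr => e e0.
(* The radial formula asks for a continuous profile, so the indicator of the disk is replaced by a
   cut-off that descends over [r, r + d]; this layer adds at most [d * C <= e]. *)
pose d := Num.min 1 (e / (C + 1)).
have d0 : 0 < d by rewrite lt_min ltr01 divr_gt0//; lra.
have d1' : d <= 1 by rewrite ge_min lexx.
have dC : d * C <= e.
  apply: (@le_trans _ _ (d * (C + 1))); first by rewrite ler_pM2l// lerDl.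
  by rewrite -ler_pdivlMr ?ge_min ?lexx ?orbT//; lra.
pose chi := cutoff r d.
have chi01 s : 0 <= chi s <= 1 by rewrite cutoff_ge0 cutoff_le1.
have chi1 s : s <= r -> chi s = 1 by exact: cutoff1.
have chi0 s : r + d <= s -> chi s = 0 by exact: cutoff0.
have cchi : continuous chi by exact: cutoff_cont.
pose f (s : R) := (2 * pi)^-1 * (Dp s ^+ 2 * Eg s) * chi s.
have cf : continuous f by have e1 := @Dp_cont R; have e2 := @Eg_cont R; rewrite /f; cts.
have f0 s : 0 <= f s.
  have /andP[h _] := chi01 s; apply: mulr_ge0 h; apply: mulr_ge0; first by rewrite invr_ge0 pi2_ge0.
  by apply: mulr_ge0; [exact: sqr_ge0|exact: ltW (Eg_gt0 s)].
have fM s : r + d <= s -> f s = 0 by move=> /chi0 h; rewrite /f h mulr0.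
have rd0 : 0 < r + d by lra.
have cK := @disk_ccn R 0 (lexx 0).
have [L L0 KL] := compact_box (let: And3 h _ _ := cK in h).
have [bfd _] := dist_profile_bmc rd0 cf fM cK KL.
have step1 : ip O V1 V1 + ip O V2 V2 <= I2 (fun x => f (enorm (resid (disk 0) x)) * \1_(~` disk 0) x).
  rewrite (I2_off_origin bfd) /ip -RintegralD//; [|exact: L2_int|exact: L2_int].
  have bV : bmc (fun x => (V1 x * V1 x * gauss x + V2 x * V2 x * gauss x) * \1_O x).
    apply: (indic_bmc (L := r)) => //; apply: cts_add; apply: cts_mul (@gauss_cont R); exact: cts_mul.
  rewrite I2_mkcond; apply: I2_le => // x; rewrite resid_disk0 indicE.
  have [xO|nO] := pselect (O x); last by rewrite memNset// mulr0.
  rewrite mem_set// mulr1 /f chi1; last exact: OD.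
  rewrite Dp_qexp enormE -/(sq x) /Eg enormE -/(sq x) gauss_sq /V1 /V2.
  rewrite exprMn enormE -/(sq x) mulr1 le_eqVlt; apply/orP; left; apply/eqP.
  move: (qexp _) (expR _) => q e'; have -> : sq x = x.1 * x.1 + x.2 * x.2 by [].
  ring.
apply: le_trans step1 _; rewrite (steiner_profile cf rd0 fM cK) mwidth_disk// mulr0.
have kc := @kp_cont R.
have step2 : \int[mu]_(s in `[0, r + d]) (f s * (0 + 2 * pi * s)) <= \int[mu]_(s in `[0, r + d]) kp s.
  apply: le_Rintegral => //.
  - by apply: integrable_cont; cts.
  - exact: integrable_cont.
  move=> s; rewrite /= in_itv/= => /andP[s0 _]; have /andP[c01 c11] := chi01 s.
  have -> : f s * (0 + 2 * pi * s) = kp s * chi s.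
    have : (2 * pi : R) != 0 by rewrite lt0r_neq0// mulr_gt0// pi_gt0.
    rewrite /f /kp; move: (2 * pi) => P P0; field; exact: P0.
  by rewrite ler_piMr// kp_ge0.
apply: le_trans step2 _; rewrite (Rint_split kc (ltW r0) (_ : r <= r + d)); last lra.
rewrite lerD2l; apply: le_trans dC.
have -> : d * C = \int[mu]_(t in `[r, r + d]) cst C t.
  have dc : forall x : R, is_derive x 1 (fun x => C * x) (cst C x).
    by move=> x; apply: (deq (derZ C (derI x))); rewrite mulr1.
  rewrite (Rint_FTC _ (@cts_cst _ _ C) dc); [ring|lra].
apply: le_Rintegral => //.
- exact: integrable_cont.
- by apply: integrable_cont => ?; exact: cvg_cst.
- by move=> s; rewrite /= in_itv/= => /andP[s0 s1]; apply: kC; lra.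
Qed.

End disk_torsion.

(** * Gaussian integrals of functions of the distance *)

Section gauss_steiner.
Context {R : realType}.
Notation mu := (@lebesgue_measure R).
Notation T2 := (measurableTypeR R * measurableTypeR R)%type.

(** From e^(-u) >= 1 - u one gets (e^u - 1 - u) (1 - u) <= u^2, and 1 - u is at least 1 / 2. *)
Lemma expR_second_order (u : R) : `|u| <= 2^-1 -> `|expR u - 1 - u| <= 2 * u ^+ 2.
Proof.
rewrite ler_norml => /andP[u1 u2]; have h1 := expR_ge1Dx u; have h2 := expR_ge1Dx (- u).
have h3 : expR u * (1 - u) <= 1 by rewrite -[leRHS](expRxMexpNx_1 u) ler_pM2l ?expR_gt0.
have h4 : (expR u - 1 - u) * (1 - u) <= u ^+ 2 by nra.
have h5 : 0 <= expR u - 1 - u by lra.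
rewrite ger0_norm//; nra.
Qed.

Section body.
Variables (K : set (R * R)) (ka : R).
Hypotheses (cK : ccn K) (ka0 : 0 < ka) (Kka : K `<=` disk ka).

Let d x := enorm (resid K x).
Let d_sq x : d x ^+ 2 = sqd K x. Proof. exact: enormE. Qed.
Let d_cont : continuous d. Proof. exact: dist_cont. Qed.
Let mK : measurable (K : set T2).
Proof. by apply: compact_measurable2; case: cK. Qed.

Lemma dist_in x : K x -> enorm (resid K x) = 0.
Proof. by move=> Kx; rewrite /enorm -/(sqd K x) sqd_in// sqrtr0. Qed.

Let Kbox : K `<=` box ka.
Proof. exact: subset_trans Kka (@disk_box R ka). Qed.

Section profile.
Variables (f : R -> R) (M r F1 : R).
Hypotheses (cf : continuous f) (M0 : 0 < M) (Mr : M <= r) (fM : forall s, M <= s -> f s = 0)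
  (f00 : 0 <= f 0) (F10 : forall s, 0 <= s -> `|f s| <= F1) .

Let F s := f s * Eg s.
Let cF : continuous F. Proof. exact: (cts_mul cf (@Eg_cont R)). Qed.
Let FM s : M <= s -> F s = 0. Proof. by move=> /fM h; rewrite /F h mul0r. Qed.
Let FF1 s : 0 <= s -> `|F s| <= F1.
Proof.
move=> s0; rewrite normrM (ger0_norm (ltW (Eg_gt0 s))); apply: le_trans (F10 s0).
by rewrite ler_piMr// Eg_le1.
Qed.

(* [F(d) resid] is a gradient, so the divergence theorem turns the first-order
   term [F(d) resid . proj] of the gaussian weight into radial integrals. *)
Lemma resid_proj_integral :
  I2 (fun x => F (d x) * dotp (resid K x) (cproj K x)) <=
  mwidth K * \int[mu]_(s in `[0, M]) (F s * s ^+ 2) + F1 * (2 * r * ka) ^+ 2.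
Proof.
have csq : continuous (@Num.sqrt R) := @sqrt_continuous R.
pose b (s : R) := F (Num.sqrt s).
have cb : continuous b := cts_comp csq cF.
have bM s : M ^+ 2 <= s -> b s = 0.
  by move=> Ms; apply: FM; exact: ge_sqrt.
have [A dA AM] := vanishing_primitive cb bM.
have cA : continuous A by move=> s; exact: is_derive_continuous (dA s).
have bd x : b (sqd K x) = F (d x) by [].
have [C0 E0] := kappa_C1 cK cb dA.
have Hc : C1c setT (fun x => A (sqd K x)) by apply: (kappa_C1c cK cb dA M0 AM).
have [Cx Ex] := @C1_fst R; have [Cy Ey] := @C1_snd R.
have cA2 : continuous (fun s : R => A (s ^+ 2)) by cts.
have AM2 s : M <= s -> A (s ^+ 2) = 0.
  by move=> Ms; apply: AM; have m0 := M0; rewrite ler_pXn2r ?nnegrE//; lra.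
have [bAd Asupp] := dist_profile_bmc M0 cA2 AM2 cK Kbox.
have [bFd Fsupp] := dist_profile_bmc M0 cF FM cK Kbox.
(* The gradient of [A (sqd K)] is -2 [F(d) resid]. It is tested against the identity field, of
   divergence 2. *)
have e1 : I2 (fun x => F (d x) * dotp (resid K x) x) = I2 (fun x => A (d x ^+ 2)).
  have := div_by_parts Hc Cx Cy.
  have -> : (fun x => A (sqd K x) * (d1 (fun x : R * R => x.1) x + d2 (fun x : R * R => x.2) x)) =
      fun x => 2 * A (d x ^+ 2).
    by apply/funext => x; have [-> _] := Ex x; have [_ ->] := Ey x; rewrite d_sq mulrC.
  have -> : (fun x => d1 (fun x => A (sqd K x)) x * x.1 + d2 (fun x => A (sqd K x)) x * x.2) =
      fun x => - (2 * (F (d x) * dotp (resid K x) x)).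
    apply/funext => x; have [-> ->] := E0 x; rewrite bd /dotp /= /GRing.scale/=; ring.
  have bb : bmc (fun x => F (d x) * dotp (resid K x) x).
    by apply: bmc_cont => //; exact: (dotp_cont (resid_cont cK) (@cts_id2 R)).
  rewrite I2Z// I2N ?opprK; last exact: bmcZ.
  by rewrite I2Z// => h; lra.
have cs : continuous (fun s : R => s) by move=> ?; exact: cvg_id.
have cFs : continuous (fun s : R => F s * s ^+ 2) by cts.
have e2 : I2 (fun x => F (d x) * d x ^+ 2) =
    \int[mu]_(s in `[0, M]) (F s * s ^+ 2 * (mwidth K + 2 * pi * s)).
  rewrite -(steiner_profile cFs M0 _ cK); last by move=> s /FM ->; rewrite mul0r.
  congr (I2 _); apply/funext => x; rewrite -/(d x) indicE.
  have [Kx|Kx] := pselect (K x); last by rewrite mem_set// mulr1.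
  by rewrite memNset; [rewrite /d dist_in// expr0n !mulr0|apply].
have e3 : I2 (fun x => A (d x ^+ 2) * \1_(~` K) x) =
    \int[mu]_(s in `[0, M]) (F s * s ^+ 2 * (2 * mwidth K + 2 * pi * s)).
  rewrite (steiner_profile cA2 M0 AM2 cK).
  have ci1 : continuous (fun s : R => A (s ^+ 2) * (mwidth K + 2 * pi * s)) by cts.
  have cab : continuous (fun s : R => F (Num.sqrt (s ^+ 2))) by cts.
  have ci2 : continuous (fun s : R => F (Num.sqrt (s ^+ 2)) * s ^+ 2 * (2 * mwidth K + 2 * pi * s)) by cts.
  (* Writing [Num.sqrt (s ^+ 2)] for [s] makes the derivative of the primitive [Ps] correct on the
     whole line. *)
  have -> : \int[mu]_(s in `[0, M]) (F s * s ^+ 2 * (2 * mwidth K + 2 * pi * s)) =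
     \int[mu]_(s in `[0, M]) (F (Num.sqrt (s ^+ 2)) * s ^+ 2 * (2 * mwidth K + 2 * pi * s)).
    by apply: eq_Rintegral => s /set_mem /=; rewrite in_itv/= => /andP[s0 _]; rewrite sqrtr_sqr ger0_norm.
  apply/eqP; rewrite -subr_eq0 -RintegralB//; [|exact: (integrable_cont 0 M ci1)|exact: (integrable_cont 0 M ci2)].
  pose Ps (s : R) := mwidth K * (s * A (s ^+ 2)) + pi * (s * s * A (s ^+ 2)).
  have ds2 (s : R) : is_derive s 1 (fun y : R => y ^+ 2) (2 * s).
    by under eq_fun do rewrite expr2; apply: deq (derM (derI s) (derI s)) _; ring.
  have dAs (s : R) : is_derive s 1 (fun y : R => A (y ^+ 2)) (- b (s ^+ 2) * (2 * s)).
    exact: (@dercomp R A (fun y : R => y ^+ 2) s _ _ (dA _) (ds2 s)).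
  have dPs (s : R) : is_derive s 1 Ps (A (s ^+ 2) * (mwidth K + 2 * pi * s) -
      F (Num.sqrt (s ^+ 2)) * s ^+ 2 * (2 * mwidth K + 2 * pi * s)).
    apply: deq (derD (derZ _ (derM (derI s) (dAs s)))
      (derZ _ (derM (derM (derI s) (derI s)) (dAs s)))) _.
    by rewrite /b; ring.
  have ci3 := cts_add ci1 (cts_opp ci2).
  by apply/eqP; rewrite (Rint_FTC (ltW M0) ci3 dPs) /Ps (AM2 M (lexx M)); ring.
have A0 : `|A 0| <= F1 * r ^+ 2.
  have M2 : 0 < M ^+ 2 by rewrite exprn_gt0.
  have [c /[!in_itv]/= /andP[c0 cM]] := MVT M2 (fun x _ => dA x) (@continuous_subspaceT _ _ _ _ cA).
  rewrite (AM _ (lexx _)) sub0r subr0 => /eqP; rewrite eqr_oppLR => /eqP ->.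
  rewrite mulNr opprK normrM (ger0_norm (ltW M2)).
  apply: ler_pM => //; [exact: sqr_ge0|exact: (FF1 (sqrtr_ge0 c))|have m0 := M0; have mr := Mr; rewrite ler_pXn2r ?nnegrE//; lra].
have bA1 : bmc (fun x => A (d x ^+ 2) * \1_K x) by exact: bmc_indic.
have bA2 : bmc (fun x => A (d x ^+ 2) * \1_(~` K) x) by apply: bmc_indic => //; exact: measurableC.
have e4 : I2 (fun x => A (d x ^+ 2)) = I2 (fun x => A (d x ^+ 2) * \1_K x) +
    I2 (fun x => A (d x ^+ 2) * \1_(~` K) x).
  rewrite -I2D//; congr (I2 _); apply/funext => x.
  by rewrite !indicE in_setC; case: (x \in K); rewrite /= ?mulr0 ?mulr1 ?addr0 ?add0r.
(* On [K] the integrand is the constant [A 0], and the area of [K] is at most (2 ka)^2: a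
   second-order term. *)
have e5 : I2 (fun x => A (d x ^+ 2) * \1_K x) <= F1 * (2 * r * ka) ^+ 2.
  have -> : F1 * (2 * r * ka) ^+ 2 = F1 * r ^+ 2 * (2 * ka) ^+ 2 by ring.
  rewrite -(I2_box ka0) -I2Z; last exact: bmc_box.
  apply: I2_le => //; first by apply: bmcZ; exact: bmc_box.
  move=> x; rewrite !indicE; have [Kx|Kx] := pselect (K x); last first.
    by rewrite memNset// mulr0 mulr_ge0//; apply: le_trans A0.
  rewrite !mem_set//; last by apply: disk_box; exact: Kka.
  by rewrite !mulr1 /d dist_in// expr0n; apply: le_trans A0; exact: ler_norm.
have -> : (fun x => F (d x) * dotp (resid K x) (cproj K x)) =
    fun x => F (d x) * dotp (resid K x) x - F (d x) * d x ^+ 2.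
  apply/funext => x; rewrite d_sq /sqd -mulrBr -dotpBr; congr (_ * dotp _ _).
  by rewrite /resid subKr.
rewrite I2B; first last.
- by apply: bmc_cont => //; exact: (cts_sqr d_cont).
- by apply: bmc_cont => //; exact: (dotp_cont (resid_cont cK) (@cts_id2 R)).
rewrite e1 e2 e4 e3.
have ck1 : continuous (fun s : R => F s * s ^+ 2 * (2 * mwidth K + 2 * pi * s)) by cts.
have ck2 : continuous (fun s : R => F s * s ^+ 2 * (mwidth K + 2 * pi * s)) by cts.
rewrite -addrA -RintegralB//; [|exact: (integrable_cont 0 M ck1)|exact: (integrable_cont 0 M ck2)].
have -> : \int[mu]_(s in `[0, M]) (F s * s ^+ 2 * (2 * mwidth K + 2 * pi * s) -
    F s * s ^+ 2 * (mwidth K + 2 * pi * s)) = mwidth K * \int[mu]_(s in `[0, M]) (F s * s ^+ 2).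
  have E : \int[mu]_(s in `[0, M]) (mwidth K * (F s * s ^+ 2)) =
      mwidth K * \int[mu]_(s in `[0, M]) (F s * s ^+ 2).
    by rewrite RintegralZl//; exact: (integrable_cont 0 M cFs).
  by rewrite -E; apply: eq_Rintegral => s _; ring.
by rewrite addrC lerD2l.
Qed.

(** The weight at x is (2 pi)^-1 [Eg(d)] e^(-y), where y is z = resid . proj plus half of |proj|^2,
    and e^(-y) is 1 - z up to a term of order ka^2. The constant 1 is integrated by the Steiner
    formula and z by [resid_proj_integral]. The part over [K] is dropped, as 0 <= [f 0]. *)
Lemma gauss_steiner (R1 : R) : ka <= R1 -> ka * (r + R1) <= 2^-1 ->
  (2 * pi)^-1 * (\int[mu]_(s in `[0, M]) (F s * (mwidth K * (1 - s ^+ 2) + 2 * pi * s))) -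
   F1 * ((2 * (r + R1) ^+ 2 + 1) * (2 * (r + R1)) ^+ 2 + (2 * r) ^+ 2) * ka ^+ 2 <=
  I2 (fun x => f (enorm (resid K x)) * gauss x).
Proof.
move=> kR kY; have m0 := M0; have mr := Mr; have k0 := ka0.
set Y := r + R1; have Y0 : 0 < Y by rewrite /Y; lra.
have F1_0 : 0 <= F1 by apply: le_trans (F10 (lexx 0)).
pose P : R := (2 * pi)^-1.
have P0 : 0 <= P by rewrite invr_ge0 pi2_ge0.
have P1 : P <= 1 by rewrite invf_le1 ?mulr_gt0 ?pi_gt0//; have := @pi_ge2 R; lra.
have [bfd fsupp] := dist_profile_bmc M0 cf fM cK Kbox.
have [bFd Fsupp] := dist_profile_bmc M0 cF FM cK Kbox.
pose z x := dotp (resid K x) (cproj K x).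
have cz : continuous z := dotp_cont (resid_cont cK) (proj_cont cK).
have bFz : bmc (fun x => F (d x) * z x) by exact: bmc_cont.
have mKc : measurable (~` K : set T2) by exact: measurableC.
have bFK : bmc (fun x => F (d x) * \1_(~` K) x) by exact: bmc_indic.
(* A pointwise error, charged to [box Y], which contains the support: 2 y^2 <= 2 (ka Y)^2 is the
   Taylor remainder, and the 1 covers |proj|^2 / 2. *)
pose Er : R := F1 * ((2 * Y ^+ 2 + 1) * ka ^+ 2).
have Er0 : 0 <= Er.
  apply: mulr_ge0 => //; apply: mulr_ge0; last exact: sqr_ge0.
  by have := sqr_ge0 Y; lra.
have pw x : P * (F (d x) * \1_(~` K) x - F (d x) * z x) - Er * \1_(box Y) x <= f (d x) * gauss x.
  have g0 := gauss_gt0 x.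
  have [Kx|Kx] := pselect (K x).
    have -> : z x = 0 by rewrite /z /resid (proj_in cK Kx) subrr /dotp /= !mul0r addr0.
    rewrite !indicE memNset; last by apply.
    rewrite /d (dist_in Kx) !mulr0 subrr mulr0 sub0r.
    apply: (@le_trans _ _ 0); last by rewrite mulr_ge0// ltW.
    by rewrite oppr_le0 mulr_ge0.
  rewrite !indicE (mem_set (A := ~` K))// mulr1.
  have [f0|fn] := eqVneq (f (d x)) 0.
    rewrite /F f0 !mul0r subrr mulr0 sub0r oppr_le0 mulr_ge0//.
  have xY : box Y x.
    have /in_box[x1 x2] := fsupp x fn; apply/in_box; rewrite /Y; lra.
  have dM : d x < M by rewrite ltNge; apply: contra fn => /fM ->.
  rewrite mem_set// mulr1.
  have [Kpx _] := projP x cK.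
  have pk : dotp (cproj K x) (cproj K x) <= ka ^+ 2.
    by rewrite -enormE ler_pXn2r ?nnegrE ?enorm_ge0//; [exact: Kka|exact: ltW].
  (* Its size is at most [ka * Y <= 2^-1], the range of [expR_second_order]. *)
  pose y := z x + dotp (cproj K x) (cproj K x) / 2.
  have p0 := dotp_ge0 (cproj K x).
  have zb : `|z x| <= M * ka.
    rewrite -(@ler_pXn2r _ 2) ?nnegrE//; last by rewrite mulr_ge0 ?ltW.
    rewrite real_normK ?num_real// exprMn; apply: le_trans (dotp_cs _ _) _.
    apply: ler_pM => //; first exact: dotp_ge0.
    by rewrite -/(sqd K x) -d_sq ler_pXn2r ?nnegrE ?enorm_ge0//; exact: ltW.
  have yb : `|y| <= ka * Y.
    apply: le_trans (ler_normD _ _) _; rewrite (ger0_norm (_ : 0 <= _ / 2)); last lra.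
    have : ka ^+ 2 <= ka * R1 by rewrite expr2 ler_pM2l.
    have : M * ka <= r * ka by rewrite ler_pM2r.
    by rewrite /Y; lra.
  have gE : gauss x = P * (Eg (d x) * expR (- y)).
    rewrite gaussE /Eg -expRD; congr (_ * expR _).
    have -> : dotp x x = d x ^+ 2 + 2 * z x + dotp (cproj K x) (cproj K x).
      rewrite d_sq /sqd /z -{1 2}(subrK (cproj K x) x) -/(resid K x) !dotpE.
      by rewrite (dotpC (cproj K x) x); ring.
    by rewrite /y; field.
  have y12 : `|- y| <= 2^-1 by rewrite normrN; apply: le_trans yb kY.
  have h := expR_second_order y12.
  have h2 : `|expR (- y) - (1 - z x)| <= (2 * Y ^+ 2 + 1) * ka ^+ 2.
    have -> : expR (- y) - (1 - z x) = (expR (- y) - 1 - - y) - dotp (cproj K x) (cproj K x) / 2.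
      by rewrite /y; ring.
    apply: le_trans (ler_normB _ _) _; rewrite (ger0_norm (_ : 0 <= _ / 2)); last lra.
    have : y ^+ 2 <= (ka * Y) ^+ 2.
      by rewrite -(real_normK (num_real y)) ler_pXn2r ?nnegrE//; exact: mulr_ge0 (ltW ka0) (ltW Y0).
    by rewrite sqrrN in h; rewrite exprMn; lra.
  have -> : f (d x) * gauss x = P * (F (d x) - F (d x) * z x) + P * (F (d x) * (expR (- y) - (1 - z x))).
    by rewrite gE /F; ring.
  rewrite lerD2l -lerNl; apply: le_trans (ler_norm _) _; rewrite normrN normrM (ger0_norm P0).
  apply: (@le_trans _ _ (1 * (F1 * ((2 * Y ^+ 2 + 1) * ka ^+ 2)))); last by rewrite mul1r.
  by apply: ler_pM => //; rewrite normrM; apply: ler_pM => //; exact: (FF1 (enorm_ge0 _)).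
have := I2_le _ _ pw; rewrite I2B; [|by apply: bmcZ; exact: bmcB|by apply: bmcZ; exact: bmc_box].
rewrite I2Z; last exact: bmcB.
rewrite I2B// I2Z; last exact: bmc_box.
rewrite I2_box// => /(_ _ _) hle.
apply: le_trans (hle _ _); first last.
- by apply: bmc_cont => //; exact: gauss_cont.
- by apply: bmcB; apply: bmcZ; [exact: bmcB|exact: bmc_box].
rewrite (steiner_profile cF M0 FM cK).
have := resid_proj_integral; rewrite -/P => rp.
have cs : continuous (fun s : R => s) by move=> ?; exact: cvg_id.
have cFs : continuous (fun s : R => F s * s ^+ 2) by cts.
have cFW : continuous (fun s : R => F s * (mwidth K + 2 * pi * s)) by cts.
have cFZ : continuous (fun s : R => mwidth K * (F s * s ^+ 2)) by cts.
have -> : \int[mu]_(s in `[0, M]) (F s * (mwidth K * (1 - s ^+ 2) + 2 * pi * s)) =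
   \int[mu]_(s in `[0, M]) (F s * (mwidth K + 2 * pi * s)) - mwidth K * \int[mu]_(s in `[0, M]) (F s * s ^+ 2).
  rewrite -RintegralZl//; last exact: (integrable_cont 0 M cFs).
  rewrite -RintegralB//; [|exact: (integrable_cont 0 M cFW)|exact: (integrable_cont 0 M cFZ)].
  by apply: eq_Rintegral => s _; ring.
move: rp; rewrite -/(z _).
set I1 := \int[mu]_(s in _) (F s * (mwidth K + _)); set I0 := mwidth K * _; set J := I2 _ => rp.
rewrite /Er.
have q1 : P * (J - I0) <= F1 * (2 * r * ka) ^+ 2.
  apply: (@le_trans _ _ (P * (F1 * (2 * r * ka) ^+ 2))); first by rewrite ler_wpM2l//; lra.
  by rewrite ler_piMl// mulr_ge0// sqr_ge0.
have -> : F1 * ((2 * Y ^+ 2 + 1) * (2 * Y) ^+ 2 + (2 * r) ^+ 2) * ka ^+ 2 =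
  F1 * ((2 * Y ^+ 2 + 1) * ka ^+ 2) * (2 * Y) ^+ 2 + F1 * (2 * r * ka) ^+ 2 by ring.
rewrite -/P; move: q1; rewrite !mulrBr; lra.
Qed.

End profile.
End body.
End gauss_steiner.

(** * The test function *)

Section test_function.
Context {R : realType}.
Notation mu := (@lebesgue_measure R).
Notation T2 := (measurableTypeR R * measurableTypeR R)%type.

(** Minus the slope of the test profile in the variable s = d^2. In the variable d it becomes [Dp d]
    times the cut-off, as 2 d times half of [qexp (d ^+ 2)] is [Dp d]. The cut-off acts between rho
    - 2 del and rho - del, which keeps the support inside the open parallel body. *)
Definition test_slope (rho del s : R) := 2^-1 * qexp s * cutoff (rho - 2 * del) del (Num.sqrt s).

Variables (rho r del : R).
Hypotheses (rho0 : 0 < rho) (rhor : rho <= r) (del0 : 0 < del) (delrho : 2 * del < rho).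

Let M := rho - del.
Let a := rho - 2 * del.
Let chi := cutoff a del.
Let b := test_slope rho del.

Let M0 : 0 < M. Proof. by have := del0; have := delrho; rewrite /M; lra. Qed.
Let a0 : 0 < a. Proof. by have := del0; have := delrho; rewrite /a; lra. Qed.
Let Mrho : M <= rho. Proof. by have := del0; rewrite /M; lra. Qed.
Let chiM s : M <= s -> chi s = 0.
Proof. by move=> Ms; apply: cutoff0 del0 _; move: Ms; rewrite /M /a; lra. Qed.

Lemma test_slope_cont : continuous (test_slope rho del).
Proof.
have c1 := @qexp_cont R; have c2 := cts_comp (@sqrt_continuous R) (@cutoff_cont R a del).
by apply: cts_mul c2; cts.
Qed.

Lemma test_slope_ge0 s : 0 <= test_slope rho del s.
Proof. by rewrite /test_slope mulr_ge0 ?cutoff_ge0// mulr_ge0// qexp_ge0. Qed.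

Lemma test_slope_eq0 s : (rho - del) ^+ 2 <= s -> test_slope rho del s = 0.
Proof.
by move=> Ms; rewrite /test_slope -/a -/chi chiM ?mulr0//; exact: ge_sqrt.
Qed.

Variable B : R -> R.
Hypotheses (dB : forall s : R, is_derive s 1 B (- b s)) (BM : forall s, M ^+ 2 <= s -> B s = 0)
  (B0 : forall s, 0 <= B s).

(** The integrand of the energy, twice the test function minus its squared gradient, at distance s
    from [K]. *)
Definition test_density (s : R) := 2 * B (s ^+ 2) - (Dp s * cutoff (rho - 2 * del) del s) ^+ 2.
Let f := test_density.

Let g_deriv (s : R) : is_derive s 1 (fun y : R => B (y ^+ 2)) (- (Dp s * chi `|s|)).
Proof.
have ds2 : is_derive s 1 (fun y : R => y ^+ 2) (2 * s).
  by under eq_fun do rewrite expr2; apply: deq (derM (derI s) (derI s)) _; ring.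
apply: deq (@dercomp R B (fun y : R => y ^+ 2) s _ _ (dB _) ds2) _.
by rewrite /b /test_slope -/a -/chi sqrtr_sqr Dp_qexp; field.
Qed.

Let g_cont : continuous (fun y : R => B (y ^+ 2)).
Proof. by move=> s; exact: is_derive_continuous (g_deriv s). Qed.

Let gM s : M <= s -> B (s ^+ 2) = 0.
Proof. by move=> Ms; apply: BM; have m0 := M0; rewrite ler_pXn2r ?nnegrE//; lra. Qed.

Lemma test_density_cont : continuous f.
Proof.
have c1 := @Dp_cont R; have c2 := @cutoff_cont R (rho - 2 * del) del.
have cB : continuous B by move=> s; exact: is_derive_continuous (dB s).
rewrite /f /test_density; apply: cts_add; first by cts.
by cts.
Qed.

Lemma test_density_eq0 s : rho - del <= s -> f s = 0.
Proof. by move=> Ms; rewrite /f /test_density gM// -/a -/chi chiM// !mulr0 expr0n subrr. Qed.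

Lemma test_density0 : 0 <= f 0.
Proof. by rewrite /f /test_density Dp_qexp !mul0r expr0n subr0 mulr_ge0. Qed.

Let g_le s : 0 <= s -> B (s ^+ 2) <= r * Dp r.
Proof.
move=> s0; have rr : 0 <= r by have := rho0; have := rhor; lra.
have Dr := Dp_ge0 rr.
have [Ms|sM] := leP M s; first by rewrite gM// mulr_ge0.
have [c /[!in_itv]/= /andP[sc cM]] := MVT sM (fun x _ => g_deriv x) (@continuous_subspaceT _ _ _ _ g_cont).
rewrite (gM (lexx M)) sub0r => /eqP; rewrite eqr_oppLR => /eqP ->.
rewrite mulNr opprK.
have c0 : 0 <= c by lra.
have cr : c <= r by have := Mrho; have := rhor; lra.
have h1 := Dp_mono c0 cr; have h0 := Dp_ge0 c0.
rewrite mulrC; apply: ler_pM; [lra|by rewrite mulr_ge0// cutoff_ge0|by have := Mrho; have := rhor; lra|].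
by apply: le_trans h1; rewrite ler_piMr// cutoff_le1.
Qed.

Lemma test_density_bound s : 0 <= s -> `|f s| <= 2 * (r * Dp r) + Dp r ^+ 2.
Proof.
move=> s0; have rr : 0 <= r by have := rho0; have := rhor; lra.
have Dr := Dp_ge0 rr.
have [Ms|sM] := leP M s; first by rewrite test_density_eq0// normr0; have := sqr_ge0 (Dp r); have := mulr_ge0 rr Dr; lra.
have sr : s <= r by have := Mrho; have := rhor; lra.
have h1 := Dp_mono s0 sr; have h0 := Dp_ge0 s0.
have c0 := cutoff_ge0 a del s; have c1 := cutoff_le1 a del s.
apply: le_trans (ler_normB _ _) _; rewrite ger0_norm ?mulr_ge0// ger0_norm ?sqr_ge0//.
apply: lerD; first by rewrite ler_pM2l// g_le.
rewrite ler_pXn2r ?nnegrE//; last exact: mulr_ge0 h0 c0.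
by apply: le_trans h1; rewrite ler_piMr.
Qed.

Section radial_bound.
Variables (G : R -> R) (p : R).
Hypotheses (dG : forall s : R, is_derive s 1 G (- Dp s)) (Grho : G rho = 0)
  (p0 : 0 <= p) (pr : p * r <= 2 * pi).

Let G_cont : continuous G. Proof. by move=> s; exact: is_derive_continuous (dG s). Qed.

(** The difference of the two profiles has derivative - [Dp] (1 - chi). It is constant up to rho - 2
    del, so the loss builds up over a width of at most 2 del, where [Dp] is at most [Dp r]. *)
Lemma test_profile_ge s : 0 <= s -> s <= rho -> G s - 2 * del * Dp r <= B (s ^+ 2).
Proof.
move=> s0 srho; have rr := rhor; have d0 := del0; have Mr := Mrho; have ea : a = rho - 2 * del by [].
have Dr : 0 <= Dp r by apply: Dp_ge0; lra.
pose h y := G y - B (y ^+ 2).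
have dh (y : R) : is_derive y 1 h (- (Dp y * (1 - chi `|y|))).
  by apply: deq (derB (dG y) (g_deriv y)) _; ring.
have ch : continuous h by move=> y; exact: is_derive_continuous (dh y).
have hrho : h rho = 0 by rewrite /h Grho gM// subr0.
have near_bd y : a <= y -> y <= rho -> h y <= 2 * del * Dp r.
  move=> ay; rewrite le_eqVlt => /predU1P[->|yr]; first by rewrite hrho; apply: mulr_ge0 => //; lra.
  have [c /[!in_itv]/= /andP[yc cr]] := MVT yr (fun x _ => dh x) (@continuous_subspaceT _ _ _ _ ch).
  rewrite hrho sub0r mulNr => /eqP; rewrite eqr_opp => /eqP ->.
  have a00 := a0; have c0 : 0 <= c by lra.
  have h1 : Dp c <= Dp r by apply: Dp_mono => //; lra.
  have x0 := cutoff_ge0 a del `|c|; have x1 := cutoff_le1 a del `|c|.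
  rewrite mulrC; apply: ler_pM; [lra| |lra|].
    by rewrite mulr_ge0 ?Dp_ge0// subr_ge0.
  by apply: le_trans h1; rewrite ler_piMr ?Dp_ge0// gerBl.
suff : h s <= 2 * del * Dp r by rewrite /h; lra.
have [as_|sa] := leP a s; first exact: near_bd.
have [c /[!in_itv]/= /andP[sc ca]] := MVT sa (fun x _ => dh x) (@continuous_subspaceT _ _ _ _ ch).
rewrite ger0_norm; last lra.
rewrite /chi cutoff1 ?(ltW ca)// subrr mulr0 oppr0 mul0r => /eqP; rewrite subr_eq0 => /eqP <-.
by apply: near_bd => //; rewrite ea; lra.
Qed.

(** The hypothesis [p * r <= 2 * pi] makes the weight p (1 - s^2) + 2 pi s nonnegative, so the
    pointwise bound on the density can be integrated. The loss 4 del [Dp r] is doubled from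
    [test_profile_ge], the weight is at most p + 2 pi r, and the interval has length at most r. *)
Lemma radial_bound :
  p * kp rho + 2 * pi * \int[mu]_(s in `[0, rho]) kp s - 4 * del * Dp r * (p + 2 * pi * r) * r <=
  \int[mu]_(s in `[0, rho - del]) (f s * Eg s * (p * (1 - s ^+ 2) + 2 * pi * s)).
Proof.
have rr := rhor; have d0 := del0; have Mr := Mrho; have r00 := rho0; have pp := p0.
have Dr : 0 <= Dp r by apply: Dp_ge0; lra.
have piR : 0 <= pi :> R by exact: pi_ge0.
have cf := test_density_cont; have cE := @Eg_cont R; have cD := @Dp_cont R; have cG := G_cont.
pose W (s : R) := p * (1 - s ^+ 2) + 2 * pi * s.
have cW : continuous W by rewrite /W; cts.
have cfEW : continuous (fun s : R => f s * Eg s * W s) by apply: cts_mul cW; exact: cts_mul.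
have -> : \int[mu]_(s in `[0, rho - del]) (f s * Eg s * (p * (1 - s ^+ 2) + 2 * pi * s)) =
    \int[mu]_(s in `[0, rho]) (f s * Eg s * W s).
  rewrite (Rint_split cfEW (ltW M0) Mrho) [X in _ = _ + X](_ : _ = 0) ?addr0//.
  have -> : \int[mu]_(s in `[M, rho]) (f s * Eg s * W s) = \int[mu]_(s in `[M, rho]) cst 0 s.
    apply: eq_Rintegral => s /set_mem /=; rewrite in_itv/= => /andP[Ms _].
    by rewrite test_density_eq0// !mul0r.
  by rewrite /Rintegral integral0.
rewrite -(torsion_integral_width (ltW r00) dG Grho) -(torsion_integral_area (ltW r00) dG Grho).
have c1 : continuous (fun s : R => (2 * G s - Dp s ^+ 2) * ((1 - s ^+ 2) * Eg s)) by cts.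
have c2 : continuous (fun s : R => (2 * G s - Dp s ^+ 2) * (s * Eg s)) by cts.
have c1p : continuous (fun s : R => p * ((2 * G s - Dp s ^+ 2) * ((1 - s ^+ 2) * Eg s))).
  by apply: cts_mul c1; move=> ?; exact: cvg_cst.
have c2p : continuous (fun s : R => 2 * pi * ((2 * G s - Dp s ^+ 2) * (s * Eg s))).
  by apply: cts_mul c2; move=> ?; exact: cvg_cst.
have E1 : \int[mu]_(s in `[0, rho]) (p * ((2 * G s - Dp s ^+ 2) * ((1 - s ^+ 2) * Eg s))) =
    p * \int[mu]_(s in `[0, rho]) ((2 * G s - Dp s ^+ 2) * ((1 - s ^+ 2) * Eg s)).
  by rewrite RintegralZl//; exact: (integrable_cont 0 rho c1).
have E2 : \int[mu]_(s in `[0, rho]) (2 * pi * ((2 * G s - Dp s ^+ 2) * (s * Eg s))) =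
    2 * pi * \int[mu]_(s in `[0, rho]) ((2 * G s - Dp s ^+ 2) * (s * Eg s)).
  by rewrite RintegralZl//; exact: (integrable_cont 0 rho c2).
rewrite -E1 -E2.
set e := 4 * del * Dp r * (p + 2 * pi * r).
have q1 : 0 <= 4 * del * Dp r by apply: mulr_ge0 => //; lra.
have q2 : 0 <= p + 2 * pi * r by have : 0 <= pi * r by [apply: mulr_ge0 => //; lra]; lra.
have e0 : 0 <= e := mulr_ge0 q1 q2.
have er : \int[mu]_(s in `[0, rho]) cst e s <= e * r.
  have dc : forall x : R, is_derive x 1 (fun x => e * x) (cst e x).
    by move=> x; apply: (deq (derZ e (derI x))); rewrite mulr1.
  rewrite (Rint_FTC (ltW r00) (@cts_cst _ _ e) dc) mulr0 subr0 ler_wpM2l//.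
apply: le_trans (lerB (lexx _) er) _.
have ce : continuous (fun _ : R => e) by move=> ?; exact: cvg_cst.
have c12 := cts_add c1p c2p.
rewrite -RintegralD//; [|exact: (integrable_cont 0 rho c1p)|exact: (integrable_cont 0 rho c2p)].
rewrite -RintegralB//; [|exact: (integrable_cont 0 rho c12)|exact: (integrable_cont 0 rho ce)].
apply: le_Rintegral => //.
- exact: (integrable_cont 0 rho (cts_add c12 (cts_opp ce))).
- exact: (integrable_cont 0 rho cfEW).
move=> s; rewrite /= in_itv/= => /andP[s0 srho].
have sr : s * s <= s * r by rewrite ler_wpM2l//; lra.
have psr : p * (s * s) <= p * (s * r) by rewrite ler_wpM2l.
have h2 : s * (p * r) <= s * (2 * pi) by rewrite ler_wpM2l.
have W0 : 0 <= W s by rewrite /W expr2; lra.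
have W1 : W s <= p + 2 * pi * r.
  have h3 : pi * s <= pi * r by rewrite ler_wpM2l//; lra.
  have h4 : 0 <= p * s ^+ 2 by rewrite mulr_ge0// sqr_ge0.
  by rewrite /W; lra.
have Eg0 := Eg_gt0 s; have Eg1 := Eg_le1 s.
have EW0 : 0 <= Eg s * W s by rewrite mulr_ge0// ltW.
have EW1 : Eg s * W s <= p + 2 * pi * r by apply: le_trans W1; rewrite ler_piMl.
have tp := test_profile_ge s0 srho.
have Ds := Dp_ge0 s0.
have x0 := cutoff_ge0 (rho - 2 * del) del s; have x1 := cutoff_le1 (rho - 2 * del) del s.
have fs : 2 * G s - Dp s ^+ 2 - 4 * del * Dp r <= f s.
  have : (Dp s * cutoff (rho - 2 * del) del s) ^+ 2 <= Dp s ^+ 2.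
    by rewrite ler_pXn2r ?nnegrE//; [rewrite ler_piMr|exact: mulr_ge0 Ds x0].
  by rewrite /f /test_density; lra.
have -> : p * ((2 * G s - Dp s ^+ 2) * ((1 - s ^+ 2) * Eg s)) +
   2 * pi * ((2 * G s - Dp s ^+ 2) * (s * Eg s)) = (2 * G s - Dp s ^+ 2) * (Eg s * W s).
  by rewrite /W; ring.
have k1 : (2 * G s - Dp s ^+ 2 - 4 * del * Dp r) * (Eg s * W s) <= f s * (Eg s * W s).
  by rewrite ler_wpM2r.
have k2 : 4 * del * Dp r * (Eg s * W s) <= e.
  by rewrite /e; apply: ler_wpM2l.
by rewrite -mulrA /cst; lra.
Qed.

End radial_bound.

Lemma test_energy K (Omega : set (R * R)) (L : R) : ccn K -> open Omega -> Omega `<=` box L ->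
  C1c Omega (fun x => B (sqd K x)) ->
  energy Omega (fun x => B (sqd K x)) = I2 (fun x => f (enorm (resid K x)) * gauss x).
Proof.
move=> cK oO OL Hf; have mO := open_measurable2 oO.
have [bf b1 b2] := C1c_bmc Hf; have [_ E0] := kappa_C1 cK test_slope_cont dB.
have out x : ~ Omega x -> [/\ B (sqd K x) = 0, d1 (fun x => B (sqd K x)) x = 0 & d2 (fun x => B (sqd K x)) x = 0].
  by move=> nx; apply: (C1c_outside Hf) => h; have [_ _ _ _ sub] := Hf; exact/nx/sub.
pose phi x := B (sqd K x); rewrite -/phi in b1 b2 E0 out bf.
have bg (k : R * R -> R) : bmc k -> bmc (fun x => k x * gauss x) by move=> bk; apply: bmc_cont => //; exact: gauss_cont.
have bs (k : R * R -> R) : bmc k -> bmc (fun x => k x * k x).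
  by move=> bk; have := bmc_sq bk; under eq_fun do rewrite expr2.
have drop k l : (forall x, ~ Omega x -> k x * l x = 0) -> ip Omega k l = I2 (fun x => k x * l x * gauss x).
  move=> kl; rewrite /ip I2_mkcond; congr (I2 _); apply/funext => x; rewrite indicE.
  have [xO|nO] := pselect (Omega x); first by rewrite mem_set// mulr1.
  by rewrite kl// !mul0r.
have e1 : ip Omega phi (cst 1) = I2 (fun x => phi x * gauss x).
  rewrite drop; first by congr (I2 _); apply/funext => x; rewrite mulr1.
  by move=> x /out[h _ _]; rewrite /phi h mul0r.
have e2 : ip Omega (d1 phi) (d1 phi) = I2 (fun x => d1 phi x * d1 phi x * gauss x).
  by apply: drop => x /out[_ h _]; rewrite h mul0r.
have e3 : ip Omega (d2 phi) (d2 phi) = I2 (fun x => d2 phi x * d2 phi x * gauss x).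
  by apply: drop => x /out[_ _ h]; rewrite h mul0r.
apply: etrans (f_equal2 (fun x y => 2 * x - y) e1 (f_equal2 +%R e2 e3)) _.
rewrite -I2Z; last exact: bg.
have eD := I2D (bg _ (bs _ b1)) (bg _ (bs _ b2)).
have eB := I2B (bmcZ 2 (bg _ bf)) (bmcD (bg _ (bs _ b1)) (bg _ (bs _ b2))).
rewrite -eD -eB; congr (I2 _); apply/funext => x; have := E0 x; rewrite -/phi => -[-> ->].
have sq : sqd K x = (resid K x).1 * (resid K x).1 + (resid K x).2 * (resid K x).2 by [].
rewrite /f /test_density Dp_qexp enormE -/(sqd K x) /phi.
have -> : (enorm (resid K x) * qexp (sqd K x) * cutoff (rho - 2 * del) del (enorm (resid K x))) ^+ 2 =
  (2 * b (sqd K x)) ^+ 2 * sqd K x.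
  have -> : b (sqd K x) = 2^-1 * qexp (sqd K x) * cutoff (rho - 2 * del) del (enorm (resid K x)) by [].
  move: (qexp _) (cutoff _ _ _) => q c; have -> : sqd K x = enorm (resid K x) ^+ 2 by rewrite enormE.
  by field.
rewrite /b sq /= /GRing.scale/=; ring.
Qed.

End test_function.

(** * Lower bound for the torsion of a parallel body *)

Section torsion_lower.
Context {R : realType}.
Notation mu := (@lebesgue_measure R).

(** The first term is the rigidity of the disk of radius [rho] and the second the gain due to [K].
    The losses come from the cut-off layer, proportional to [del], and from [gauss_steiner],
    proportional to [ka ^+ 2]. *)
Lemma torsion_lower (K Omega : set (R * R)) (rho r del ka R1 L : R) :
  0 < rho -> rho <= r -> 0 < del -> 2 * del < rho ->
  ccn K -> 0 < ka -> K `<=` disk ka -> ka <= R1 -> ka * (r + R1) <= 2^-1 ->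
  0 <= mwidth K -> mwidth K * r <= 2 * pi ->
  open Omega -> 0 < L -> Omega `<=` box L -> (forall x, sqd K x < rho ^+ 2 -> Omega x) ->
  \int[mu]_(s in `[0, rho]) kp s + (2 * pi)^-1 * (mwidth K * kp rho) -
    4 * del * Dp r * (mwidth K + 2 * pi * r) * r -
    (2 * (r * Dp r) + Dp r ^+ 2) * ((2 * (r + R1) ^+ 2 + 1) * (2 * (r + R1)) ^+ 2 + (2 * r) ^+ 2) * ka ^+ 2
  <= Tgamma Omega.
Proof.
move=> rho0 rhor del0 dr cK ka0 Kka kR kY p0 pr oO L0 OL KO.
have M0 : 0 < rho - del by lra.
have Mr : rho - del <= r by lra.
have cb : continuous (test_slope rho del) by exact: test_slope_cont.
have b0 := test_slope_ge0 rho del.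
have bM := test_slope_eq0 del0 dr.
have [B [dB BM cB B0]] := profile_primitive cb b0 bM.
have Hf : C1c Omega (fun x => B (sqd K x)).
  apply: (kappa_C1c cK cb dB M0 BM) => x xM; apply: KO; apply: le_lt_trans xM _.
  by rewrite ltr_pXn2r ?nnegrE//; lra.
apply: le_trans (Tgamma_energy oO L0 OL Hf).
rewrite (test_energy dB cK oO OL Hf).
have [G0 dG0] := antideriv (@Dp_cont R).
pose G s := G0 rho - G0 s.
have dG (s : R) : is_derive s 1 G (- Dp s) by apply: deq (derB (derC _ _) (dG0 s)) _; rewrite sub0r.
have Gr : G rho = 0 by rewrite /G subrr.
have rb := radial_bound rho0 rhor del0 dr dB BM dG Gr p0 pr.
have cf := @test_density_cont _ _ _ _ dB.
have gs := gauss_steiner cK ka0 Kka cf M0 Mr (test_density_eq0 del0 dr BM)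
  (test_density0 rho del B0) (test_density_bound rho0 rhor del0 dr dB BM B0) kR kY.
apply: le_trans gs; rewrite lerD2r.
have piP : 0 < 2 * pi :> R by rewrite mulr_gt0// pi_gt0.
have i0 : 0 <= (2 * pi)^-1 :> R by rewrite invr_ge0 ltW.
have i1 : (2 * pi)^-1 <= 1 :> R by rewrite invf_le1//; have := @pi_ge2 R; lra.
apply: le_trans (ler_wpM2l i0 rb).
set T := \int[mu]_(s in _) kp s; set E := 4 * del * _ * _ * r; set q := mwidth K * kp rho.
have -> : (2 * pi)^-1 * (q + 2 * pi * T - E) = T + (2 * pi)^-1 * q - (2 * pi)^-1 * E.
  by move: (2 * pi) (lt0r_neq0 piP) => P P0; field.
rewrite lerD2l lerN2 ler_piMl// /E.
have Dr : 0 <= Dp r by apply: Dp_ge0; lra.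
have rr : 0 <= pi * r by apply: mulr_ge0; [exact: pi_ge0|lra].
apply: mulr_ge0; last lra.
by apply: mulr_ge0; [apply: mulr_ge0 => //; lra|lra].
Qed.

End torsion_lower.

(** * First-order expansion *)

Section radial_solution.
Context {R : realType}.

(* The ODE makes [s u'(s) e^{-s^2/2} - e^{-s^2/2}] a constant [A]; if [1 + A] were
   nonzero, [u] would be logarithmic at 0. *)
Lemma u2_derive1 (u : R -> R) (r : R) : is_u2 u -> 0 < r -> derive1 u r = - Dp r.
Proof.
move=> [du ode u0 ulim] r0; set v := derive1 u.
have dv (s : R) : 0 < s -> is_derive s 1 v (- 1 - s^-1 * v s + s * v s).
  move=> s0; have [_ d] := du s s0.
  apply: DeriveDef => //; rewrite -derive1E; have := ode s s0; rewrite -/v; lra.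
have du' (s : R) : 0 < s -> is_derive s 1 u (v s).
  by move=> s0; have [d _] := du s s0; apply: DeriveDef => //; rewrite -derive1E.
pose z s := s * v s * Eg s - Eg s.
have dz (s : R) : 0 < s -> is_derive s 1 z 0.
  move=> s0; apply: deq (derB (derM (derM (derI s) (dv s s0)) (Eg_deriv s)) (Eg_deriv s)) _.
  by field; exact: lt0r_neq0.
have zlt (a b : R) : 0 < a -> a < b -> z a = z b.
  move=> a0 ab; have cz : {within `[a, b], continuous z}.
    apply: derivable_within_continuous => x; rewrite in_itv/= => /andP[ax _].
    by have [] := dz x (lt_le_trans a0 ax).
  have [|c _] := @MVT R z (fun=> 0) a b ab _ cz.
    by move=> x; rewrite in_itv/= => /andP[ax _]; apply: dz; lra.
  by rewrite mul0r => /eqP; rewrite subr_eq0 => /eqP.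
have zc (a b : R) : 0 < a -> 0 < b -> z a = z b.
  move=> a0 b0; case: (ltgtP a b) => [h|h|->//]; first exact: zlt.
  by apply/esym; exact: zlt.
pose A := z r.
have vE (s : R) : 0 < s -> v s = (1 + A) / s + A * Dp s.
  move=> s0; have zs : s * v s * Eg s - Eg s = A by exact: zc.
  have e1 : s * v s = 1 + A * expR (s ^+ 2 / 2).
    have e0 := Eg_gt0 s; apply: (mulIf (lt0r_neq0 e0)).
    by rewrite mulrDl -(mulrA A) expR_Eg -zs; ring.
  have -> : v s = (s * v s) / s by field; exact: lt0r_neq0.
  by rewrite e1 /Dp; field; exact: lt0r_neq0.
suff A1 : 1 + A = 0.
  have A2 : A = - 1 by lra.
  by rewrite (vE r r0) A1 mul0r add0r A2 mulN1r.
have D1 : 0 <= Dp (1 : R) by exact: Dp_ge0.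
(* By the mean value theorem on [h / 2, h], 1 + A is c (u'(c) - A Dp c) for some c <= h; the 4
   bounds the difference quotient of [u], and the rest bounds A Dp c. *)
pose k := 4 + `|A| * Dp 1.
have k0 : 0 < k by have := mulr_ge0 (normr_ge0 A) D1; rewrite /k; lra.
have [e e0 He] : exists2 e : R, 0 < e & forall h, 0 < h -> h < e -> `|u h| <= h.
  have /cvgrPdist_lt/(_ _ (@ltr01 R)) := ulim.
  rewrite near_withinE => /nbhs_ballP[e /= e0 He]; exists e => // h h0 he.
  have := He h; rewrite /ball/= sub0r normrN gtr0_norm// => /(_ he) /(_ h0).
  rewrite u0 subr0 sub0r normrN normrM normfV (gtr0_norm h0) => /ltW.
  by rewrite ler_pdivrMr// mul1r.
have small (h : R) : 0 < h -> h < e -> h <= 1 -> `|1 + A| <= h * k.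
  move=> h0 he h1; have h2 : h / 2 < h by lra.
  have cu : {within `[h / 2, h], continuous u}.
    apply: derivable_within_continuous => x; rewrite in_itv/= => /andP[ax _].
    by have [] := du' x ltac:(lra).
  have [|c /[!in_itv]/= /andP[c1 c2] hc] := @MVT R u v (h / 2) h h2 _ cu.
    by move=> x; rewrite in_itv/= => /andP[ax _]; apply: du'; lra.
  have c0 : 0 < c by lra.
  have E : 1 + A = c * (2 / h * (u h - u (h / 2)) - A * Dp c).
    by rewrite hc vE//; field; rewrite !lt0r_neq0.
  have b1 := He h h0 he; have b2 := He (h / 2) ltac:(lra) ltac:(lra).
  have D0 : Dp c <= Dp 1 by apply: Dp_mono; lra.
  rewrite E normrM (gtr0_norm c0); apply: ler_pM => //; [exact: ltW|exact: ltW|].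
  apply: le_trans (ler_normB _ _) _; rewrite /k; apply: lerD.
    rewrite normrM (gtr0_norm (_ : 0 < 2 / h)) ?divr_gt0//.
    have : `|u h - u (h / 2)| <= 2 * h by apply: le_trans (ler_normB _ _) _; lra.
    move=> q; apply: (@le_trans _ _ (2 / h * (2 * h))).
      by rewrite ler_pM2l// divr_gt0.
    by rewrite le_eqVlt; apply/orP; left; apply/eqP; field; exact: lt0r_neq0.
  by rewrite normrM (ger0_norm (Dp_ge0 (ltW c0))) ler_wpM2l.
apply/eqP; rewrite -normr_le0 leNgt; apply/negP => n0.
pose h := Num.min (Num.min 1 (e / 2)) (`|1 + A| / (2 * k)).
have h0 : 0 < h by rewrite !lt_min ltr01 !divr_gt0// mulr_gt0.
have h1 : h <= 1 by rewrite /h !ge_min lexx.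
have he : h < e by apply: (@le_lt_trans _ _ (e / 2)); [rewrite /h !ge_min lexx orbT|lra].
have hk : h * (2 * k) <= `|1 + A|.
  by rewrite -ler_pdivlMr ?mulr_gt0// /h ge_min lexx orbT.
have := small h h0 he h1; have := mulr_gt0 h0 k0; lra.
Qed.

End radial_solution.

(** * Minkowski combinations with a disk *)

Section minkowski.
Context {R : realType}.
Notation mu := (@lebesgue_measure R).

Lemma scale_shrink (t : R) (K : set (R * R)) : scale_set t K = shrink K (1 - t) 0.
Proof.
rewrite /scale_set /shrink; congr image; apply/funext => k.
by rewrite scaler0 addr0 subKr.
Qed.

Lemma enorm_scale (t : R) (x : R * R) : 0 <= t -> enorm (t *: x) = t * enorm x.
Proof.
move=> t0; rewrite /enorm dotpZl dotpZr mulrA -expr2 sqrtrM ?sqr_ge0//.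
by rewrite sqrtr_sqr ger0_norm.
Qed.

Lemma support_bounds (K : set (R * R)) (R1 : R) : ccn K -> K `<=` disk R1 -> K 0 ->
  0 <= mwidth K <= 2 * pi * R1.
Proof.
move=> cK KR K0; have R10 : 0 <= R1.
  by apply: le_trans (KR _ K0); exact: enorm_ge0.
apply/andP; split.
  apply: Rintegral_ge0 => th _; rewrite support_funE.
  have -> : 0 = dotp 0 (cos th, sin th) :> R by rewrite /dotp /= !mul0r addr0.
  exact: hsup_ge.
rewrite -(mwidth_disk R10); apply: le_Rintegral => //.
- exact: (integrable_cont _ _ (support_cont cK)).
- exact: (integrable_cont _ _ (support_cont (disk_ccn R10))).
move=> th _; rewrite disk_support// support_funE; apply: hsup_le => // z Kz.
apply: le_trans (dotp_le _ _) _; rewrite -/(udir th) {2}/enorm udir_unit sqrtr1 mulr1.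
exact: KR.
Qed.

Lemma mean_support (K : set (R * R)) (r : R) : ccn K -> 0 <= r ->
  \int[mu]_(th in `[0, 2 * pi]) (support_fun K th - r) = mwidth K - 2 * pi * r.
Proof.
move=> cK r0; rewrite -(mwidth_disk r0) /mwidth -RintegralB//.
- by apply: eq_Rintegral => th _; rewrite disk_support.
- exact: (integrable_cont _ _ (support_cont cK)).
- exact: (integrable_cont _ _ (support_cont (disk_ccn r0))).
Qed.

(** [torsion_lower] for the scaled body [scale_set t K], [rho = (1 - t) * r] and [ka = t * R1]. The
    bound on t keeps [rho] at least r / 2 and ka (r + R1) at most 1 / 2. *)
Lemma torsion_expansion (r R1 : R) : 0 < r -> 0 < R1 -> exists t1 C : R, [/\ 0 < t1, 0 < C &
  forall K, ccn K -> K `<=` disk R1 -> K 0 -> forall t, 0 < t <= t1 ->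
    \int[mu]_(s in `[0, r]) kp s + kp r * ((2 * pi)^-1 * (mwidth K - 2 * pi * r)) * t - C * t ^+ 2 <=
    Tgamma_body (sum_set (scale_set (1 - t) (disk r)) (scale_set t K))].
Proof.
move=> r0 R10; have [Ck Ck0 klip] := kp_lip (ltW r0).
have Dr := Dp_ge0 (ltW r0).
pose F1 := 2 * (r * Dp r) + Dp r ^+ 2.
pose Cg := (2 * (r + R1) ^+ 2 + 1) * (2 * (r + R1)) ^+ 2 + (2 * r) ^+ 2.
have piP := pi_gt0 R.
have F10 : 0 <= F1 by have := sqr_ge0 (Dp r); have := mulr_ge0 (ltW r0) Dr; rewrite /F1; lra.
have Cg0 : 0 <= Cg.
  have := sqr_ge0 (r + R1); have := sqr_ge0 (2 * r) => h1 h2.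
  have : 0 <= (2 * (r + R1) ^+ 2 + 1) * (2 * (r + R1)) ^+ 2 by apply: mulr_ge0 (sqr_ge0 _); lra.
  by rewrite /Cg; lra.
pose C3 := 2 * r * Dp r * (2 * pi + 2 * pi * r ^+ 2).
have pr2 : 0 <= pi * r ^+ 2 by rewrite mulr_ge0 ?ltW// exprn_gt0.
have C30 : 0 <= C3.
  by apply: mulr_ge0; [apply: mulr_ge0 => //; lra|lra].
(* In order: the Taylor remainder of the weight, the cut-off layer, the replacement of [kp rho] by
   [kp r], and 1 to make the constant positive. *)
pose C := F1 * Cg * R1 ^+ 2 + C3 + R1 * Ck * r + 1.
have q1 : 0 <= F1 * Cg * R1 ^+ 2 by apply: mulr_ge0 (sqr_ge0 _); exact: mulr_ge0.
have q2 : 0 <= R1 * Ck * r by apply: mulr_ge0 (ltW r0); exact: mulr_ge0 (ltW R10) Ck0.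
have Y0 : 0 < R1 * (r + R1) by apply: mulr_gt0; lra.
exists (Num.min 2^-1 (2^-1 / (R1 * (r + R1)))), C; split.
- by rewrite lt_min invr_gt0 ltr0n /= divr_gt0.
- by rewrite /C; lra.
move=> K cK KR K0 t /andP[t0]; rewrite le_min => /andP[th]; rewrite ler_pdivlMr// => tY.
have /andP[P0 P1] := support_bounds cK KR K0.
rewrite /Tgamma_body; set Ot := sum_set _ _; set O := Ot°.
have oO : open O by exact: open_interior.
have t01 : 0 <= 1 - t by lra.
have OL : O `<=` box (r + R1).
  apply: subset_trans (@interior_subset _ _) _.
  move=> _ [_ [u ur <-] [_ [w wK <-] <-]].
  have /disk_box/in_box[u1 u2] := ur; have /KR/disk_box/in_box[w1 w2] := wK.
  have hh (a b : R) : `|a| <= r -> `|b| <= R1 -> `|(1 - t) * a + t * b| <= r + R1.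
    move=> ha hb; apply: le_trans (ler_normD _ _) _; rewrite !normrM (ger0_norm t01) (gtr0_norm t0).
    have k1 : (1 - t) * `|a| <= 1 * r by apply: ler_pM => //; lra.
    have k2 : t * `|b| <= 1 * R1 by apply: ler_pM => //; lra.
    by lra.
  by apply/in_box; split; apply: hh.
pose rho := (1 - t) * r.
have rho0 : 0 < rho by apply: mulr_gt0 => //; lra.
have rhor : rho <= r by rewrite /rho ler_piMl ?ltW//; lra.
have rho2 : r / 2 <= rho by rewrite /rho mulrC; apply: ler_pM; lra.
(* Of order t^2, so that the cut-off costs no more than the other errors; 2 del = t^2 r <= r / 4
   stays below [rho], which is at least r / 2. *)
pose del := t ^+ 2 * r / 2.
have t2 : 0 < t ^+ 2 by rewrite exprn_gt0.
have t4 : t ^+ 2 <= 4^-1 by rewrite expr2; have : t * t <= 2^-1 * 2^-1 by [apply: ler_pM; lra]; lra.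
have del0 : 0 < del by rewrite /del !mulr_gt0.
have tr4 : t ^+ 2 * r <= 4^-1 * r by rewrite ler_pM2r.
have delrho : 2 * del < rho by rewrite /del; lra.
pose Kt := scale_set t K.
have cKt : ccn Kt by rewrite /Kt scale_shrink; exact: shrink_ccn.
have mKt : mwidth Kt = t * mwidth K.
  by rewrite /Kt scale_shrink shrink_mwidth// ?subKr//; apply/andP; split; lra.
have ka0 : 0 < t * R1 by exact: mulr_gt0.
have Kka : Kt `<=` disk (t * R1).
  move=> _ [k Kk <-]; rewrite /disk /= enorm_scale; last exact: ltW.
  by rewrite ler_pM2l//; exact: KR.
have kR : t * R1 <= R1 by rewrite ler_piMl ?ltW//; lra.
have kY : t * R1 * (r + R1) <= 2^-1 by rewrite -mulrA.
have p0 : 0 <= mwidth Kt by rewrite mKt mulr_ge0// ltW.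
have tr1 : t * R1 * r <= 2^-1.
  apply: le_trans kY; rewrite mulrDr lerDl mulr_ge0// ltW//.
have pr : mwidth Kt * r <= 2 * pi.
  rewrite mKt; apply: (@le_trans _ _ (t * (2 * pi * R1) * r)).
    by rewrite ler_pM2r// ler_pM2l.
  have -> : t * (2 * pi * R1) * r = 2 * pi * (t * R1 * r) by ring.
  by rewrite ler_piMr//; lra.
(* The strict inequality defines an open set, so it suffices to place it in the Minkowski sum: the
   residual goes to the scaled disk, the foot to [Kt]. *)
have KO x : sqd Kt x < rho ^+ 2 -> O x.
  have oU : open [set x | sqd Kt x < rho ^+ 2].
    apply: (@open_comp _ _ (sqd Kt) [set s | s < rho ^+ 2]); last exact: open_lt.
    by move=> y _; exact: sqd_cont.
  move: x; change ([set x | sqd Kt x < rho ^+ 2] `<=` O); rewrite /O -open_subsetE// => y /= yr.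
  have [pK _] := projP y cKt.
  exists (resid Kt y); last by exists (cproj Kt y) => //; rewrite /resid subrK.
  exists ((1 - t)^-1 *: resid Kt y); last first.
    by rewrite scalerA mulfV ?scale1r//; lra.
  rewrite /disk /= enorm_scale ?invr_ge0// ler_pdivrMl; last lra.
  by rewrite -(@ler_pXn2r _ 2) ?nnegrE ?enorm_ge0 ?(ltW rho0)// enormE ltW.
have main := torsion_lower rho0 rhor del0 delrho cKt ka0 Kka kR kY p0 pr oO (addr_gt0 r0 R10) OL KO.
apply: le_trans main; rewrite mKt -/F1 -/Cg.
have kc := @kp_cont R.
(* [kp] is nondecreasing, so the annulus of width t r removed from the disk costs at most t r
   [kp r]; this is the - r in the factor M. *)
have tau : \int[mu]_(s in `[0, r]) kp s <= \int[mu]_(s in `[0, rho]) kp s + t * r * kp r.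
  rewrite (Rint_split kc (ltW rho0) rhor) lerD2l.
  have dc : forall x : R, is_derive x 1 (fun x => kp r * x) (cst (kp r) x).
    by move=> x; apply: (deq (derZ (kp r) (derI x))); rewrite mulr1.
  have ccst : continuous (cst (kp r) : R -> R) by move=> ?; exact: cvg_cst.
  apply: (@le_trans _ _ (\int[mu]_(s in `[rho, r]) cst (kp r) s)).
    apply: le_Rintegral => //; [exact: (integrable_cont _ _ kc)|exact: (integrable_cont _ _ ccst)|].
    by move=> s; rewrite /= in_itv/= => /andP[s0 s1]; apply: kp_mono => //; lra.
  by rewrite (Rint_FTC rhor ccst dc) le_eqVlt; apply/orP; left; apply/eqP; rewrite /rho; ring.
set T0 := \int[mu]_(s in `[0, r]) _ in tau *; set T1 := \int[mu]_(s in `[0, rho]) _ in tau *.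
have kl := klip rho (ltW rho0) rhor.
have rt : r - rho = t * r by rewrite /rho; ring.
rewrite rt in kl.
pose q := (2 * pi)^-1 * mwidth K.
have pi2 : 0 < 2 * pi :> R by lra.
have qR : q <= R1 by rewrite /q mulrC ler_pdivrMr//; lra.
have qq0 : 0 <= q by rewrite mulr_ge0// invr_ge0 ltW.
have s1 : q * (t * (kp r - kp rho)) <= R1 * (t * (Ck * (t * r))).
  apply: (@le_trans _ _ (q * (t * (Ck * (t * r))))); first by rewrite ler_wpM2l// ler_pM2l.
  apply: ler_wpM2r qR; apply: mulr_ge0; first exact: ltW.
  by apply: mulr_ge0 => //; apply: mulr_ge0; exact: ltW.
have s2 : 4 * del * Dp r * (t * mwidth K + 2 * pi * r) * r <= C3 * t ^+ 2.
  have -> : 4 * del * Dp r * (t * mwidth K + 2 * pi * r) * r =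
     2 * t ^+ 2 * r * Dp r * (t * mwidth K * r + 2 * pi * r ^+ 2) by rewrite /del; field.
  have -> : C3 * t ^+ 2 = 2 * t ^+ 2 * r * Dp r * (2 * pi + 2 * pi * r ^+ 2) by rewrite /C3; ring.
  apply: ler_wpM2l; first by apply: mulr_ge0 => //; apply: mulr_ge0; lra.
  by rewrite lerD2r -mKt.
have e1 : (2 * pi)^-1 * (mwidth K - 2 * pi * r) = q - r.
  by rewrite mulrBr -/q mulrA mulVf ?mul1r// lt0r_neq0.
have e2 : (2 * pi)^-1 * (t * mwidth K * kp rho) = t * (q * kp rho) by rewrite /q; ring.
rewrite e1 e2 /C exprMn.
move: s1 s2 tau; set S := 4 * del * _ * _ * r.
have := ltW t2; move: (kp r) (kp rho) => k1 k2; rewrite !expr2; nra.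
Qed.

End minkowski.

Theorem proposition3p3 (R : realType) (r R1 : R) (r_gt0 : 0 < r)
    (R1_gt0 : 0 < R1) :
  exists t1 C : R, [/\ 0 < t1, 0 < C &
    forall (u2 : R -> R) (Omega1 : set (R * R)),
      is_u2 u2 -> convex_body Omega1 -> Omega1 `<=` disk R1 ->
      Omega1 (0, 0) ->
      let M := (2 * pi)^-1 *
        \int[@lebesgue_measure R]_(theta in `[0, 2 * pi])
          (support_fun Omega1 theta - r) in
      let c := r * (derive1 u2 r) ^+ 2 * expR (- r ^+ 2 / 2) in
      let Omega t := sum_set (scale_set (1 - t) (disk r)) (scale_set t Omega1) in
      [/\ M%:E = ((perimeter Omega1 - perimeter (disk r)) * ((2 * pi)^-1)%:E)%E,
          forall t, 0 < t <= t1 ->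
            Tgamma_body (Omega t) >=
              Tgamma_body (disk r) + c * M * t - C * t ^+ 2 &
          ((2 * pi * r)%:E < perimeter Omega1)%E ->
            \forall t \near 0^'+,
              Tgamma_body (Omega t) > Tgamma_body (disk r)]].
Proof.
have [t1 [C [t10 C0 key]]] := torsion_expansion r_gt0 R1_gt0.
exists t1, C; split => // u2 Omega1 Hu2 bO OR O0 M c Omega.
have cO := convex_body_ccn bO; have r0 := ltW r_gt0.
have cE : c = kp r by rewrite /c (u2_derive1 Hu2 r_gt0) sqrrN.
have ME : M = (2 * pi)^-1 * (mwidth Omega1 - 2 * pi * r) by rewrite /M mean_support.
have expansion t : 0 < t <= t1 ->
    Tgamma_body (disk r) + c * M * t - C * t ^+ 2 <= Tgamma_body (Omega t).
  move=> ht; apply: le_trans (key Omega1 cO OR O0 t ht).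
  by rewrite cE ME lerD2r lerD2r; exact: Tgamma_disk_le.
split => //.
  rewrite (perimeterE bO) (perimeterE (disk_convex_body r_gt0)) mwidth_disk// ME.
  by rewrite -EFinB -EFinM mulrC.
rewrite (perimeterE bO) lte_fin => rP.
have M0 : 0 < M by rewrite ME mulr_gt0 ?subr_gt0// invr_gt0 mulr_gt0// pi_gt0.
have c0 : 0 < c.
  by rewrite cE /kp mulr_gt0 ?Eg_gt0// mulr_gt0// exprn_gt0// Dp_gt0.
have cM0 : 0 < c * M := mulr_gt0 c0 M0.
near=> t; have t0 : 0 < t by near: t; exact: nbhs_right_gt.
have tt1 : t <= t1 by near: t; exact: nbhs_right_le.
(* From here on the quadratic loss C t^2 is smaller than the linear gain c M t. *)
have tC : t < c * M / C by near: t; apply: nbhs_right_lt; exact: divr_gt0.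
apply: lt_le_trans (expansion t _); last by rewrite t0 tt1.
rewrite -addrA ltrDl subr_gt0 expr2 mulrA ltr_pM2r//.
by rewrite mulrC -ltr_pdivlMr.
Unshelve. all: by end_near. Qed.
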